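(* The maximum size of a pure partial plane of order $6$ is $25$. That is, every pure partial plane of order $6$ has at most $25$ lines, and pure partial planes of order $6$ with $25$ lines exist. Furthermore, every pure partial plane of order $6$ and size $25$ is isomorphic to one of the following four (on the point set $\{0,1,\ldots,42\}$): $P_1$: $\{0,1,2,3,4,5,6\}$, $\{0,7,8,9,10,11,12\}$, $\{0,13,14,15,16,17,18\}$, $\{0,19,20,21,22,23,24\}$, $\{0,25,26,27,28,29,30\}$, $\{0,31,32,33,34,35,36\}$, $\{0,37,38,39,40,41,42\}$, $\{1,7,13,19,25,31,37\}$, $\{1,8,14,20,26,32,38\}$, $\{1,9,15,21,27,33,39\}$, $\{1,10,16,22,28,34,40\}$, $\{1,11,17,23,29,35,41\}$, $\{1,12,18,24,30,36,42\}$, $\{2,7,14,21,28,35,42\}$, $\{2,8,13,22,27,36,41\}$, $\{2,9,16,23,30,31,38\}$, $\{2,10,15,24,29,32,37\}$, $\{2,11,18,19,26,34,39\}$, $\{2,12,17,20,25,33,40\}$, $\{3,7,15,20,30,34,41\}$, $\{3,9,14,19,29,36,40\}$, $\{3,10,13,23,26,33,42\}$, $\{4,7,18,22,29,33,38\}$, $\{4,11,13,21,30,32,40\}$, $\{4,12,14,23,27,34,37\}$. $P_2$: the same first $22$ lines as $P_1$ (i.e. all lines of $P_1$ from $\{0,1,2,3,4,5,6\}$ through $\{3,10,13,23,26,33,42\}$), together with $\{4,7,18,23,27,32,40\}$, $\{4,11,14,22,30,33,37\}$, $\{4,12,13,21,29,34,38\}$. $P_3$: $\{0,1,2,3,4,5,6\}$,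 $\{0,7,8,9,10,11,12\}$, $\{0,13,14,15,16,17,18\}$, $\{0,19,20,21,22,23,24\}$, $\{0,25,26,27,28,29,30\}$, $\{0,31,32,33,34,35,36\}$, $\{0,37,38,39,40,41,42\}$, $\{1,7,13,19,25,31,37\}$, $\{1,8,14,20,26,32,38\}$, $\{1,9,15,21,27,33,39\}$, $\{1,10,16,22,28,34,40\}$, $\{1,11,17,23,29,35,41\}$, $\{1,12,18,24,30,36,42\}$, $\{2,7,14,21,28,35,42\}$, $\{2,8,13,22,27,36,41\}$, $\{2,9,17,19,30,32,40\}$, $\{2,10,18,23,25,33,38\}$, $\{2,11,16,24,26,31,39\}$, $\{2,12,15,20,29,34,37\}$, $\{3,7,15,23,26,36,40\}$, $\{3,8,17,24,28,33,37\}$, $\{3,11,13,21,30,34,38\}$, $\{4,7,16,20,30,33,41\}$, $\{4,8,18,21,29,31,40\}$, $\{4,12,13,23,28,32,39\}$. $P_4$: $\{0,1,2,15,16,17,18\}$, $\{0,3,4,19,20,21,22\}$, $\{0,5,6,23,24,25,26\}$, $\{0,7,8,27,28,29,30\}$, $\{0,9,10,31,32,33,34\}$, $\{1,3,5,27,31,35,36\}$, $\{1,4,6,28,32,37,38\}$, $\{1,11,12,19,23,29,33\}$, $\{1,13,14,20,24,30,34\}$, $\{2,7,9,19,24,35,37\}$, $\{2,8,10,20,23,36,38\}$, $\{2,11,13,21,25,27,32\}$, $\{2,12,14,22,26,28,31\}$, $\{3,7,11,15,26,34,38\}$, $\{3,8,14,16,25,33,37\}$, $\{3,9,13,17,23,28,39\}$,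 $\{4,8,11,18,24,31,39\}$, $\{4,9,12,15,25,30,36\}$, $\{4,10,13,16,26,29,35\}$, $\{5,7,12,16,20,32,39\}$, $\{5,9,14,18,21,29,38\}$, $\{5,10,11,17,22,30,37\}$, $\{6,7,13,18,22,33,36\}$, $\{6,8,12,17,21,34,35\}$, $\{6,10,14,15,19,27,39\}$.
   Context: A pure partial plane of order $n$ and size $s$ is a set $X$ of $n^2+n+1$ points together with a collection of $s$ distinct lines, each line being a subset of $X$ of cardinality $n+1$, such that any two distinct lines intersect in exactly one point. (Some points may lie on no line.) Two pure partial planes are isomorphic if there are a bijection between their point sets and a bijection between their line sets preserving the point-in-line incidence relation. *)

(* Defs.v *)
From mathcomp Require Import all_boot.

Set Implicit Arguments.
Unset Strict Implicit.
Unset Printing Implicit Defensive.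

Definition pure_partial_plane (n s : nat) (X : finType) (L : {set {set X}}) :
    Prop :=
  [/\ #|X| = n ^ 2 + n + 1,
      #|L| = s,
      forall l : {set X}, l \in L -> #|l| = n + 1
    & forall l m : {set X}, l \in L -> m \in L -> l != m -> #|l :&: m| = 1].

(* [g] is a bijection between the two sets of lines; its values on subsets of *)
(* [X] that are not lines are irrelevant.                                     *)
Definition ppp_isomorphic (X Y : finType) (L : {set {set X}})
    (M : {set {set Y}}) : Prop :=
  exists (f : X -> Y) (g : {set X} -> {set Y}),
    [/\ bijective f,
        {in L &, injective g},
        g @: L = M
      & forall (x : X) (l : {set X}), l \in L -> (f x \in g l) = (x \in l)].

Definition lines_of (s : seq (seq nat)) : {set {set 'I_43}} :=
  [set:: [seq [set i : 'I_43 | val i \in l] | l <- s]].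

Definition common_lines12 : seq (seq nat) :=
  [:: [:: 0; 1; 2; 3; 4; 5; 6];
      [:: 0; 7; 8; 9; 10; 11; 12];
      [:: 0; 13; 14; 15; 16; 17; 18];
      [:: 0; 19; 20; 21; 22; 23; 24];
      [:: 0; 25; 26; 27; 28; 29; 30];
      [:: 0; 31; 32; 33; 34; 35; 36];
      [:: 0; 37; 38; 39; 40; 41; 42];
      [:: 1; 7; 13; 19; 25; 31; 37];
      [:: 1; 8; 14; 20; 26; 32; 38];
      [:: 1; 9; 15; 21; 27; 33; 39];
      [:: 1; 10; 16; 22; 28; 34; 40];
      [:: 1; 11; 17; 23; 29; 35; 41];
      [:: 1; 12; 18; 24; 30; 36; 42];
      [:: 2; 7; 14; 21; 28; 35; 42];
      [:: 2; 8; 13; 22; 27; 36; 41];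
      [:: 2; 9; 16; 23; 30; 31; 38];
      [:: 2; 10; 15; 24; 29; 32; 37];
      [:: 2; 11; 18; 19; 26; 34; 39];
      [:: 2; 12; 17; 20; 25; 33; 40];
      [:: 3; 7; 15; 20; 30; 34; 41];
      [:: 3; 9; 14; 19; 29; 36; 40];
      [:: 3; 10; 13; 23; 26; 33; 42]].

Definition P1 : {set {set 'I_43}} := lines_of (common_lines12 ++
  [:: [:: 4; 7; 18; 22; 29; 33; 38];
      [:: 4; 11; 13; 21; 30; 32; 40];
      [:: 4; 12; 14; 23; 27; 34; 37]]).

Definition P2 : {set {set 'I_43}} := lines_of (common_lines12 ++
  [:: [:: 4; 7; 18; 23; 27; 32; 40];
      [:: 4; 11; 14; 22; 30; 33; 37];
      [:: 4; 12; 13; 21; 29; 34; 38]]).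

Definition P3 : {set {set 'I_43}} := lines_of
  [:: [:: 0; 1; 2; 3; 4; 5; 6];
      [:: 0; 7; 8; 9; 10; 11; 12];
      [:: 0; 13; 14; 15; 16; 17; 18];
      [:: 0; 19; 20; 21; 22; 23; 24];
      [:: 0; 25; 26; 27; 28; 29; 30];
      [:: 0; 31; 32; 33; 34; 35; 36];
      [:: 0; 37; 38; 39; 40; 41; 42];
      [:: 1; 7; 13; 19; 25; 31; 37];
      [:: 1; 8; 14; 20; 26; 32; 38];
      [:: 1; 9; 15; 21; 27; 33; 39];
      [:: 1; 10; 16; 22; 28; 34; 40];
      [:: 1; 11; 17; 23; 29; 35; 41];
      [:: 1; 12; 18; 24; 30; 36; 42];
      [:: 2; 7; 14; 21; 28; 35; 42];
      [:: 2; 8; 13; 22; 27; 36; 41];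
      [:: 2; 9; 17; 19; 30; 32; 40];
      [:: 2; 10; 18; 23; 25; 33; 38];
      [:: 2; 11; 16; 24; 26; 31; 39];
      [:: 2; 12; 15; 20; 29; 34; 37];
      [:: 3; 7; 15; 23; 26; 36; 40];
      [:: 3; 8; 17; 24; 28; 33; 37];
      [:: 3; 11; 13; 21; 30; 34; 38];
      [:: 4; 7; 16; 20; 30; 33; 41];
      [:: 4; 8; 18; 21; 29; 31; 40];
      [:: 4; 12; 13; 23; 28; 32; 39]].

Definition P4 : {set {set 'I_43}} := lines_of
  [:: [:: 0; 1; 2; 15; 16; 17; 18];
      [:: 0; 3; 4; 19; 20; 21; 22];
      [:: 0; 5; 6; 23; 24; 25; 26];
      [:: 0; 7; 8; 27; 28; 29; 30];
      [:: 0; 9; 10; 31; 32; 33; 34];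
      [:: 1; 3; 5; 27; 31; 35; 36];
      [:: 1; 4; 6; 28; 32; 37; 38];
      [:: 1; 11; 12; 19; 23; 29; 33];
      [:: 1; 13; 14; 20; 24; 30; 34];
      [:: 2; 7; 9; 19; 24; 35; 37];
      [:: 2; 8; 10; 20; 23; 36; 38];
      [:: 2; 11; 13; 21; 25; 27; 32];
      [:: 2; 12; 14; 22; 26; 28; 31];
      [:: 3; 7; 11; 15; 26; 34; 38];
      [:: 3; 8; 14; 16; 25; 33; 37];
      [:: 3; 9; 13; 17; 23; 28; 39];
      [:: 4; 8; 11; 18; 24; 31; 39];
      [:: 4; 9; 12; 15; 25; 30; 36];
      [:: 4; 10; 13; 16; 26; 29; 35];
      [:: 5; 7; 12; 16; 20; 32; 39];
      [:: 5; 9; 14; 18; 21; 29; 38];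
      [:: 5; 10; 11; 17; 22; 30; 37];
      [:: 6; 7; 13; 18; 22; 33; 36];
      [:: 6; 8; 12; 17; 21; 34; 35];
      [:: 6; 10; 14; 15; 19; 27; 39]].

(* Main.v *)
Require Import Defs.
From Stdlib Require Import BinNums PArith NArith Lia.
From mathcomp Require Import all_boot fingroup perm.

(** A point of degree [d] forces [6 * d + 1 <= 43] points, so degrees are at most
    [7].  A point [z] of degree [6] yields a further line, made of [z] and the
    points not collinear with it; hence a maximal set of lines has no such
    point.  For at least [25] lines, double counting on the points of a line
    gives a line [l0] with either three points of degree [5], or two points of
    degree [7] and a third one of degree at least [4].

    The lines through these three points (other than [l0]) form a seed.  Up to
    a permutation of the points, a seed is determined by which triples of its
    lines are concurrent.  These arrays of triples are enumerated up to
    symmetry, adding the lines through the third point one at a time.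

    A further line is determined by its points off [l0]: these form a 6-set
    meeting the lines of the seed in a prescribed way, two such 6-sets being
    disjoint or meeting once according to whether the lines meet on [l0] or
    not.  An exhaustive search over these 6-sets, run by evaluation, only finds
    copies of [P1], ..., [P4].  None of these can be extended by a line, so a
    maximal set of at least [25] lines is one of them, and has [25] lines. *)

Set Implicit Arguments.
Unset Strict Implicit.
Unset Printing Implicit Defensive.

(** The degrees along a line add up to the number of lines plus 6, hence to at least 31. If no
    degree exceeds 5, the excess of 31 over 7 * 4 forces three points of degree 5 on any line. If
    two points have degree 7, the five other points of their line share at least 17, so one of them
    has degree at least 4. A single point [z] of degree 7 is the delicate case: the right line must
    be found among those through [z], and this takes a second moment, the sum of the squares of the
    degrees.

    The enumerations rest on no trust in precomputed data. One principle, [conc_perm], turns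
    combinatorial data into permutations of the points and is used twice: it makes a verified model
    of a triple array as good as the actual seed, and it identifies a completed seed with a known
    plane although the search never decides through which points of [l0] the new lines pass. The
    search always stops at 25 lines, so it only shows that a maximal family contains one of the four
    planes; that it contains nothing more comes from a separate test on these planes. *)

(* Translates the boolean arithmetic of [ssrnat] for [lia]. *)
Ltac ssrlia :=
  intros; repeat match goal with
  | H : is_true (_ && _) |- _ => let H1 := fresh in let H2 := fresh in case/andP: H => H1 H2
  | H : is_true (_ || _) |- _ => case/orP: H => H
  | H : is_true (~~ (leq _ _)) |- _ => rewrite -ltnNge in H
  | H : leq _ _ = false |- _ => move/negbT: H => H
  | H : is_true (leq _ _) |- _ => move/leP: H => H
  | H : is_true (_ == _ :> nat) |- _ => move/eqP: H => H
  | H : is_true (_ != _ :> nat) |- _ => move/eqP: H => H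
  | |- is_true (_ && _) => apply/andP; split
  | |- is_true (leq _ _) => apply/leP
  | |- is_true (_ == _ :> nat) => apply/eqP
  | |- is_true (_ != _ :> nat) => apply/eqP
  | |- leq _ _ = false => apply/negbTE; rewrite -ltnNge
  end; cbv delta [addn subn muln] in *; lia.

(** * Exhaustive search on binary masks *)

(* A set of points is encoded by the binary number whose digits are its
   indicator function.  The tests below use [if] rather than [&&] so that they
   stay lazy under call-by-value evaluation. *)
Definition bit (m : N) (i : nat) : bool := N.testbit_nat m i.

Fixpoint pos_ge (n : nat) (p : positive) {struct p} : bool :=
  match n with
  | 0 => true
  | n'.+1 => match p with
             | xI p' => pos_ge n' p'
             | xO p' => pos_ge n p'
             | xH => if n' is 0 then true else false
             end
  end.
Definition mask_ge (n : nat) (m : N) : bool :=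
  match m with N0 => if n is 0 then true else false | Npos p => pos_ge n p end.

Fixpoint pos_single (p : positive) : bool :=
  match p with xH => true | xO p' => pos_single p' | xI _ => false end.
Definition single (m : N) : bool := if m is Npos p then pos_single p else false.
Definition null (m : N) : bool := if m is N0 then true else false.

Fixpoint pos_bits (p w : positive) : seq N :=
  match p with
  | xH => [:: Npos w]
  | xO p' => pos_bits p' (xO w)
  | xI p' => Npos w :: pos_bits p' (xO w)
  end.
Definition bits (m : N) : seq N := if m is Npos p then pos_bits p xH else [::].

Fixpoint ofbits (s : seq bool) : N :=
  match s with
  | [::] => N0
  | b :: s' => if b then N.succ_double (ofbits s') else N.double (ofbits s')
  end.

Fixpoint pos_disj (p q : positive) {struct p} : bool :=
  match p with
  | xH => match q with xO _ => true | _ => false end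
  | xO p' => match q with xH => true | xO q' => pos_disj p' q' | xI q' => pos_disj p' q' end
  | xI p' => match q with xH => false | xO q' => pos_disj p' q' | xI _ => false end
  end.
Fixpoint pos_meet1 (p q : positive) {struct p} : bool :=
  match p with
  | xH => match q with xO _ => false | _ => true end
  | xO p' => match q with xH => false | xO q' => pos_meet1 p' q' | xI q' => pos_meet1 p' q' end
  | xI p' => match q with xH => true | xO q' => pos_meet1 p' q' | xI q' => pos_disj p' q' end
  end.
Definition disj (a b : N) : bool :=
  match a with N0 => true | Npos p => match b with N0 => true | Npos q => pos_disj p q end end.
Definition meet1 (a b : N) : bool :=
  match a with N0 => false | Npos p => match b with N0 => false | Npos q => pos_meet1 p q end end.

Fixpoint choose_bits (bs : seq N) (k : nat) (cur : N) : seq N :=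
  match k with
  | 0 => [:: cur]
  | k'.+1 => match bs with
             | [::] => [::]
             | b :: bs' => choose_bits bs' k' (N.lor cur b) ++ choose_bits bs' k cur
             end
  end.
Definition point := (N * N)%type.
(* Sets of points meeting each line exactly once.  A line is represented by a
   one-digit mask together with its points; a point by the mask of the lines
   through it and its own mask; [cov] records the lines already met, and [Z] the
   points on none of the lines. *)
Fixpoint gen_transversals (ls : seq (N * seq point)) (Z : seq N) (cov cur : N) (k : nat) : seq N :=
  match ls with
  | [::] => choose_bits Z k cur
  | (x, ps) :: ls' =>
    if disj cov x then
      match k with
      | 0 => [::]
      | k'.+1 => flatten [seq gen_transversals ls' Z (N.lor cov p.1) (N.lor cur p.2) k'
                         | p <- ps & disj cov p.1]
      end
    else gen_transversals ls' Z cov cur k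
  end.
(** Coding a point by the lines through it turns the condition that no line be met twice into a
    single disjointness test of masks. *)
Definition hit_pattern (ls : seq N) (b : N) : N := ofbits [seq ~~ disj l b | l <- ls].
Fixpoint shifts (n : nat) (w : N) : seq N :=
  if n is n'.+1 then w :: shifts n' (N.double w) else [::].
Definition candidates (ls : seq N) (U : N) (k : nat) : seq N :=
  let ps := [seq (hit_pattern ls b, b) | b <- bits U] in
  let xs := shifts (size ls) 1%num in
  gen_transversals [seq (x, [seq p <- ps | ~~ disj x p.1]) | x <- xs]
      [seq p.2 | p <- ps & null p.1] N0 N0 k.

(** * Search for classes of candidates by bit sequences *)

Fixpoint andb_seq (a b : bitseq) : bitseq :=
  match a with
  | [::] => [::]
  | x :: a' => match b with
               | [::] => [::]
               | y :: b' => (if x then y else false) :: andb_seq a' b'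
               end
  end.
Fixpoint clear_prefix (n : nat) (a : bitseq) : bitseq :=
  match n with
  | 0 => a
  | n'.+1 => match a with [::] => [::] | _ :: a' => false :: clear_prefix n' a' end
  end.
(** The pruning test of all the searches; it stops at the [n]-th true entry. *)
Fixpoint count_ge (n : nat) (a : bitseq) : bool :=
  match n with
  | 0 => true
  | n'.+1 => (fix go (a : bitseq) : bool :=
     match a with
     | [::] => false
     | b :: a' => if b then count_ge n' a' else go a'
     end) a
  end.

Fixpoint lazy_all (A : Type) (p : A -> bool) (s : seq A) : bool :=
  if s is x :: s' then if p x then lazy_all p s' else false else true.

(* A candidate, its disjointness with the later candidates, and whether it meets
   each of the candidates exactly once. *)
Definition cand_row := (N * (bitseq * bitseq))%type.
Fixpoint rows_of (G t : seq N) : seq cand_row :=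
  match t with
  | [::] => [::]
  | g :: t' => (g, (map (disj g) t', map (meet1 g) G)) :: rows_of G t'
  end.

(** After a few choices most candidates are excluded, and deleting them shortens all later
    operations. The disjointness part of a row only concerns the later rows, hence is cut down by
    the rest [sel'] of the selector; the meeting part concerns all candidates, hence is cut down by
    [R]. *)
Fixpoint restrict_rows (sel : bitseq) (rows : seq cand_row) (R : bitseq) : seq cand_row :=
  match rows with
  | [::] => [::]
  | (g, (d, o)) :: rows' =>
    match sel with
    | [::] => [::]
    | b :: sel' =>
      if b then (g, (mask sel' d, mask R o)) :: restrict_rows sel' rows' R
      else restrict_rows sel' rows' R
    end
  end.
(** Inverse of [mask sel]: brings a selection made in a restricted table back to the indices of the
    full one. *)
Fixpoint expand_bits (sel a : bitseq) : bitseq :=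
  match sel with
  | [::] => [::]
  | b :: sel' => if b then head false a :: expand_bits sel' (behead a) else false :: expand_bits sel' a
  end.
Definition all_true (A : Type) (s : seq A) : bitseq := [seq true | _ <- s].

Section Cls.
Variables (need : nat) (kont : nat -> bitseq -> seq N -> bool).
(* Enumerates the ways to add at most [k + 1] candidates to a class of pairwise
   disjoint ones: [L] marks the candidates disjoint from the class, [R] those
   meeting all its members once, of which at least [need] must survive. *)
Fixpoint extend_class (rows : seq cand_row) (k : nat) (L R : bitseq) (acc : seq N) : bool :=
  match rows with
  | [::] => true
  | (g, (d, o)) :: rows' =>
    match L with
    | [::] => true
    | b :: P1_lines =>
      if b then
        let R2 := andb_seq R o in
        if (if count_ge need R2 then
              if kont k R2 (g :: acc) then
                if k is k'.+1 then extend_class rows' k' (andb_seq P1_lines d) R2 (g :: acc) else true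
              else false
            else true)
        then extend_class rows' k P1_lines R acc else false
      else extend_class rows' k P1_lines R acc
    end
  end.
End Cls.

(** The continuation receives the index following the chosen candidate, so that it may discard all
    earlier candidates when classes are ordered by their least members. *)
Fixpoint first_members (k : nat) (f : seq cand_row -> bitseq -> bitseq -> nat -> seq N -> bool)
    (rows : seq cand_row) (L R : bitseq) (i : nat) (acc : seq N) : bool :=
  match rows with
  | [::] => true
  | (g, (d, o)) :: rows' =>
    match L with
    | [::] => true
    | b :: P1_lines =>
      if b then
        if (if count_ge k L then f rows' (andb_seq P1_lines d) (andb_seq R o) i.+1 (g :: acc) else true)
        then first_members k f rows' P1_lines R i.+1 acc else false
      else first_members k f rows' P1_lines R i.+1 acc
    end
  end.

(* Partitions [k] candidates marked by [R] into at most [n] classes of at most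
   [cap] members, each class being generated by its member of least index, and
   the classes in the order of these least indices. *)
Fixpoint search_classes (rows : seq cand_row) (leaf : seq N -> bool) (cap n k : nat) (R : bitseq) (acc : seq N) : bool :=
  match k with
  | 0 => leaf acc
  | k'.+1 =>
    match n with
    | 0 => true
    | n'.+1 =>
      let next k R acc :=
        if k <= n' * cap then if count_ge k R then search_classes rows leaf cap n' k R acc else true
        else true in
      first_members k (fun rows' L R i acc =>
        let R := clear_prefix i R in
        if count_ge (k - cap) R then
          if next k' R acc then
            if k' is k''.+1 then extend_class (k - cap) next rows' k'' L R acc else true
          else false
        else true) rows R R 0 acc
    end
  end.

(** Meant for the six further lines through a point of degree 7: their parts off [l0] partition the
    points off [l0], so the least uncovered point can be used for branching. The bound 6 in the test
    is the number of lines still missing once this class is complete. *)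
Fixpoint exact_cover (k : nat) (V : N) (L : seq cand_row) (R : bitseq) (acc : seq N) (kont : bitseq -> seq N -> bool) : bool :=
  match k with
  | 0 => kont R acc
  | k'.+1 =>
    if bits V is q :: _ then
      lazy_all (fun r : cand_row => let: (g, (_, o)) := r in
        if disj g q then true else
        let R2 := andb_seq R o in
        if count_ge 6 R2 then
          exact_cover k' (N.ldiff V g) [seq r' <- L | disj g r'.1] R2 (g :: acc) kont
        else true) L
    else true
  end.

(** * Arrays of concurrent triples and their symmetries *)

(* [cell T i j k] tells whether the [i]-th, [j]-th and [k]-th lines through the
   first, second and third point of the seed are concurrent.  *)
Definition triple_array := seq (seq (seq bool)).
Definition cell (T : triple_array) (i j k : nat) : bool := nth false (nth [::] (nth [::] T k) i) j.
Definition make_array (n K : nat) (f : nat -> nat -> nat -> bool) : triple_array :=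
  mkseq (fun k => mkseq (fun i => mkseq (fun j => f i j k) n) n) K.
Definition layer_of (n : nat) (v : seq nat) : seq (seq bool) :=
  [seq [seq x == j | j <- iota 0 n] | x <- v].

(* A layer of an array is coded by the column of the true entry in each row, or
   [n] if there is none. *)
Fixpoint layer_codes (n : nat) (full : bool) (T : triple_array) (m i : nat) (avail : seq nat) : seq (seq nat) :=
  match m with
  | 0 => [:: [::]]
  | m'.+1 =>
    flatten [seq (if has (fun L => nth false (nth [::] L i) j) T then [::]
                  else [seq j :: v | v <- layer_codes n full T m' i.+1 (rem j avail)]) | j <- avail]
    ++ (if full then [::] else [seq n :: v | v <- layer_codes n full T m' i.+1 avail])
  end.
Definition layer_weight (L : seq (seq bool)) : nat := sumn [seq count id r | r <- L].
(* Layers are added in the order of their weights, so the last one is the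
   heaviest; the other bounds are [sum_weight], [weight_ge2], [row_ge] and
   [col_ge] below. *)
Definition admissible (T : triple_array) (L : seq (seq bool)) : bool :=
  let K := (size T).+1 in
  let TL := rcons T L in
  let c := layer_weight L in
  [&& 2 <= c, all (fun L' => layer_weight L' <= c) T,
      sumn [seq layer_weight L' | L' <- TL] <= 4 + 2 * K,
      all (fun i => K <= sumn [seq count id (nth [::] L' i) | L' <- TL] + 2) (iota 0 4)
    & all (fun j => K <= sumn [seq count (fun r => nth false r j) L' | L' <- TL] + 2) (iota 0 4)].
Definition extensions (n : nat) (full : bool) (T : triple_array) : seq triple_array :=
  [seq rcons T L | L <- [seq L <- [seq layer_of n v | v <- layer_codes n full T n 0 (iota 0 n)] | full || admissible T L]].

(* Permutations of the lines through each of the three points, and a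
   permutation of the points given by its index in [slot]. *)
Definition hint := (seq nat * seq nat * seq nat * nat)%type.
Definition slot (t g : nat) : nat :=
  nth 0 (nth [::] [:: [:: 0;1;2]; [:: 1;0;2]; [:: 0;2;1]; [:: 2;1;0]; [:: 1;2;0]; [:: 2;0;1]] t) g.
Definition sel (A : Type) (x y z : A) (g : nat) : A := match g with 0 => x | 1 => y | _ => z end.
Definition slot_inv (t g : nat) : nat :=
  nth 0 (nth [::] [:: [:: 0;1;2]; [:: 1;0;2]; [:: 0;2;1]; [:: 2;1;0]; [:: 2;0;1]; [:: 1;2;0]] t) g.
Definition act_hint (n : nat) (h : hint) (T : triple_array) : triple_array :=
  let: (s0, s1, s2, t) := h in
  let a := slot_inv t 0 in let b := slot_inv t 1 in let c := slot_inv t 2 in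
  make_array n (size T) (fun i j k =>
    let x := nth 0 s0 i in let y := nth 0 s1 j in let z := nth 0 s2 k in
    cell T (sel x y z a) (sel x y z b) (sel x y z c)).
Definition perm_seq (n : nat) (s : seq nat) : bool :=
  [&& size s == n, all (fun x => x < n) s & uniq s].
Definition valid_hint (n K : nat) (h : hint) : bool :=
  let: (s0, s1, s2, t) := h in
  [&& perm_seq n s0, perm_seq n s1, perm_seq K s2 & (t < 2) || ((K == n) && (t < 6))].
Definition normalise (n : nat) (h : hint) (T : triple_array) : triple_array :=
  if valid_hint n (size T) h then act_hint n h T else T.

Fixpoint digits (b : N) (m : nat) (x : N) : seq nat * N :=
  match m with
  | 0 => ([::], x)
  | m'.+1 => let (q, r) := N.div_eucl x b in
             let (s, y) := digits b m' q in (N.to_nat r :: s, y)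
  end.
(** The three permutations are packed as base [n] digits, least significant first; what remains is
    the index of the permutation of the three points. *)
Definition decode_hint (n K : nat) (x : N) : hint :=
  let b := N.of_nat n in
  let (s0, x) := digits b n x in
  let (s1, x) := digits b n x in
  let (s2, x) := digits b K x in
  (s0, s1, s2, N.to_nat x).

Fixpoint apply_hints (n K : nat) (es : seq triple_array) (hs : seq N) : seq triple_array :=
  match es, hs with
  | e :: es', h :: hs' => normalise n (decode_hint n K h) e :: apply_hints n K es' hs'
  | _, _ => es
  end.
Section Eqs.
Variables (A : Type) (e : A -> A -> bool).
Fixpoint eq_seq (s t : seq A) : bool :=
  match s, t with
  | [::], [::] => true
  | x :: s', y :: t' => if e x y then eq_seq s' t' else false
  | _, _ => false
  end.
Fixpoint mem_by (x : A) (s : seq A) : bool :=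
  if s is y :: s' then if e x y then true else mem_by x s' else false.
Fixpoint dedup (s : seq A) : seq A :=
  if s is x :: s' then if mem_by x s' then dedup s' else x :: dedup s' else [::].
End Eqs.
Definition eq_array : triple_array -> triple_array -> bool := eq_seq (eq_seq (eq_seq (fun a b : bool => if a then b else if b then false else true))).
Definition next_level (n : nat) (full : bool) (K : nat) (reps : seq triple_array) (hs : seq N) : seq triple_array :=
  dedup eq_array (apply_hints n K (flatten [seq extensions n full T | T <- reps]) hs).

(** With a single layer, rows and columns can be rearranged so that the true entries start the
    diagonal. Only the weight of the layer then matters, and the hint is computed rather than looked
    up. *)
Definition first_hint (n : nat) (T : triple_array) : hint :=
  let v := [seq find id r | r <- nth [::] T 0] in
  let d := [seq i <- iota 0 n | nth n v i < n] in
  let u := [seq i <- iota 0 n | ~~ (nth n v i < n)] in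
  let w := [seq nth n v i | i <- d] in
  (d ++ u, w ++ [seq j <- iota 0 n | j \notin w], [:: 0], 0).
Definition first_level (n : nat) (full : bool) : seq triple_array :=
  dedup eq_array [seq normalise n (first_hint n T) T | T <- extensions n full [::]].

(** * Explicit models of the seeds *)

(* For each of the 43 points, the indices of the lines of the seed through it:
   first the points off [l0], which has index [0], then those on it. *)
Definition point_patterns (n : nat) (T : triple_array) : seq (seq nat) :=
  let K := size T in
  let A i := i.+1 in let B j := (n + j).+1 in let C k := (n + n + k).+1 in
  let I := iota 0 n in let IK := iota 0 K in
  let p0 := [:: 0 :: map A I; 0 :: map B I; 0 :: map C IK; [:: 0]; [:: 0]; [:: 0]; [:: 0]] in
  let tr := flatten [seq flatten [seq flatten [seq (if cell T i j k then [:: [:: A i; B j; C k]] else [::]) | k <- IK] | j <- I] | i <- I] in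
  let d01 := flatten [seq flatten [seq (if has (fun k => cell T i j k) IK then [::] else [:: [:: A i; B j]]) | j <- I] | i <- I] in
  let d02 := flatten [seq flatten [seq (if has (fun j => cell T i j k) I then [::] else [:: [:: A i; C k]]) | k <- IK] | i <- I] in
  let d12 := flatten [seq flatten [seq (if has (fun i => cell T i j k) I then [::] else [:: [:: B j; C k]]) | k <- IK] | j <- I] in
  let m := tr ++ d01 ++ d02 ++ d12 in
  let sg := flatten [seq nseq (6 - count (fun p => x \in p) m) [:: x] | x <- iota 1 (n + n + K)] in
  let points_off := m ++ sg in
  points_off ++ nseq (36 - size points_off) [::] ++ p0.
Definition seed_lines (n : nat) (T : triple_array) : seq N :=
  let ps := point_patterns n T in
  [seq ofbits [seq x \in p | p <- ps] | x <- iota 0 (n + n + size T).+1].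

Definition group_of (n x : nat) : nat := if x <= n then 0 else if x <= n + n then 1 else 2.
(** Meant for [x < y < z], where the pencils come in increasing order: if [x] and [z] share a
    pencil, so does [y], and the lines meet at its centre. Two lines of one pencil are never
    concurrent with a line of another one, so the array decides the remaining triples. *)
Definition conc_array (n : nat) (T : triple_array) (x y z : nat) : bool :=
  match x with
  | 0 => group_of n y == group_of n z
  | _ => if group_of n x == group_of n z then true
         else [&& group_of n x == 0, group_of n y == 1, group_of n z == 2 & cell T x.-1 (y - n).-1 (z - n - n).-1]
  end.
Definition all_points : N := N.ones 43.
Definition card7 (m : N) : bool := mask_ge 7 m && ~~ mask_ge 8 m.
Definition nthN (s : seq N) i := nth N0 s i.
(** The model built from [point_patterns] is trusted only through this test: by [conc_perm], a
    family of 7-sets meeting pairwise once and with the right concurrent triples is the seed, up to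
    a permutation of the points. *)
Definition valid_seed (n : nat) (T : triple_array) (B : seq N) : bool :=
  let K := size B in
  [&& all card7 B, all (fun m => null (N.ldiff m all_points)) B,
      K == (n + n + size T).+1 &
      all (fun x => all (fun y => 
        let xy := N.land (nthN B x) (nthN B y) in
        single xy && all (fun z => ~~ disj xy (nthN B z) == conc_array n T x y z) (iota y.+1 (K - y.+1)))
       (iota x.+1 (K - x.+1))) (iota 0 K)].

Definition parts_off (B : seq N) : seq N := if B is l :: B' then [seq N.ldiff b l | b <- B'] else [::].
Definition points_off (B : seq N) : N := N.ldiff all_points (head N0 B).
Definition search_sub (rows : seq cand_row) (leaf : seq N -> bool) (cap n k : nat) (R : bitseq) (acc : seq N) : bool :=
  if count_ge k R then
    let sub := restrict_rows R rows R in search_classes sub leaf cap n k (all_true sub) acc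
  else true.
(** [m] is 3 minus the number of members added to the first one, so 0 and 1 stand for first classes
    of four and of three lines. Twelve lines in at most four classes of at most four either have a
    class of four, which is then taken first, or have four classes of three; in the latter case the
    first class is the one of least index, which allows the prefix to be cleared. *)
Definition after_first_class (rows : seq cand_row) (leaf : seq N -> bool) (i : nat) (R : bitseq) (m : nat) (R' : bitseq) (acc : seq N) : bool :=
  match m with
  | 0 => search_sub rows leaf 4 3 8 (expand_bits R R') acc
  | 1 => search_sub rows leaf 3 3 9 (clear_prefix i (expand_bits R R')) acc
  | _ => true
  end.
(** Both shapes of the twelve missing lines are run: classes of at most four, and a class of six
    coming from a point of degree 7 on [l0]. *)
Definition search4 (B : seq N) (leaf : seq N -> bool) : bool :=
  let G := candidates (parts_off B) (points_off B) 6 in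
  let rows := rows_of G G in
  let F := all_true G in
  if first_members 3 (fun rows' L R i acc =>
       let sub := restrict_rows L rows' R in
       extend_class 8 (after_first_class rows leaf i R) sub 2 (all_true sub) (mask R F) acc) rows F F 0 [::] then
  exact_cover 6 (points_off B) rows F [::] (search_sub rows leaf 6 3 6) else false.
(** Of the nine missing lines at most three pass through the third point; their parts avoid the seed
    lines through it and come from [G1], the others from [G2]. One table holds both, so that a
    choice in [G1] filters [G2]. The first call treats the case of no line from [G1]; afterwards [m]
    is 3 minus the number of those chosen, so [6 + m] are left to find in [G2]. *)
Definition search6 (B : seq N) (leaf : seq N -> bool) : bool :=
  let ls := parts_off B in
  let pq := take 12 ls in let r := drop 12 ls in
  let G1 := candidates pq (N.ldiff (points_off B) (foldr N.lor N0 r)) 6 in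
  let G2 := candidates ls (points_off B) 6 in
  let G := G1 ++ G2 in
  let rows := rows_of G G in
  let L := nseq (size G1) true in
  let R := nseq (size G1) false ++ nseq (size G2) true in
  if search_sub rows leaf 6 4 9 R [::] then
  extend_class 6 (fun m => search_sub rows leaf 6 4 (6 + m)) rows 2 L R [::] else false.

(** * Comparison with the four planes *)

Fixpoint lazy_has (A : Type) (p : A -> bool) (s : seq A) : bool :=
  if s is x :: s' then if p x then true else lazy_has p s' else false.
Definition mem_masks (x : N) := lazy_has (N.eqb x).
Definition preim_mask (r : seq nat) (A : N) : N := ofbits [seq bit A x | x <- r].
Definition plane_masks (P : seq (seq nat)) : seq N := [seq ofbits [seq q \in l | q <- iota 0 43] | l <- P].
Definition P1_lines : seq (seq nat) := ltac:(match eval unfold P1 in P1 with lines_of ?s => exact s end).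
Definition P2_lines : seq (seq nat) := ltac:(match eval unfold P2 in P2 with lines_of ?s => exact s end).
Definition P3_lines : seq (seq nat) := ltac:(match eval unfold P3 in P3 with lines_of ?s => exact s end).
Definition P4_lines : seq (seq nat) := ltac:(match eval unfold P4 in P4 with lines_of ?s => exact s end).
Definition planes : seq (seq N) := map plane_masks [:: P1_lines; P2_lines; P3_lines; P4_lines].
(* Only points off [l0] are compared: the search leaves open at which points of
   [l0] the classes of further lines are concurrent. *)
Definition leaf_ok (B : seq N) (hs : seq (nat * seq nat)) (acc : seq N) : bool :=
  lazy_has (fun h => let: (j, r) := h in
    let P := nth [::] planes j in
    let l0 := preim_mask r (head N0 B) in
    let P' := [seq N.ldiff l l0 | l <- P] in
    if lazy_all (fun A => mem_masks (preim_mask r A) P') (acc ++ parts_off B) then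
      if mem_masks l0 P then perm_seq 43 r else false
    else false) hs.
Definition hints_at (i : nat) (hs : seq (nat * (nat * N))) : seq (nat * seq nat) :=
  [seq (h.2.1, (digits 43 43 h.2.2).1) | h <- hs & h.1 == i].
Fixpoint check_seeds (n : nat) (search : seq N -> (seq N -> bool) -> bool) (hs : seq (nat * (nat * N))) (i : nat) (Ts : seq triple_array) : bool :=
  if Ts is T :: Ts' then
    let B := seed_lines n T in
    if valid_seed n T B then
      if search B (leaf_ok B (hints_at i hs)) then check_seeds n search hs i.+1 Ts' else false
    else false
  else true.
(** A line that could be added would be a 7-set meeting each line of the plane once, that is, a
    candidate. *)
Definition no_extension (P : seq N) : bool := if candidates P all_points 7 is [::] then true else false.

(** * Masks as sets of points *)

Lemma bitE m i : bit m i = N.testbit m (N.of_nat i).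
Proof.
have E p : Pos.pred_N (Pos.of_succ_nat p) = N.of_nat p by ssrlia.
case: m => [|p]; first by [].
rewrite /bit /=; elim: p i => [p IH|p IH|] [|i] //=; by rewrite E IH; case: i.
Qed.

Lemma mask_inj a b : (forall i, bit a i = bit b i) -> a = b.
Proof.
move=> e; apply: N.bits_inj => n; rewrite -(N2Nat.id n) -!bitE; exact: e.
Qed.

Lemma bit_land a b i : bit (N.land a b) i = bit a i && bit b i.
Proof. by rewrite !bitE N.land_spec. Qed.
Lemma bit_lor a b i : bit (N.lor a b) i = bit a i || bit b i.
Proof. by rewrite !bitE N.lor_spec. Qed.
Lemma bit_ldiff a b i : bit (N.ldiff a b) i = bit a i && ~~ bit b i.
Proof. by rewrite !bitE N.ldiff_spec. Qed.
Lemma bit_double a i : bit (N.double a) i = if i is i'.+1 then bit a i' else false.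
Proof. by case: a i => [|p] [|i]. Qed.
Lemma bit_succ_double a i : bit (N.succ_double a) i = if i is i'.+1 then bit a i' else true.
Proof. by case: a i => [|p] [|i]. Qed.

Lemma bit_ofbits s i : bit (ofbits s) i = nth false s i.
Proof.
elim: s i => [|b s IH] [|i] //=; case: b; rewrite ?bit_double ?bit_succ_double //.
Qed.

Fixpoint pos_positions (p : positive) : seq nat :=
  match p with
  | xH => [:: 0]
  | xO p' => [seq i.+1 | i <- pos_positions p']
  | xI p' => 0 :: [seq i.+1 | i <- pos_positions p']
  end.
Definition positions (m : N) : seq nat := if m is Npos p then pos_positions p else [::].

Lemma mem_positions m i : (i \in positions m) = bit m i.
Proof.
case: m => [|p] //=; elim: p i => [p IH|p IH|] [|i] //=;
  rewrite ?inE ?(mem_map succn_inj) ?IH //.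
by apply/mapP => -[].
Qed.
Lemma positions_uniq m : uniq (positions m).
Proof.
case: m => [|p] //=; elim: p => [p IH|p IH|] //=; rewrite ?(map_inj_uniq succn_inj) // IH andbT.
by apply/mapP => -[].
Qed.
Lemma pos_geE n p : pos_ge n p = (n <= size (pos_positions p)).
Proof.
elim: p n => [p IH|p IH|] [|n] //=; rewrite ?size_map ?IH //.
by case: n.
Qed.
Lemma mask_geE n m : mask_ge n m = (n <= size (positions m)).
Proof. by case: m => [|p]; [case: n | rewrite /= pos_geE]. Qed.
Lemma nullE m : null m = (size (positions m) == 0).
Proof. by case: m => [|p] //=; elim: p => //= p; rewrite size_map. Qed.
Lemma singleE m : single m = (size (positions m) == 1).
Proof.
case: m => [|p] //=; elim: p => //= p IH; rewrite size_map //.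
by rewrite -[LHS]/false; case: p {IH} => //= p; rewrite ?size_map //; 
  move: (nullE (Npos p)) => /=; case: (size _).
Qed.
Lemma nullP m : reflect (forall i, bit m i = false) (null m).
Proof.
rewrite nullE size_eq0; apply: (iffP eqP) => [e i|e]; first by rewrite -mem_positions e.
by case E: (positions m) => [//|i s]; have := e i; rewrite -mem_positions E mem_head.
Qed.
Lemma nullPn m : reflect (exists i, bit m i) (~~ null m).
Proof.
apply: (iffP idP) => [|[i ti]]; last by apply/negP => /nullP /(_ i); rewrite ti.
rewrite nullE; case E: (positions m) => [//|i s] _; by exists i; rewrite -mem_positions E mem_head.
Qed.
Lemma singleP m : reflect (exists i, forall j, bit m j = (j == i)) (single m).
Proof.
rewrite singleE; apply: (iffP idP) => [|[i e]].
  case E: (positions m) => [//|i [|//]] _; exists i => j; by rewrite -mem_positions E inE.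
have: perm_eq (positions m) [:: i].
  apply: uniq_perm; rewrite ?positions_uniq // => j; by rewrite mem_positions e inE.
by move/perm_size ->.
Qed.

Definition unit_mask (i : nat) : N := iter i N.double 1%num.
Lemma bit_unit_mask i j : bit (unit_mask i) j = (j == i).
Proof. by elim: i j => [|i IH] [|j] //=; rewrite bit_double // IH. Qed.
Lemma pos_bitsE p w k : Npos w = unit_mask k -> pos_bits p w = [seq unit_mask (k + i) | i <- pos_positions p].
Proof.
elim: p w k => [p IH|p IH|] w k e /=; rewrite ?addn0 ?e //.
  rewrite (IH _ k.+1); last by rewrite [unit_mask _]/= -/(unit_mask k) -e.
  rewrite -map_comp; congr cons; apply: eq_map => i /=; by rewrite addnS.
rewrite (IH _ k.+1); last by rewrite [unit_mask _]/= -/(unit_mask k) -e.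
rewrite -map_comp; apply: eq_map => i /=; by rewrite addnS.
Qed.
Lemma bitsE m : bits m = [seq unit_mask i | i <- positions m].
Proof. case: m => [|p] //=; exact: (@pos_bitsE p xH 0). Qed.

Lemma pos_disjE p q : pos_disj p q = null (Pos.land p q).
Proof.
by elim: p q => [p IH|p IH|] [q|q|] //=; rewrite ?IH; case: (Pos.land p q).
Qed.
Lemma disjE a b : disj a b = null (N.land a b).
Proof. by case: a b => [|p] [|q] //=; rewrite pos_disjE. Qed.
Lemma pos_meet1E p q : pos_meet1 p q = single (Pos.land p q).
Proof.
elim: p q => [p IH|p IH|] [q|q|] //=; rewrite ?IH ?pos_disjE; case: (Pos.land p q) => //.
Qed.
Lemma meet1E a b : meet1 a b = single (N.land a b).
Proof. by case: a b => [|p] [|q] //=; rewrite pos_meet1E. Qed.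

Definition set_of_mask (m : N) : {set 'I_43} := [set i : 'I_43 | bit m i].
Definition mask_of (A : {set 'I_43}) : N := ofbits [seq i \in A | i <- enum 'I_43].

Lemma bit_mask_of (A : {set 'I_43}) (i : 'I_43) : bit (mask_of A) i = (i \in A).
Proof.
by rewrite bit_ofbits (nth_map i) ?size_enum_ord // nth_ord_enum.
Qed.
Lemma bit_mask_of_ge (A : {set 'I_43}) i : 43 <= i -> bit (mask_of A) i = false.
Proof. by move=> h; rewrite bit_ofbits nth_default // size_map size_enum_ord. Qed.
Lemma bit_mask_ofP (A : {set 'I_43}) (i : nat) :
  reflect (exists2 x : 'I_43, x \in A & i = x :> nat) (bit (mask_of A) i).
Proof.
apply: (iffP idP) => [h|[x xA ->]]; last by rewrite bit_mask_of.
case: (ltnP i 43) => hi; last by rewrite bit_mask_of_ge in h.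
by exists (Ordinal hi) => //; move: h; rewrite (bit_mask_of A (Ordinal hi)).
Qed.
Lemma mask_ofK : cancel mask_of set_of_mask.
Proof. by move=> A; apply/setP => i; rewrite inE bit_mask_of. Qed.
Lemma set_of_maskK m : (forall i, bit m i -> i < 43) -> mask_of (set_of_mask m) = m.
Proof.
move=> h; apply: mask_inj => i; case: (ltnP i 43) => hi.
  by rewrite (bit_mask_of _ (Ordinal hi)) inE.
rewrite bit_mask_of_ge //; case E: (bit m i) => //; move: (h _ E); by rewrite ltnNge hi.
Qed.
Lemma set_of_mask_land a b : set_of_mask (N.land a b) = set_of_mask a :&: set_of_mask b.
Proof. by apply/setP => i; rewrite !inE bit_land. Qed.
Lemma set_of_mask_ldiff a b : set_of_mask (N.ldiff a b) = set_of_mask a :\: set_of_mask b.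
Proof. by apply/setP => i; rewrite !inE bit_ldiff andbC. Qed.
Lemma mask_of_land A B : N.land (mask_of A) (mask_of B) = mask_of (A :&: B).
Proof.
apply: mask_inj => i; case: (ltnP i 43) => hi; last by rewrite bit_land !bit_mask_of_ge.
by rewrite bit_land !(bit_mask_of _ (Ordinal hi)) inE.
Qed.
Lemma mask_of_ldiff A B : N.ldiff (mask_of A) (mask_of B) = mask_of (A :\: B).
Proof.
apply: mask_inj => i; case: (ltnP i 43) => hi; last by rewrite bit_ldiff !bit_mask_of_ge.
by rewrite bit_ldiff !(bit_mask_of _ (Ordinal hi)) inE andbC.
Qed.
Lemma size_positions_mask_of A : size (positions (mask_of A)) = #|A|.
Proof.
rewrite cardE -(size_map val); apply: perm_size; apply: uniq_perm.
- exact: positions_uniq.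
- by rewrite map_inj_uniq ?enum_uniq //; apply: val_inj.
move=> i; rewrite mem_positions; apply/bit_mask_ofP/mapP => -[x xA ->]; exists x => //; by rewrite mem_enum in xA *.
Qed.
Lemma null_mask_of A : null (mask_of A) = (A == set0).
Proof. by rewrite nullE size_positions_mask_of cards_eq0. Qed.
Lemma single_mask_of A : single (mask_of A) = (#|A| == 1).
Proof. by rewrite singleE size_positions_mask_of. Qed.
Lemma card_set_of_mask m : (forall i, bit m i -> i < 43) -> #|set_of_mask m| = size (positions m).
Proof. by move=> h; rewrite -size_positions_mask_of set_of_maskK. Qed.

Definition submask (a b : N) := forall i, bit a i -> bit b i.

Lemma choose_bitsP ps k cur a : uniq ps -> submask cur a ->
  (forall i, bit a i -> ~~ bit cur i -> i \in ps) ->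
  size (positions a) = k + size (positions cur) -> a \in choose_bits [seq unit_mask i | i <- ps] k cur.
Proof.
elim: ps k cur => [|p ps IH] k cur /=.
  move=> _ sub h e.
  have E : cur = a.
    apply: mask_inj => i; apply/idP/idP => [/sub //|ai].
    by case E: (bit cur i) => //; have := h i ai; rewrite E => /(_ isT).
  move: e; rewrite E; case: k => [|k]; first by rewrite mem_seq1.
  by move=> /eqP; rewrite -[X in X == _]add0n eqn_add2r.
move=> /andP [pn us] sub h.
case: k => [|k] e.
  (* Nothing remains to be chosen: [cur] has as many digits as [a] and is contained in it. *)
  rewrite mem_seq1; apply/eqP; apply: mask_inj => i; rewrite -!mem_positions.
  have [| |_ ->] := @uniq_min_size _ (positions cur) (positions a) (positions_uniq _) => //.
    by move=> j; rewrite !mem_positions; exact: sub.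
  by rewrite e.
rewrite mem_cat; case: (boolP (bit a p && ~~ bit cur p)) => [/andP [ap cp]|np].
  apply/orP; left; apply: IH => //.
  - by move=> i; rewrite bit_lor bit_unit_mask => /orP [/sub //|/eqP ->].
  - move=> i ai; rewrite bit_lor bit_unit_mask negb_or => /andP [ci ip].
    by have := h i ai ci; rewrite inE (negPf ip).
  rewrite e addSnnS; congr (_ + _).
  have : perm_eq (p :: positions cur) (positions (N.lor cur (unit_mask p))).
    apply: uniq_perm; rewrite /= ?positions_uniq ?mem_positions ?cp // => i.
    by rewrite inE !mem_positions bit_lor bit_unit_mask orbC.
  by move/perm_size => <-.
apply/orP; right; apply: (IH k.+1) => // i ai ci.
move: (h i ai ci); rewrite inE => /orP [/eqP E|//].
by rewrite E in ai ci; rewrite ai ci in np.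
Qed.

Lemma shiftsE n w k : w = unit_mask k -> shifts n w = [seq unit_mask i | i <- iota k n].
Proof.
elim: n w k => //= n IH w k e; rewrite -e; congr cons; apply: IH.
by rewrite e.
Qed.

Lemma bit_hit_pattern ls i t : bit (hit_pattern ls (unit_mask i)) t = (t < size ls) && bit (nth N0 ls t) i.
Proof.
rewrite bit_ofbits; case: (ltnP t (size ls)) => h; last by rewrite nth_default ?size_map.
rewrite (nth_map N0) //= disjE; apply/nullPn/idP => [[j]|h']; last first.
  by exists i; rewrite bit_land bit_unit_mask eqxx andbT.
by rewrite bit_land bit_unit_mask => /andP [h' /eqP <-].
Qed.

Section Gen.
Variables (ls : seq N) (U a : N).
Hypotheses (aU : submask a U) (a1 : forall l, l \in ls -> single (N.land a l)).

Let onep t i j : t < size ls -> bit a i -> bit a j -> bit (nth N0 ls t) i ->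
  bit (nth N0 ls t) j -> i = j.
Proof.
move=> ht ai aj li lj; have /singleP [k e] := a1 (mem_nth N0 ht).
have := e i; have := e j; rewrite !bit_land ai aj li lj /=.
by move=> /esym/eqP -> /esym/eqP ->.
Qed.

Let pts : seq point := [seq (hit_pattern ls b, b) | b <- bits U].
Let xls t := [seq (x, [seq p <- pts | ~~ disj x p.1])
             | x <- [seq unit_mask i | i <- iota t (size ls - t)]].

Let pt_mem i : bit U i -> (hit_pattern ls (unit_mask i), unit_mask i) \in pts.
Proof.
by move=> Ui; apply: map_f; rewrite bitsE; apply: map_f; rewrite mem_positions.
Qed.

Let size_lor cur i : ~~ bit cur i -> size (positions (N.lor cur (unit_mask i))) = (size (positions cur)).+1.
Proof.
move=> ci.
have : perm_eq (i :: positions cur) (positions (N.lor cur (unit_mask i))).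
  apply: uniq_perm; rewrite /= ?positions_uniq ?mem_positions ?ci // => j.
  by rewrite inE !mem_positions bit_lor bit_unit_mask orbC.
by move/perm_size => <-.
Qed.

(** Invariant: [cov] marks exactly the lines met by [cur], among them the first [t]. The branch to
    follow at line [t] is the point where [a] meets it; that point is on no line of [cov], as [a]
    would meet such a line twice. *)
Lemma gen_transversalsP t cov cur k : t <= size ls -> submask cur a ->
  (forall s, bit cov s = (s < size ls) && has (bit (nth N0 ls s)) (positions cur)) ->
  (forall s, s < t -> bit cov s) ->
  size (positions a) = k + size (positions cur) ->
  a \in gen_transversals (xls t) [seq p.2 | p <- pts & null p.1] cov cur k.
Proof.
move En : (size ls - t) => n; elim: n t En cov cur k => [|n IH] t En cov cur k tl sub covE covt ek.
  have Et : t = size ls by ssrlia.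
  rewrite /xls En /=.
  have -> : [seq p.2 | p <- pts & null p.1] =
      [seq unit_mask i | i <- [seq i <- positions U | null (hit_pattern ls (unit_mask i))]].
    by rewrite /pts bitsE -map_comp filter_map -map_comp.
  apply: choose_bitsP => //; first by rewrite filter_uniq ?positions_uniq.
  move=> i ai ci; rewrite mem_filter mem_positions aU // andbT.
  apply/nullP => s; rewrite bit_hit_pattern; apply/negP => /andP [hs li].
  have := covt s; rewrite Et hs covE hs /= => /(_ isT) /hasP [j]; rewrite mem_positions => cj lj.
  have E := onep hs ai (sub j cj) li lj; by rewrite E cj in ci.
have ht : t < size ls by ssrlia.
rewrite /xls En /= -/(xls t.+1).
have xlsE : [seq (x, [seq p <- pts | ~~ disj x p.1]) | x <- [seq unit_mask i | i <- iota t.+1 n]] = xls t.+1.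
  by rewrite /xls; congr [seq _ | x <- [seq _ | i <- iota _ _]]; ssrlia.
rewrite xlsE.
have nullx m : disj m (unit_mask t) = ~~ bit m t.
  rewrite disjE; apply/nullP/idP => [/(_ t)|h s]; rewrite bit_land bit_unit_mask ?eqxx ?andbT; first by move->.
  by case: eqP => [->|]; rewrite ?andbT ?andbF //; apply/negbTE.
rewrite nullx; case: (boolP (bit cov t)) => /= [ct|nct].
  apply: IH => //; first by ssrlia.
  by move=> s; rewrite ltnS leq_eqVlt => /orP [/eqP -> //|]; apply: covt.
have /singleP [i ei] := a1 (mem_nth N0 ht).
have /andP [ai li] : bit a i && bit (nth N0 ls t) i by rewrite -bit_land ei.
have ci : ~~ bit cur i.
  apply/negP => ci; move: nct; rewrite covE ht /= => /hasP []; exists i => //.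
  by rewrite mem_positions.
(* The budget cannot be exhausted here: [cur] would already be all of [a], hence contain [i]. *)
case: k ek => [|k] ek.
  have : i \in positions cur; last by rewrite mem_positions (negPf ci).
  have [| |_ ->] := @uniq_min_size _ (positions cur) (positions a) (positions_uniq _) => //; last by rewrite mem_positions.
    by move=> j; rewrite !mem_positions; exact: sub.
  by rewrite ek.
apply/flattenP; eexists; first apply/mapP.
  exists (hit_pattern ls (unit_mask i), unit_mask i); last by [].
  rewrite mem_filter mem_filter pt_mem ?aU // andbT /=; apply/andP; split.
    rewrite disjE; apply/nullP => s; rewrite bit_land bit_hit_pattern covE; case: (ltnP s (size ls)) => //= hs.
    apply/negP => /andP [/hasP [j]]; rewrite mem_positions => cj lj lsi.
    have E := onep hs ai (sub j cj) lsi lj; by rewrite E cj in ci.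
  by rewrite disjE; apply/nullPn; exists t; rewrite bit_land bit_unit_mask eqxx bit_hit_pattern ht li.
apply: IH; first by ssrlia.
- by [].
- by move=> j; rewrite bit_lor bit_unit_mask => /orP [/sub //|/eqP ->].
- move=> s; rewrite bit_lor covE bit_hit_pattern -andb_orr; congr (_ && _).
  apply/orP/hasP => [[/hasP [j jc lj]|l]|[j]].
  + by exists j => //; move: jc; rewrite !mem_positions bit_lor => ->.
  + by exists i => //; rewrite mem_positions bit_lor bit_unit_mask eqxx orbT.
  rewrite mem_positions bit_lor bit_unit_mask => /orP [cj lj|/eqP -> ->]; last by right.
  by left; apply/hasP; exists j; rewrite ?mem_positions.
- move=> s; rewrite ltnS bit_lor leq_eqVlt => /orP [/eqP ->|/covt -> //].
  by rewrite bit_hit_pattern ht li orbT.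
by rewrite size_lor // ek addSnnS.
Qed.

Lemma candidatesP : a \in candidates ls U (size (positions a)).
Proof.
rewrite /candidates (@shiftsE _ _ 0) //.
have := @gen_transversalsP 0 N0 N0 (size (positions a)); rewrite /xls subn0; apply => //.
- by move=> s; case: (s < _) => //=; rewrite andbF.
- by rewrite addn0.
Qed.
End Gen.

(** * Soundness of the search *)

Lemma nth_andb_seq a b i : nth false (andb_seq a b) i = nth false a i && nth false b i.
Proof.
elim: a b i => [|x a IH] [|y b] [|i] //=; rewrite ?andbF ?nth_nil //; by case: x.
Qed.
Lemma nth_clear_prefix n a i : nth false (clear_prefix n a) i = (n <= i) && nth false a i.
Proof. by elim: n a i => [|n IH] [|x a] [|i] //=; rewrite ?nth_nil ?andbF ?IH. Qed.
Lemma count_geE n a : count_ge n a = (n <= count id a).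
Proof.
elim: n a => [|n IH] a //; elim: a => [|b a IHa] //.
rewrite [LHS]/= -/(count_ge n.+1 a).
by case: b => /=; rewrite ?IH ?add1n ?ltnS // add0n -IHa.
Qed.
Lemma count_geP n a (s : seq nat) : uniq s -> n <= size s ->
  (forall i : nat, i \in s -> nth false a i) -> count_ge n a.
Proof.
move=> us ns h; rewrite count_geE (leq_trans ns) //.
have -> : count id a = size [seq i <- iota 0 (size a) | nth false a i].
  by rewrite size_filter -{1}[a](mkseq_nth false) count_map.
apply: uniq_leq_size => // i si; rewrite mem_filter h // mem_iota /= add0n.
by rewrite ltnNge; apply/negP => l; have := h i si; rewrite nth_default.
Qed.

Definition row0 : cand_row := (N0, ([::], [::])).
Section Rows.
Variable rows : seq cand_row.
Definition row_mask p := (nth row0 rows p).1.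
Definition row_disj p x := nth false (nth row0 rows p).2.1 x.
Definition row_meet1 p x := nth false (nth row0 rows p).2.2 x.

Lemma drop_rows i : i < size rows ->
  drop i rows = (row_mask i, ((nth row0 rows i).2.1, (nth row0 rows i).2.2)) :: drop i.+1 rows.
Proof. by move=> h; rewrite (drop_nth row0 h) /row_mask; case: (nth _ _ _) => a []. Qed.

(** [c] is increasing, so its members are chosen in the order of the scan. [K] stands for the rest
    of the solution: as it meets every member of [c] once, it survives in [R] at each node, and
    [need <= size K] shows that the pruning never cuts this branch. *)
Lemma extend_class_sound need kont i k L R acc : extend_class need kont (drop i rows) k L R acc = true ->
  forall c, sorted ltn c -> 0 < size c <= k.+1 ->
  (forall j : nat, j \in c -> [/\ i <= j, j < size rows & nth false L (j - i)]) ->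
  {in c &, forall j h : nat, j < h -> row_disj j (h - j.+1)} ->
  forall K : seq nat, uniq K -> need <= size K ->
  (forall j : nat, j \in K -> nth false R j) ->
  (forall h j : nat, h \in c -> j \in K -> row_meet1 h j) ->
  exists R' acc', [/\ forall j : nat, j \in K -> nth false R' j,
    kont (k.+1 - size c) R' (acc' ++ acc) = true & perm_eq acc' [seq row_mask j | j <- c]].
Proof.
move En: (size rows - i) => n; elim: n i En k L R acc => [|n IH] i En k L R acc.
  move=> _ [|j c] //= _ _ h; have [] := h j (mem_head _ _); ssrlia.
have hi : i < size rows by ssrlia.
rewrite (drop_rows hi) /= => H [|j c] //= pc sc hc dc K uK nK RK oK.
have [ij js Lj] := hc j (mem_head _ _).
have cj h : h \in c -> j < h.
  by move=> hh; move: pc; rewrite (path_sortedE ltn_trans) => /andP [/allP /(_ _ hh)].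
case: L hc Lj H => [|b P1_lines] hc Lj; first by rewrite nth_nil in Lj.
(* Whatever happens at row [i], success includes success of the scan that skips this row. *)
have H1 : (if b then (if (if count_ge need (andb_seq R (nth row0 rows i).2.2)
    then if kont k (andb_seq R (nth row0 rows i).2.2) (row_mask i :: acc)
    then match k with
         | 0 => true
         | k'.+1 => extend_class need kont (drop i.+1 rows) k' (andb_seq P1_lines (nth row0 rows i).2.1)
                        (andb_seq R (nth row0 rows i).2.2) (row_mask i :: acc) end
      else false else true) then extend_class need kont (drop i.+1 rows) k P1_lines R acc else false)
    else extend_class need kont (drop i.+1 rows) k P1_lines R acc) = true ->
    extend_class need kont (drop i.+1 rows) k P1_lines R acc = true.
  by case: (b) => //; case: ifP.
case: (ltngtP i j) ij => // [ij|eij] _.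
  move=> /H1 {}H1; have Ei : size rows - i.+1 = n by ssrlia.
  apply: (IH _ Ei _ _ _ _ H1 (j :: c)) => // h hh; have [a1 a2 a3] := hc h hh.
  have ih : i < h by move: hh; rewrite inE => /orP [/eqP -> //|/cj]; ssrlia.
  split=> //; move: a3; by have -> : h - i = (h - i.+1).+1 by ssrlia.
subst j; move: Lj; rewrite subnn /= => ->.
set R2 := andb_seq R _; have R2K h : h \in K -> nth false R2 h.
  by move=> hh; rewrite nth_andb_seq RK //=; apply: oK; rewrite // mem_head.
rewrite (count_geP uK nK R2K).
case E: (kont k _ _) => //.
case: c pc sc hc dc oK cj => [|j c] /= pc sc hc dc oK cj.
  move=> _; exists R2, [:: row_mask i]; split=> //; by rewrite subn1.
case: k sc E {H1} => // k sc E.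
case: ifP => // H _.
have En' : size rows - i.+1 = n by ssrlia.
have sj : sorted ltn (j :: c) by case/andP: pc.
have hc' (h : nat) : h \in j :: c ->
    [/\ i.+1 <= h, h < size rows & nth false (andb_seq P1_lines (nth row0 rows i).2.1) (h - i.+1)].
  move=> hh; have hh' : h \in [:: i, j & c] by rewrite inE hh orbT.
  have [a1 a2 a3] := hc h hh'; have ih := cj h hh.
  split=> //; rewrite nth_andb_seq.
  move: a3; have -> : h - i = (h - i.+1).+1 by ssrlia.
  move=> /= -> /=; exact: (dc i h (mem_head _ _) hh' ih).
have dc' : {in j :: c &, forall j h : nat, j < h -> row_disj j (h - j.+1)}.
  by move=> x y hx hy; apply: dc; rewrite inE ?hx ?hy orbT.
have oK' h y : h \in j :: c -> y \in K -> row_meet1 h y.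
  by move=> hh hK; apply: oK; rewrite // inE hh orbT.
have [R' [acc' [RR kk pp]]] := IH _ En' _ _ _ _ H _ sj sc hc' dc' _ uK nK R2K oK'.
exists R', (rcons acc' (row_mask i)); split=> //.
- by move: kk; rewrite cat_rcons /= !subSS.
- by rewrite perm_rcons /= perm_cons.
Qed.

(** The list [s] witnesses that [q] marked candidates remain from [j] on, so the counting test lets
    the choice of [j] through. *)
Lemma first_members_sound q f i L R acc : first_members q f (drop i rows) L R i acc = true ->
  forall j, i <= j < size rows -> nth false L (j - i) ->
  forall s, uniq s -> q <= size s -> (forall h : nat, h \in s -> j <= h /\ nth false L (h - i)) ->
  exists2 L', f (drop j.+1 rows) L' (andb_seq R (nth row0 rows j).2.2) j.+1 (row_mask j :: acc) = true &
    forall h, j < h -> nth false L (h - i) -> row_disj j (h - j.+1) -> nth false L' (h - j.+1).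
Proof.
move En: (size rows - i) => n; elim: n i En L R acc => [|n IH] i En L R acc.
  move=> _ j; ssrlia.
have hi : i < size rows by ssrlia.
rewrite (drop_rows hi) /= => H j /andP [ij js] Lj s us qs sL.
case: L Lj sL H => [|b P1_lines] Lj sL; first by rewrite nth_nil in Lj.
case: (ltngtP i j) ij => // [ij|eij] _.
  move=> H; have {}H : first_members q f (drop i.+1 rows) P1_lines R i.+1 acc = true.
    by move: H; case: (b) => //; case: ifP.
  have En' : size rows - i.+1 = n by ssrlia.
  have subE h : i < h -> h - i = (h - i.+1).+1 by ssrlia.
  rewrite subE // in Lj.
  have sL' h : h \in s -> j <= h /\ nth false P1_lines (h - i.+1).
    by move=> hh; have [c d] := sL h hh; rewrite subE //= in d; ssrlia.
  have ijs : i < j < size rows by rewrite ij.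
  have [L' a b'] := IH _ En' _ _ _ H j ijs Lj s us qs sL'.
  exists L' => // h hj Lh; apply: b' => //.
  by rewrite subE //= in Lh; ssrlia.
subst j; move: (Lj); rewrite subnn /= => eb; rewrite eb in sL *.
have -> : count_ge q (true :: P1_lines).
  apply: (@count_geP _ _ [seq h - i | h <- s]); rewrite ?size_map //.
    rewrite map_inj_in_uniq // => x y /sL [x1 _] /sL [y1 _]; ssrlia.
  by move=> x /mapP [h /sL [_ Lh] ->].
case: ifP => // H _; exists (andb_seq P1_lines (nth row0 rows i).2.1) => //.
move=> h hj; have -> : h - i = (h - i.+1).+1 by ssrlia.
by move=> /= Lh dh; rewrite nth_andb_seq Lh.
Qed.
End Rows.

Lemma size_rows_of G t : size (rows_of G t) = size t.
Proof. by elim: t => //= g t ->. Qed.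
Lemma row_mask_rows_of G t p : row_mask (rows_of G t) p = nth N0 t p.
Proof.
rewrite /row_mask; elim: t p => [|g t IH] [|p] //=; by rewrite nth_nil.
Qed.
Lemma row_disj_rows_of G t p x : p.+1 + x < size t ->
  row_disj (rows_of G t) p x = null (N.land (nth N0 t p) (nth N0 t (p.+1 + x))).
Proof.
rewrite /row_disj; elim: t p => [|g t IH] [|p] //= h.
  by rewrite (nth_map N0) ?disjE.
by rewrite IH.
Qed.
Lemma row_meet1_rows_of G t p x : p < size t -> x < size G ->
  row_meet1 (rows_of G t) p x = single (N.land (nth N0 t p) (nth N0 G x)).
Proof.
rewrite /row_meet1; elim: t p => [|g t IH] [|p] //= h xG; last by rewrite IH.
by rewrite (nth_map N0) ?meet1E.
Qed.

Section Labels.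
Variable lab : nat -> nat.
Implicit Type K : seq nat.

Lemma size_undup_lab K x : x \in map lab K ->
  size (undup [seq lab j | j <- [seq j <- K | lab j != x]]) = (size (undup (map lab K))).-1.
Proof.
move=> h; rewrite -(filter_map lab (predC1 x)) -filter_undup -rem_filter ?undup_uniq //.
by rewrite size_rem ?mem_undup.
Qed.

(** Pigeonhole, removing one label at a time; it justifies the test [k <= n' * cap] of the
    search. *)
Lemma size_lab n cap K : size (undup (map lab K)) <= n ->
  (forall x, count (fun j => lab j == x) K <= cap) -> size K <= n * cap.
Proof.
elim: n K => [|n IH] K hn hc.
  by move: hn; rewrite leqn0 size_eq0 => /eqP /undup_nil; case: K {hc}.
case: K hn hc => // i K hn hc; set K1 := i :: K.
rewrite -(count_predC (fun j => lab j == lab i) K1) mulSn leq_add //.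
rewrite -size_filter; apply: IH.
  by rewrite size_undup_lab ?mem_head //; move: hn; case: (size _).
by move=> x; apply: leq_trans (hc x); rewrite count_filter; apply: sub_count => j /andP [].
Qed.
End Labels.

Section Classes.
Variable rows : seq cand_row.
Local Notation dz := (row_disj rows).
Local Notation oz := (row_meet1 rows).
Local Notation gz := (row_mask rows).

(** A solution is a set [K] of indices whose classes are the fibres of [lab]. The fibre of the least
    index [i] is split off; its other members form [C]. The remainder [K'] uses one label less, and
    since [C] has fewer than [cap] members, [K'] is large enough for every counting test. *)
Lemma search_classes_sound leaf cap n k R acc :
  search_classes rows leaf cap n k R acc = true ->
  forall (lab : nat -> nat) (K : seq nat), sorted ltn K -> size K = k ->
  (forall j : nat, j \in K -> j < size rows /\ nth false R j) ->
  {in K &, forall i j : nat, i < j -> if lab i == lab j then dz i (j - i.+1) else oz i j && oz j i} ->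
  size (undup (map lab K)) <= n ->
  (forall x, count (fun j => lab j == x) K <= cap) ->
  exists2 s, leaf (s ++ acc) = true & perm_eq s [seq gz j | j <- K].
Proof.
elim: n k R acc => [|n IH] k R acc H lab [|i K] sK ek RK rK nK cK.
- by exists [::] => //; move: H; rewrite -ek.
- by have := size_lab nK cK.
- by exists [::] => //; move: H; rewrite -ek.
move: ek H => /= <-.
set K1 := i :: K.
pose C := [seq j <- K | lab j == lab i]; pose K' := [seq j <- K | lab j != lab i].
have eK : size K = size C + size K' by rewrite !size_filter count_predC.
have iK j : j \in K -> i < j.
  by move=> hh; move: sK; rewrite /= (path_sortedE ltn_trans) => /andP [/allP /(_ _ hh)].
have sK0 : sorted ltn K by move: sK => /=; case: (K) => //= a s /andP [].
have CK j : j \in C -> j \in K by rewrite mem_filter => /andP [].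
have K'K j : j \in K' -> j \in K by rewrite mem_filter => /andP [].
have K1K j : j \in K -> j \in K1 by rewrite inE orbC => ->.
have uK : uniq K by apply: (sorted_uniq ltn_trans ltnn).
have uK' : uniq K' by rewrite filter_uniq.
have uK1 : uniq K1 by apply: (sorted_uniq ltn_trans ltnn).
have cC : size C < cap.
  apply: leq_trans (cK (lab i)); rewrite /= eqxx add1n ltnS size_filter.
  by apply: eq_leq; apply: eq_count.
have pK : perm_eq (i :: C ++ K') K1.
  by rewrite /K1 perm_cons perm_filterC.
have nK' : size (undup (map lab K')) <= n.
  have -> : K' = [seq j <- K1 | lab j != lab i] by rewrite /= eqxx.
  by rewrite size_undup_lab ?mem_head //; move: nK; case: (size _).
have cK' x : count (fun j => lab j == x) K' <= cap.
  apply: leq_trans (cK x); apply: leq_trans (leq_addl _ _).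
  by rewrite count_filter; apply: sub_count => j /andP [].
have sK' : size K' <= n * cap by apply: size_lab nK' cK'.
have ssK' : sorted ltn K' by apply: sorted_filter => //; exact: ltn_trans.
have iG : i < size rows by have [] := RK i (mem_head _ _).
move=> H.
have sR h : h \in K1 -> i <= h /\ nth false R (h - 0).
  move=> hh; rewrite subn0; have [_ ->] := RK h hh; split=> //.
  by move: hh; rewrite inE => /orP [/eqP -> //|/iK /ltnW].
have Ri : nth false R (i - 0) by have [] := sR i (mem_head _ _).
rewrite -[X in first_members _ _ X _ _ _ _](drop0 rows) in H.
have [L' Hf HL] := first_members_sound H (j := i) iG Ri uK1 (leqnn _) sR.
move: Hf; set R1 := clear_prefix _ _ => Hf.
(* Indices with another label exceed [i], hence survive the cleared prefix, and they meet [i]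
   once. *)
have R1K j : j \in K' -> nth false R1 j.
  move=> hj; have jK := K'K j hj; have [jG Rj] := RK j (K1K j jK).
  rewrite nth_clear_prefix nth_andb_seq Rj iK //=.
  have := rK i j (mem_head _ _) (K1K j jK) (iK j jK).
  by move: hj; rewrite mem_filter eq_sym => /andP [/negPf -> _] /andP [].
have at1 m : m <= size K' -> forall R', (forall j : nat, j \in K' -> nth false R' j) -> count_ge m R'.
  by move=> hm R' hR; apply: count_geP uK' hm hR.
move: Hf; rewrite at1 //; last by move: cC eK; clear; ssrlia.
have fin R' acc' : (forall j : nat, j \in K' -> nth false R' j) ->
    (if size K' <= n * cap then
       if count_ge (size K') R' then search_classes rows leaf cap n (size K') R' acc' else true
     else true) = true ->
    exists2 s, leaf (s ++ acc') = true & perm_eq s [seq gz j | j <- K'].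
  move=> hR; rewrite sK' at1 // => H'.
  apply: (IH _ _ _ H' lab K') => //.
    by move=> j hj; have [a _] := RK j (K1K j (K'K j hj)); split=> //; exact: hR.
  by move=> a b ha hb; apply: rK; apply/K1K/K'K.
have done_ acc' s : leaf (s ++ acc' ++ gz i :: acc) = true ->
    perm_eq s [seq gz j | j <- K'] -> perm_eq acc' [seq gz j | j <- C] ->
    exists2 s, leaf (s ++ acc) = true & perm_eq s [seq gz j | j <- K1].
  move=> hl p1 p2; exists (s ++ acc' ++ [:: gz i]); first by rewrite -!catA.
  rewrite (perm_trans _ (perm_map _ pK)) //= map_cat.
  by rewrite catA perm_catC /= perm_cons perm_catC perm_cat.
(* If [i] is alone in its class, the direct call of [next] finds the rest; otherwise [extend_class]
   first adds [C]. *)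
case EC : C => [|c0 C'].
  have eKK : K = K'.
    apply/esym/all_filterP/allP => j jK; apply/negP => e.
    by have : j \in C; [rewrite mem_filter e | rewrite EC].
  have -> : size K = size K' by rewrite -eKK.
  case: ifP => // Hn _.
  have [s hs ps] := fin _ _ R1K Hn.
  by apply: (done_ [::] s); rewrite ?EC.
have EK : size K = ((size C + size K').-1).+1 by rewrite eK EC.
case: ifP => // _; rewrite EK => Hc.
have sC : sorted ltn C by apply: sorted_filter => //; exact: ltn_trans.
have szC : 0 < size C <= (size C + size K').-1.+1 by rewrite EC /=; clear; ssrlia.
have hC j : j \in C -> [/\ i.+1 <= j, j < size rows & nth false L' (j - i.+1)].
  move=> jC; have jK := CK j jC; have [jG Rj] := RK j (K1K j jK).
  split=> //; first exact: iK.
  apply: HL; rewrite ?subn0 ?iK //.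
  have := rK i j (mem_head _ _) (K1K j jK) (iK j jK).
  by move: jC; rewrite mem_filter eq_sym => /andP [-> _].
have dC : {in C &, forall j h : nat, j < h -> dz j (h - j.+1)}.
  move=> a b ha hb ab; have := rK a b (K1K _ (CK _ ha)) (K1K _ (CK _ hb)) ab.
  by move: ha hb; rewrite !mem_filter => /andP [/eqP -> _] /andP [/eqP -> _]; rewrite eqxx.
have need' : (size C + size K').-1.+2 - cap <= size K' by move: cC; rewrite EC /=; clear; ssrlia.
have oCK a b : a \in C -> b \in K' -> oz a b.
  move=> ha hb; have := rK a b (K1K _ (CK _ ha)) (K1K _ (K'K _ hb)).
  have := rK b a (K1K _ (K'K _ hb)) (K1K _ (CK _ ha)).
  have /eqP la : lab a == lab i by move: ha; rewrite mem_filter => /andP [].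
  have /negPf nb : lab b != lab i by move: hb; rewrite mem_filter => /andP [].
  rewrite la nb eq_sym nb.
  case: (ltngtP a b) => [_ _ /(_ isT) /andP [] //|_ /(_ isT) /andP [] //|e] //.
  by move: nb; rewrite -e la eqxx.
have [R' [acc' [RR kk pp]]] := extend_class_sound Hc sC szC hC dC uK' need' R1K oCK.
have Em : (size C + size K').-1.+1 - size C = size K' by rewrite EC /=; clear; ssrlia.
rewrite Em in kk.
have [s hs ps] := fin _ _ RR kk.
exact: (done_ acc' s).
Qed.
End Classes.

Lemma nth_mask_rank (A : Type) (x0 : A) R s x : nth false R x ->
  nth x0 (mask R s) (count id (take x R)) = nth x0 s x.
Proof.
elim: R s x => [|b R IH] [|a s] [|x] //=; rewrite ?nth_nil //.
- by move=> ->.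
- move=> h; have := IH s x h; case: b => /=; rewrite ?add1n ?add0n //.
Qed.
Lemma size_restrict_rows sel rows R : size (restrict_rows sel rows R) = count id (take (size rows) sel).
Proof.
elim: rows sel => [|[g [d o]] rows IH] [|b sel] //=.
by case: b => /=; rewrite IH.
Qed.
Lemma nth_restrict_rows sel rows R p : p < size rows -> nth false sel p ->
  nth row0 (restrict_rows sel rows R) (count id (take p sel)) =
  (row_mask rows p, (mask (drop p.+1 sel) (nth row0 rows p).2.1, mask R (nth row0 rows p).2.2)).
Proof.
elim: rows sel p => [|[g [d o]] rows IH] [|b sel] [|p] //=; rewrite ?drop0.
- by move=> _ ->.
- by move=> h1 h2; have := IH sel p h1 h2; case: b => /=; rewrite ?add1n ?add0n.
Qed.
(** The index, in the restricted table, of the selected candidate [p]. *)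
Definition rank (sel : bitseq) p := count id (take p sel).
Lemma rankS sel p x : nth false sel p -> rank sel (p.+1 + x) = (rank sel p + rank (drop p.+1 sel) x).+1.
Proof.
elim: sel p => [|b sel IH] [|p] //=; rewrite ?nth_nil // /rank /= ?drop0 ?take0.
  by move=> ->; rewrite add1n.
by move=> h; have := IH p h; rewrite /rank => ->; rewrite addnS addnA.
Qed.
Lemma rank_lt sel p q : nth false sel p -> p < q -> rank sel p < rank sel q.
Proof. by move=> h pq; rewrite -(subnKC pq) rankS // ltnS leq_addr. Qed.
Lemma nth_all_true (A : Type) (s : seq A) x : nth false (all_true s) x = (x < size s).
Proof. by elim: s x => [|a s IH] [|x] //=; rewrite -IH. Qed.

Section Proj.
Variables (sel : bitseq) (rows : seq cand_row) (R : bitseq).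
Local Notation sub := (restrict_rows sel rows R).
Lemma row_mask_restrict p : p < size rows -> nth false sel p -> row_mask sub (rank sel p) = row_mask rows p.
Proof. by move=> h1 h2; rewrite /row_mask nth_restrict_rows. Qed.
Lemma row_disj_restrict p q : p < size rows -> nth false sel p -> p < q -> nth false sel q ->
  row_disj sub (rank sel p) (rank sel q - (rank sel p).+1) = row_disj rows p (q - p.+1).
Proof.
move=> h1 h2 pq h3; rewrite /row_disj nth_restrict_rows //= -{1}(subnKC pq) rankS // subSS addKn.
by rewrite nth_mask_rank // nth_drop subnKC.
Qed.
Lemma row_meet1_restrict p x : p < size rows -> nth false sel p -> nth false R x ->
  row_meet1 sub (rank sel p) (rank R x) = row_meet1 rows p x.
Proof. by move=> h1 h2 h3; rewrite /row_meet1 nth_restrict_rows //= nth_mask_rank. Qed.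
Lemma rank_size p : p < size rows -> nth false sel p -> rank sel p < size sub.
Proof. by move=> h1 h2; rewrite size_restrict_rows; apply: rank_lt. Qed.
End Proj.

(** [rank R] is increasing on the survivors, so it carries a solution to one of the restricted table
    with the same masks. *)
Lemma search_sub_sound rows leaf cap n k R acc :
  search_sub rows leaf cap n k R acc = true ->
  forall (lab : nat -> nat) (K : seq nat), sorted ltn K -> size K = k ->
  (forall j : nat, j \in K -> j < size rows /\ nth false R j) ->
  {in K &, forall i j : nat, i < j ->
    if lab i == lab j then row_disj rows i (j - i.+1) else row_meet1 rows i j && row_meet1 rows j i} ->
  size (undup (map lab K)) <= n ->
  (forall x, count (fun j => lab j == x) K <= cap) ->
  exists2 s, leaf (s ++ acc) = true & perm_eq s [seq row_mask rows j | j <- K].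
Proof.
rewrite /search_sub => H lab K sK ek RK rK nK cK.
have uK : uniq K by apply: (sorted_uniq ltn_trans ltnn).
move: H; rewrite (@count_geP _ _ K) ?ek //; last by move=> i /RK [].
set sub := restrict_rows R rows R => H.
have rinj : {in K &, injective (rank R)}.
  move=> x y /RK [_ hx] /RK [_ hy] e; case: (ltngtP x y) => // xy.
    by have := rank_lt hx xy; rewrite e ltnn.
  by have := rank_lt hy xy; rewrite e ltnn.
(* The label of a restricted index is read off from its position among the images of [K]. *)
pose lab' x := lab (nth 0 K (index x (map (rank R) K))).
have labE j : j \in K -> lab' (rank R j) = lab j.
  by move=> jK; rewrite /lab' nth_index_map.
have mlab : map lab' (map (rank R) K) = map lab K.
  by rewrite -map_comp; apply/eq_in_map => j /labE.
have [||j /mapP [i iK ->]|x y /mapP [i iK ->] /mapP [j jK ->] xy|||s hs ps] :=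
    search_classes_sound H (lab := lab') (K := map (rank R) K).
- apply: (@homo_sorted_in _ _ (mem K) (rank R) ltn ltn _ _ _ sK); last by apply/allP.
  move=> x y xK yK; have [_ hx] := RK x xK; exact: rank_lt.
- by rewrite size_map.
- have [a b] := RK i iK; split; first exact: rank_size.
  by rewrite nth_all_true; exact: rank_size.
- have [i1 i2] := RK i iK; have [j1 j2] := RK j jK; rewrite !labE //.
  have ij : i < j.
    case: (ltngtP i j) => // [ji|e]; last by rewrite e ltnn in xy.
    by have := rank_lt j2 ji; rewrite ltnNge (ltnW xy).
  by rewrite row_disj_restrict // !row_meet1_restrict //; apply: rK.
- by rewrite mlab.
- move=> x; rewrite -(count_map lab' (pred1 x)) mlab count_map; exact: cK.
exists s => //; apply: (perm_trans ps); rewrite -map_comp.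
rewrite (_ : [seq _ | j <- K] = [seq row_mask rows j | j <- K]) //.
by apply/eq_in_map => j /RK [a b] /=; exact: row_mask_restrict.
Qed.

Arguments count_ge : simpl never.

Lemma lazy_allP (A : eqType) (p : A -> bool) s x : lazy_all p s -> x \in s -> p x.
Proof.
elim: s => //= y s IH; case E: (p y) => // h.
by rewrite inE => /orP [/eqP -> //|]; apply: IH.
Qed.

Section Cover.
Variable rows : seq cand_row.
Local Notation gz := (row_mask rows).
Local Notation oz := (row_meet1 rows).

(** [C] partitions [V]. The branch to follow is the member [j] of [C] containing the least point [q]
    of [V]; removing it from [C] leaves a partition of the points that remain. *)
Lemma exact_cover_sound k V L R acc kont : exact_cover k V L R acc kont = true ->
  forall C : seq nat, uniq C -> size C = k ->
  (forall j : nat, j \in C -> nth row0 rows j \in L) ->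
  {in C &, forall i j : nat, i != j -> null (N.land (gz i) (gz j))} ->
  (forall j : nat, j \in C -> ~~ null (gz j)) ->
  (forall x, bit V x = has (fun j => bit (gz j) x) C) ->
  forall K : seq nat, uniq K -> 6 <= size K ->
  (forall j : nat, j \in K -> nth false R j) ->
  (forall h j : nat, h \in C -> j \in K -> oz h j) ->
  exists R' acc', [/\ forall j : nat, j \in K -> nth false R' j,
    kont R' (acc' ++ acc) = true & perm_eq acc' [seq gz j | j <- C]].
Proof.
elim: k V L R acc => [|k IH] V L R acc H C uC eC CL Cd Cn VE K uK sK RK oK.
  by exists R, [::]; move/size0nil: eC => ->.
(* [C] is not empty and has no empty member, so [V] has a least point. *)
have [h [hC [x0 gx]]] : exists h : nat, h \in C /\ exists x, bit (gz h) x.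
  case: C eC CL Cn {uC Cd VE oK} => // h C _ _ Cn; exists h; rewrite mem_head; split=> //.
  by apply/nullPn/Cn/mem_head.
have Vx0 : bit V x0 by rewrite VE; apply/hasP; exists h.
move: H => /=; rewrite bitsE; case E: (positions V) => [|q ps].
  by rewrite -mem_positions E in Vx0.
have Vq : bit V q by rewrite -mem_positions E mem_head.
move: Vq; rewrite VE => /hasP [j jC gq] /= H.
have := lazy_allP H (CL j jC).
case Er : (nth row0 rows j) => [g [d o]].
have eg : gz j = g by rewrite /row_mask Er.
have eoz x : oz j x = nth false o x by rewrite /row_meet1 Er.
have -> : disj g (unit_mask q) = false.
  by rewrite disjE -eg; apply/negbTE/nullPn; exists q; rewrite bit_land bit_unit_mask eqxx gq.
have R2K x : x \in K -> nth false (andb_seq R o) x.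
  by move=> hx; rewrite nth_andb_seq RK // -eoz oK.
rewrite (count_geP uK sK R2K) => H'.
have pC : perm_eq C (j :: rem j C) by apply: perm_to_rem.
have remC i : i \in rem j C -> i \in C /\ i != j.
  by rewrite mem_rem_uniq // => /andP [].
have uC' : uniq (rem j C) by apply: rem_uniq.
have eC' : size (rem j C) = k by rewrite size_rem // eC.
have CL' i : i \in rem j C -> nth row0 rows i \in [seq r' <- L | disj g r'.1].
  move=> /remC [iC ij]; rewrite mem_filter CL // andbT disjE -eg.
  by apply: Cd => //; rewrite eq_sym.
have Cd' : {in rem j C &, forall i j : nat, i != j -> null (N.land (gz i) (gz j))}.
  by move=> x y /remC [xC _] /remC [yC _]; apply: Cd.
have Cn' i : i \in rem j C -> ~~ null (gz i) by move=> /remC [iC _]; apply: Cn.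
have VE' x : bit (N.ldiff V g) x = has (fun i => bit (gz i) x) (rem j C).
  rewrite bit_ldiff VE (perm_has _ pC) /= eg.
  case gx' : (bit g x) => /=; last by rewrite andbT.
  apply/esym/negbTE/hasPn => i /remC [iC ij].
  have /nullP /(_ x) := Cd i j iC jC ij.
  by rewrite bit_land eg gx' andbT => ->.
have oK' a b : a \in rem j C -> b \in K -> oz a b by move=> /remC [aC _]; apply: oK.
have [R' [acc' [RR kk pp]]] := IH _ _ _ _ H' _ uC' eC' CL' Cd' Cn' VE' K uK sK R2K oK'.
exists R', (rcons acc' g); split=> //; first by rewrite cat_rcons.
apply: (@perm_trans _ (g :: [seq gz i | i <- rem j C])); first by rewrite perm_rcons perm_cons.
by rewrite -eg -map_cons; apply: perm_map; rewrite perm_sym.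
Qed.
End Cover.

Lemma nth_expand_bits sel a x : nth false (expand_bits sel a) x = nth false sel x && nth false a (rank sel x).
Proof.
elim: sel a x => [|b sel IH] a [|x] //=; case: b => //=; rewrite ?nth0 ?IH //.
by rewrite /rank /= add1n; case: a => [|y a] //=; rewrite ?nth_nil ?andbF.
Qed.

Section SearchG.
Variable G : seq N.
Let rows := rows_of G G.
Local Notation g := (nth N0 G).
Let F := all_true G.

Let gzE j : row_mask rows j = g j. Proof. exact: row_mask_rows_of. Qed.
Let szR : size rows = size G. Proof. exact: size_rows_of. Qed.
Let dzE i j : i < j < size G -> row_disj rows i (j - i.+1) = null (N.land (g i) (g j)).
Proof. by move=> /andP [ij jG]; rewrite row_disj_rows_of ?subnKC. Qed.
Let ozE i j : i < size G -> j < size G -> row_meet1 rows i j = single (N.land (g i) (g j)).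
Proof. exact: row_meet1_rows_of. Qed.

(** The conclusion is expressed in the full table, whereas the first class is extended in a
    restricted one: this is where the two numberings are translated into each other. *)
Lemma first_class leaf :
  first_members 3 (fun rows' L R i acc =>
       let sub := restrict_rows L rows' R in
       extend_class 8 (after_first_class rows leaf i R) sub 2 (all_true sub) (mask R F) acc) rows F F 0 [::] = true ->
  forall i c, sorted ltn (i :: c) -> 2 <= size c <= 3 -> all (gtn (size G)) (i :: c) ->
  {in i :: c &, forall j h : nat, j < h -> null (N.land (g j) (g h))} ->
  forall K : seq nat, uniq K -> 8 <= size K -> all (gtn (size G)) K ->
  (forall h j : nat, h \in i :: c -> j \in K -> single (N.land (g h) (g j))) ->
  exists R acc, [/\ forall j : nat, j \in K -> nth false R j,
    (if size c == 3 then search_sub rows leaf 4 3 8 R acc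
     else search_sub rows leaf 3 3 9 (clear_prefix i.+1 R) acc) = true
    & perm_eq acc [seq g j | j <- i :: c]].
Proof.
move=> H i c sc szc /allP aG0 dc K uK sK /allP KG0 oK.
have aG (j : nat) : j \in i :: c -> j < size G by move/aG0.
have KG (j : nat) : j \in K -> j < size G by move/KG0.
have iG : i < size G by apply: aG; rewrite mem_head.
have ci j : j \in c -> i < j.
  by move=> jc; move: sc; rewrite /= (path_sortedE ltn_trans) => /andP [/allP /(_ _ jc)].
have cic j : j \in c -> j \in i :: c by rewrite inE orbC => ->.
have nF j : j < size G -> nth false F j by rewrite nth_all_true.
rewrite -[X in first_members _ _ X _ _ _ _](drop0 rows) in H.
have icL h : h \in i :: c -> i <= h /\ nth false F (h - 0).
  move=> hc; rewrite subn0 nF ?aG //; split=> //.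
  by move: hc; rewrite inE => /orP [/eqP -> //|/ci /ltnW].
have ic3 : 3 <= size (i :: c) by case/andP: szc.
have uic : uniq (i :: c) by apply: (sorted_uniq ltn_trans ltnn).
have iR : i < size rows by rewrite szR.
have iF : nth false F (i - 0) by rewrite subn0 nF.
have [L' Hf HL] := first_members_sound H (j := i) iR iF uic ic3 icL.
move: Hf; set R1 := andb_seq _ _; set rows' := drop i.+1 rows; set sub := restrict_rows _ _ _ => Hf.
have R1K j : j \in K -> nth false R1 j.
  move=> jK; rewrite nth_andb_seq nF ?KG //= -/(row_meet1 rows i j) ozE; [|exact: iG|exact: KG].
  by apply: oK; rewrite ?mem_head.
have szr' : size rows' = size G - i.+1 by rewrite size_drop szR.
have cL : forall j : nat, j \in c -> nth false L' (j - i.+1).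
  move=> j jc; have ij := ci j jc; have jG := aG j (cic j jc).
  apply: HL; rewrite ?subn0 ?nF // dzE ?ij ?jG //.
  by apply: dc; rewrite ?mem_head ?cic.
have cr' j : j \in c -> j - i.+1 < size rows'.
  by move=> jc; rewrite szr'; apply: ltn_sub2r; [exact: leq_ltn_trans (ci j jc) (aG j (cic j jc))|exact: (aG j (cic j jc))].
have nr' p : nth row0 rows' p = nth row0 rows (i.+1 + p) by rewrite nth_drop.
have iK j : i < j -> i.+1 + (j - i.+1) = j by move=> h; rewrite subnKC.
(* Members of [c] are sought among the rows after [i], hence the shift by [i.+1]; [K] is numbered
   among the candidates meeting [i] once. *)
pose c' := [seq rank L' (j - i.+1) | j <- c].
pose K' := map (rank R1) K.
have sc' : sorted ltn c'.
  have sc0 : sorted ltn c by move: sc => /=; case: (c) => //= a s /andP [].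
  apply: (@homo_sorted_in _ _ (mem c) _ ltn ltn _ _ _ sc0); last by apply/allP.
  move=> x y xc yc xy; apply: rank_lt; first exact: cL.
  exact: ltn_sub2r (leq_ltn_trans (ci x xc) xy) xy.
have szc' : 0 < size c' <= 3.
  by rewrite size_map; case/andP: szc => h ->; rewrite (leq_trans _ h).
have hc' j : j \in c' -> [/\ 0 <= j, j < size sub & nth false (all_true sub) (j - 0)].
  move=> /mapP [h hc ->]; have a := rank_size R1 (cr' h hc) (cL h hc).
  by rewrite subn0 nth_all_true.
have dc' : {in c' &, forall j h : nat, j < h -> row_disj sub j (h - j.+1)}.
  move=> _ _ /mapP [x xc ->] /mapP [y yc ->] xy.
  have ix := ci x xc; have iy := ci y yc.
  have xy' : x < y.
    case: (ltngtP x y) => // [yx|e]; last by rewrite e ltnn in xy.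
    have : y - i.+1 < x - i.+1 by exact: ltn_sub2r (leq_ltn_trans iy yx) yx.
    by move/(rank_lt (cL y yc)); rewrite ltnNge (ltnW xy).
  rewrite row_disj_restrict ?cr' ?cL //; last by exact: ltn_sub2r (leq_ltn_trans ix xy') xy'.
  rewrite /row_disj nr' iK //.
  have -> : y - i.+1 - (x - i.+1).+1 = y - x.+1 by move: ix; clear; ssrlia.
  rewrite -/(row_disj rows x _) dzE ?xy' ?aG ?cic //.
  by apply: dc => //; apply: cic.
have uK' : uniq K'.
  rewrite map_inj_in_uniq // => x y xK yK e.
  case: (ltngtP x y) => // h.
    by have := rank_lt (R1K _ xK) h; rewrite e ltnn.
  by have := rank_lt (R1K _ yK) h; rewrite e ltnn.
have sK' : 8 <= size K' by rewrite size_map.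
have RK' j : j \in K' -> nth false (mask R1 F) j.
  by move=> /mapP [x xK ->]; rewrite nth_mask_rank ?R1K // nF // KG.
have oK' a b : a \in c' -> b \in K' -> row_meet1 sub a b.
  move=> /mapP [x xc ->] /mapP [y yK ->].
  rewrite row_meet1_restrict ?cr' ?cL ?R1K // /row_meet1 nr' iK ?ci // -/(row_meet1 rows x y) ozE; [|exact/aG/cic|exact: KG].
  by apply: oK => //; apply: cic.
change (extend_class 8 (after_first_class rows leaf i.+1 R1) sub 2 (all_true sub) (mask R1 F) [:: row_mask rows i] = true) in Hf.
rewrite -[X in extend_class _ _ X _ _ _ _](drop0 sub) in Hf.
have [R' [acc' [RR kk pp]]] := extend_class_sound Hf sc' szc' hc' dc' uK' sK' RK' oK'.
have RE j : j \in K -> nth false (expand_bits R1 R') j.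
  by move=> jK; rewrite nth_expand_bits R1K //=; apply: RR; apply: map_f.
exists (expand_bits R1 R'), (acc' ++ [:: g i]); split=> //.
  move: kk; rewrite size_map gzE /after_first_class; case/andP: szc.
  by case: (size c) => [|[|[|[|]]]].
rewrite perm_catC /= perm_cons (perm_trans pp) // -map_comp.
rewrite (_ : [seq _ | j <- c] = [seq g j | j <- c]) //.
apply/eq_in_map => j jc /=; rewrite row_mask_restrict ?cr' ?cL //.
by rewrite /row_mask nr' iK ?ci // -/(row_mask rows j) gzE.
Qed.

Variables (leaf : seq N -> bool) (lab : N -> nat).
Let labI j := lab (g j).
Variable K : seq nat.
Hypotheses (sK : sorted ltn K) (KG : all (gtn (size G)) K).
Hypothesis rK : {in K &, forall i j : nat, i != j ->
  if labI i == labI j then null (N.land (g i) (g j)) else single (N.land (g i) (g j))}.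

Let rel (S : seq nat) : {subset S <= K} -> {in S &, forall i j : nat, i < j ->
  if labI i == labI j then row_disj rows i (j - i.+1) else row_meet1 rows i j && row_meet1 rows j i}.
Proof.
move=> sub i j /sub iK /sub jK ij; have iG := allP KG i iK; have jG := allP KG j jK.
have := rK iK jK; rewrite neq_ltn ij => /(_ isT).
rewrite dzE ?ij // !ozE // (N.land_comm (g j)); by case: ifP => // _ ->.
Qed.
Let uK : uniq K. Proof. exact: (sorted_uniq ltn_trans ltnn). Qed.

Lemma search_sub_leaf cap n k R acc (S : seq nat) : search_sub rows leaf cap n k R acc = true ->
  {subset S <= K} -> sorted ltn S -> size S = k -> (forall j : nat, j \in S -> nth false R j) ->
  size (undup (map labI S)) <= n -> (forall x, count (fun j => labI j == x) S <= cap) ->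
  exists2 s, leaf (s ++ acc) = true & perm_eq s [seq g j | j <- S].
Proof.
move=> H sub sS eS RS nS cS.
have [||s hs ps] := search_sub_sound H (lab := labI) sS eS _ _ nS cS.
- by move=> j jS; split; [rewrite szR; apply: (allP KG); apply: sub | apply: RS].
- exact: rel.
exists s => //; rewrite (_ : [seq g j | j <- S] = [seq row_mask rows j | j <- S]) //.
by apply: eq_map => j; rewrite gzE.
Qed.

Lemma firsts_search_sound : size K = 12 -> size (undup (map labI K)) <= 4 ->
  (forall x, count (fun j => labI j == x) K <= 4) ->
  first_members 3 (fun rows' L R i acc =>
       let sub := restrict_rows L rows' R in
       extend_class 8 (after_first_class rows leaf i R) sub 2 (all_true sub) (mask R F) acc) rows F F 0 [::] = true ->
  exists2 s, leaf s = true & perm_eq s [seq g j | j <- K].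
Proof.
move=> eK nK cK H.
(* The two ways to start: from any class of four, or, if no class exceeds three, from a class of
   three containing the least index. *)
have main x i c : [seq j <- K | labI j == x] = i :: c -> 2 <= size c <= 3 ->
    (size c = 3 \/ (size c = 2 /\ forall j, j \in K -> labI j != x -> i < j)
       /\ (forall y, count (fun j => labI j == y) K <= 3)) ->
    exists2 s, leaf s = true & perm_eq s [seq g j | j <- K].
  move=> eC szc hcase; set K' := [seq j <- K | labI j != x].
  have CK j : j \in i :: c -> j \in K /\ labI j = x.
    by rewrite -eC mem_filter => /andP [/eqP ->].
  have K'K : {subset K' <= K} by move=> j; rewrite mem_filter => /andP [].
  have sC : sorted ltn (i :: c) by rewrite -eC; apply: sorted_filter => //; exact: ltn_trans.
  have aC : all (gtn (size G)) (i :: c) by apply/allP => j /CK [jK _]; apply: (allP KG).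
  have dC : {in i :: c &, forall j h : nat, j < h -> null (N.land (g j) (g h))}.
    move=> a b /CK [aK ea] /CK [bK eb] ab; have := rK aK bK.
    by rewrite ea eb eqxx neq_ltn ab => /(_ isT).
  have sz : size (i :: c) + size K' = 12 by rewrite -eC !size_filter count_predC.
  have sz8 : 8 <= size K' by move: sz szc => /=; ssrlia.
  have aK' : all (gtn (size G)) K' by apply/allP => j /K'K; apply: (allP KG).
  have oC h j : h \in i :: c -> j \in K' -> single (N.land (g h) (g j)).
    move=> /CK [hK eh] jK'; have := rK hK (K'K _ jK').
    move: jK'; rewrite mem_filter => /andP [nj _].
    rewrite eh [x == _]eq_sym (negPf nj); apply.
    by apply/negP => /eqP e; move: nj; rewrite -e eh eqxx.
  have pK : perm_eq ([seq g j | j <- i :: c] ++ [seq g j | j <- K']) [seq g j | j <- K].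
    by rewrite -map_cat -eC; apply: perm_map; rewrite perm_filterC.
  have [R [acc [RK Hs part_mask]]] := first_class H sC szc aC dC (filter_uniq _ uK) sz8 aK' oC.
  have sK' : sorted ltn K' by apply: sorted_filter => //; exact: ltn_trans.
  have nK' : size (undup (map labI K')) <= 3.
    rewrite size_undup_lab; first by move: nK; case: (size _).
    have [iK <-] := CK i (mem_head _ _); exact: map_f.
  have cK' m y : count (fun j => labI j == y) K <= m -> count (fun j => labI j == y) K' <= m.
    by apply: leq_trans; rewrite count_filter; apply: sub_count => j /andP [].
  have fin s : leaf (s ++ acc) -> perm_eq s [seq g j | j <- K'] ->
      exists2 s, leaf s = true & perm_eq s [seq g j | j <- K].
    move=> hl ps; exists (s ++ acc) => //.
    by rewrite (perm_trans _ pK) // perm_catC perm_cat.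
  case: hcase => [e3|[[e2 ilt] c3]].
    move: Hs; rewrite e3 eqxx => Hs.
    have eK' : size K' = 8 by move: sz e3; clear; move=> /=; ssrlia.
    have [s hs ps] := search_sub_leaf Hs K'K sK' eK' RK nK' (fun y => cK' _ _ (cK y)).
    exact: fin hs ps.
  move: Hs; rewrite e2 /= => Hs.
  have eK' : size K' = 9 by move: sz e2; clear; move=> /=; ssrlia.
  have RK' j : j \in K' -> nth false (clear_prefix i.+1 R) j.
    move=> jK'; rewrite nth_clear_prefix RK // andbT ilt //; first exact: K'K.
    by move: jK'; rewrite mem_filter => /andP [].
  have [s hs ps] := search_sub_leaf Hs K'K sK' eK' RK' nK' (fun y => cK' _ _ (c3 y)).
  exact: fin hs ps.
case: (boolP (has (fun j => 4 <= count (fun h => labI h == labI j) K) K)) => [/hasP [j jK c4]|/hasPn n4].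
  have : size [seq h <- K | labI h == labI j] = 4.
    by rewrite size_filter; apply/eqP; rewrite eqn_leq c4 cK.
  case E : [seq h <- K | labI h == labI j] => [//|i c] /= [ec].
  by apply: (main _ _ _ E); rewrite ?ec //; left.
have c3 y : count (fun j => labI j == y) K <= 3.
  case: (boolP (has (fun j => labI j == y) K)) => [/hasP [j jK /eqP <-]|].
    by have := n4 j jK; rewrite -ltnNge.
  by rewrite has_count -leqNgt leqn0 => /eqP ->.
case EK : K eK => [//|i K0] eK.
have E : [seq j <- K | labI j == labI i] = i :: [seq j <- K0 | labI j == labI i].
  by rewrite EK /= eqxx.
have nK' : size (undup (map labI [seq j <- K | labI j != labI i])) <= 3.
  rewrite size_undup_lab; first by move: nK; case: (size _).
  by rewrite EK mem_head.
have cK' y : count (fun j => labI j == y) [seq j <- K | labI j != labI i] <= 3.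
  by apply: leq_trans (c3 y); rewrite count_filter; apply: sub_count => j /andP [].
(* The three other classes hold at most nine of the twelve indices, so the class of [i] has exactly
   three. *)
have s9 := size_lab nK' cK'.
have szs : size [seq j <- K | labI j == labI i] + size [seq j <- K | labI j != labI i] = 12.
  by rewrite !size_filter count_predC EK.
have s3 : size [seq j <- K | labI j == labI i] <= 3 by rewrite size_filter.
have e2 : size [seq j <- K0 | labI j == labI i] = 2.
  by move: szs s3; rewrite E /=; ssrlia.
rewrite -EK; apply: (main _ _ _ E); rewrite ?e2 //; right; split=> //; split=> // j.
rewrite EK inE => /orP [/eqP ->|jK0 _]; first by rewrite eqxx.
by move: sK; rewrite EK /= (path_sortedE ltn_trans) => /andP [/allP /(_ _ jK0)].
Qed.

Lemma cover_search_sound x V : size K = 12 -> size (undup (map labI K)) <= 4 ->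
  count (fun j => labI j == x) K = 6 ->
  (forall j : nat, j \in K -> ~~ null (g j)) ->
  (forall p, bit V p = has (fun j => (labI j == x) && bit (g j) p) K) ->
  exact_cover 6 V rows F [::] (search_sub rows leaf 6 3 6) = true ->
  exists2 s, leaf s = true & perm_eq s [seq g j | j <- K].
Proof.
move=> eK nK cx Kn VE H.
set C := [seq j <- K | labI j == x]; set K' := [seq j <- K | labI j != x].
have CK j : j \in C -> j \in K /\ labI j = x.
  by rewrite mem_filter => /andP [/eqP ->].
have K'K : {subset K' <= K} by move=> j; rewrite mem_filter => /andP [].
have sz : size C = 6 by rewrite size_filter.
have sz' : size K' = 6.
  by apply/eqP; rewrite -(eqn_add2l (size C)) !size_filter count_predC eK cx.
have CL j : j \in C -> nth row0 rows j \in rows.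
  by move=> /CK [jK _]; apply: mem_nth; rewrite szR; apply: (allP KG).
have Cd : {in C &, forall i j : nat, i != j -> null (N.land (row_mask rows i) (row_mask rows j))}.
  move=> a b /CK [aK ea] /CK [bK eb] ab; have := rK aK bK ab.
  by rewrite ea eb eqxx !gzE.
have Cn j : j \in C -> ~~ null (row_mask rows j) by rewrite gzE => /CK [jK _]; apply: Kn.
have VE' p : bit V p = has (fun j => bit (row_mask rows j) p) C.
  rewrite VE has_filter /C -has_filter; elim: (K) => //= a s ->.
  by case: (labI a == x) => //=; rewrite gzE.
have RK j : j \in K' -> nth false F j.
  by move=> /K'K jK; rewrite nth_all_true; apply: (allP KG).
have oC h j : h \in C -> j \in K' -> row_meet1 rows h j.
  move=> /CK [hK eh] jK'; have jK := K'K _ jK'; have := rK hK jK.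
  move: jK'; rewrite mem_filter => /andP [nj _].
  rewrite eh [x == _]eq_sym (negPf nj) ozE; try by apply: (allP KG).
  by apply; apply/negP => /eqP e; move: nj; rewrite -e eh eqxx.
have [R' [acc [RR kk part_mask]]] := exact_cover_sound H (filter_uniq _ uK) sz CL Cd Cn VE' (filter_uniq _ uK) (eq_leq (esym sz')) RK oC.
have sK' : sorted ltn K' by apply: sorted_filter => //; exact: ltn_trans.
have nK' : size (undup (map labI K')) <= 3.
  rewrite size_undup_lab; first by move: nK; case: (size _).
  have : 0 < size C by rewrite sz.
  by case: (C) CK => // j s /(_ j (mem_head _ _)) [jK <-] _; apply: map_f.
have cK' y : count (fun j => labI j == y) K' <= 6 by rewrite -sz' count_size.
have [s hs ps] := search_sub_leaf kk K'K sK' sz' RR nK' cK'.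
rewrite cats0 in hs; exists (s ++ acc) => //.
have pK : perm_eq ([seq g j | j <- C] ++ [seq g j | j <- K']) [seq g j | j <- K].
  by rewrite -map_cat; apply: perm_map; rewrite perm_filterC.
rewrite (perm_trans _ pK) // perm_catC perm_cat // (perm_trans part_mask) //.
rewrite (_ : [seq row_mask rows j | j <- C] = [seq g j | j <- C]) //.
by apply: eq_map => j; rewrite gzE.
Qed.
End SearchG.

(** The search works with increasing indices into the table. The offset [m] places masks of the
    second block of [G1 ++ G2] in that block, even if they also occur in the first. *)
Lemma to_index (G : seq N) m (ks : seq N) : uniq ks -> {subset ks <= drop m G} ->
  exists K : seq nat, [/\ sorted ltn K, all (gtn (size G)) K, all (leq m) K
    & perm_eq [seq nth N0 G j | j <- K] ks].
Proof.
move=> uks sub; pose pos a := m + index a (drop m G).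
have posE a : a \in ks -> nth N0 G (pos a) = a.
  by move=> /sub h; rewrite /pos -nth_drop nth_index.
have pinj : {in ks &, injective pos}.
  by move=> a b ha hb e; rewrite -(posE a) // e posE.
have pK : perm_eq (sort leq (map pos ks)) (map pos ks) by rewrite perm_sort.
exists (sort leq (map pos ks)); split.
- rewrite ltn_sorted_uniq_leq sort_uniq map_inj_in_uniq // uks /=.
  exact: sort_sorted leq_total _.
- rewrite all_sort; apply/allP => _ /mapP [a /sub h ->] /=.
  by rewrite /pos -ltn_subRL -size_drop index_mem.
- by rewrite all_sort; apply/allP => _ /mapP [a _ ->] /=; rewrite leq_addr.
apply: (perm_trans (perm_map _ pK)); rewrite -map_comp.
rewrite (_ : [seq _ | a <- ks] = ks) //; rewrite -[RHS]map_id.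
by apply/eq_in_map => a /posE.
Qed.

Lemma search4_sound B leaf : search4 B leaf = true ->
  forall (lab : N -> nat) (ks : seq N), uniq ks -> size ks = 12 ->
  {subset ks <= candidates (parts_off B) (points_off B) 6} ->
  {in ks &, forall a b, a != b ->
    if lab a == lab b then null (N.land a b) else single (N.land a b)} ->
  (forall a, a \in ks -> ~~ null a) ->
  size (undup (map lab ks)) <= 4 ->
  (forall x, count (fun a => lab a == x) ks <= 4) \/
  (exists2 x, count (fun a => lab a == x) ks = 6 &
    forall p, bit (points_off B) p = has (fun a => (lab a == x) && bit a p) ks) ->
  exists2 s, leaf s = true & perm_eq s ks.
Proof.
rewrite /search4; set G := candidates _ _ _.
move=> H lab ks uks sks sub rel nz nl hc.
have sub0 : {subset ks <= drop 0 G} by rewrite drop0.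
have [K [sK KG _ pK]] := to_index uks sub0.
have KE j : j \in K -> nth N0 G j \in ks.
  by move=> jK; rewrite -(perm_mem pK); apply: map_f.
have eK : size K = 12 by rewrite -sks -(perm_size pK) size_map.
have ginj : {in K &, injective (nth N0 G)}.
  have : uniq [seq nth N0 G j | j <- K] by rewrite (perm_uniq pK).
  move=> u x y xK yK e; rewrite -(nth_index 0 xK) -(nth_index 0 yK).
  congr nth; apply/eqP; rewrite -(nth_uniq N0 _ _ u) ?size_map ?index_mem //.
  by rewrite !(nth_map 0) ?index_mem // !nth_index // e.
have rK : {in K &, forall i j : nat, i != j ->
  if lab (nth N0 G i) == lab (nth N0 G j) then null (N.land (nth N0 G i) (nth N0 G j))
  else single (N.land (nth N0 G i) (nth N0 G j))}.
  move=> i j iK jK ij; apply: rel; rewrite ?KE //.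
  by apply: contra ij => /eqP /(ginj _ _ iK jK) ->.
have nK : size (undup [seq lab (nth N0 G j) | j <- K]) <= 4.
  apply: leq_trans nl; apply: eq_leq; apply: perm_size; apply: perm_undup => x.
  by rewrite (map_comp lab) (perm_mem (perm_map lab pK)).
have cE x : count (fun j => lab (nth N0 G j) == x) K = count (fun a => lab a == x) ks.
  by rewrite -(seq.permP pK) count_map.
move: H; case E : (first_members _ _ _ _ _ _ _) => // H.
suff [s hs ps] : exists2 s, leaf s = true & perm_eq s [seq nth N0 G j | j <- K].
  by exists s => //; apply: perm_trans ps pK.
case: hc => [c4|[x c6 VE]].
  by apply: (firsts_search_sound sK KG rK eK nK _ E) => x; rewrite cE.
apply: (cover_search_sound (x := x) sK KG rK eK nK _ _ _ H).
- by rewrite cE.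
- by move=> j jK; apply/nz/KE.
move=> p; rewrite VE -(perm_has _ pK) has_map; exact: eq_has.
Qed.

Lemma search6_sound B leaf : search6 B leaf = true ->
  forall (lab : N -> nat) (cs os : seq N), uniq cs -> uniq os -> size cs <= 3 ->
  size cs + size os = 9 ->
  {subset cs <= candidates (take 12 (parts_off B))
                  (N.ldiff (points_off B) (foldr N.lor N0 (drop 12 (parts_off B)))) 6} ->
  {subset os <= candidates (parts_off B) (points_off B) 6} ->
  {in cs &, forall a b, a != b -> null (N.land a b)} ->
  {in cs & os, forall a b, single (N.land a b)} ->
  {in os &, forall a b, a != b ->
    if lab a == lab b then null (N.land a b) else single (N.land a b)} ->
  size (undup (map lab os)) <= 4 ->
  (forall x, count (fun a => lab a == x) os <= 6) ->
  exists2 s, leaf s = true & perm_eq s (cs ++ os).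
Proof.
rewrite /search6; cbv zeta; set G1 := candidates _ (N.ldiff _ _) _; set G2 := candidates (parts_off B) _ _.
set G := G1 ++ G2; set rows := rows_of G G; set R := nseq (size G1) false ++ _; set L := nseq (size G1) true => H lab cs os uc uo sc3 sz subc subo relc relco relo nl cl.
have subc0 : {subset cs <= drop 0 G1} by rewrite drop0.
have subo0 : {subset os <= drop (size G1) G} by rewrite drop_size_cat.
have [C [sC CG _ pC]] := to_index uc subc0.
have [K [sK KG /allP KG1 pK]] := to_index uo subo0.
have gC j : j \in C -> nth N0 G j = nth N0 G1 j.
  by move=> /(allP CG) /= h; rewrite nth_cat h.
have {}pC : perm_eq [seq nth N0 G j | j <- C] cs.
  by rewrite (_ : [seq _ | j <- C] = [seq nth N0 G1 j | j <- C]) //; apply/eq_in_map.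

have cE j : j \in C -> nth N0 G j \in cs.
  by move=> jK; rewrite -(perm_mem pC); apply: map_f.
have kE j : j \in K -> nth N0 G j \in os.
  by move=> jK; rewrite -(perm_mem pK); apply: map_f.
have CG' j : j \in C -> j < size G.
  by move=> /(allP CG) /= h; rewrite size_cat ltn_addr.
have inj_of S ks : uniq ks -> perm_eq [seq nth N0 G j | j <- S] ks ->
    {in S &, injective (nth N0 G)}.
  move=> uks p; have u : uniq [seq nth N0 G j | j <- S] by rewrite (perm_uniq p).
  move=> x y xK yK e; rewrite -(nth_index 0 xK) -(nth_index 0 yK).
  congr nth; apply/eqP; rewrite -(nth_uniq N0 _ _ u) ?size_map ?index_mem //.
  by rewrite !(nth_map 0) ?index_mem // !nth_index // e.
have Cinj := inj_of _ _ uc pC; have Kinj := inj_of _ _ uo pK.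
have rK : {in K &, forall i j : nat, i != j ->
  if lab (nth N0 G i) == lab (nth N0 G j) then null (N.land (nth N0 G i) (nth N0 G j))
  else single (N.land (nth N0 G i) (nth N0 G j))}.
  move=> i j iK jK ij; apply: relo; rewrite ?kE //.
  by apply: contra ij => /eqP /(Kinj _ _ iK jK) ->.
have nK : size (undup [seq lab (nth N0 G j) | j <- K]) <= 4.
  apply: leq_trans nl; apply: eq_leq; apply: perm_size; apply: perm_undup => x.
  by rewrite (map_comp lab) (perm_mem (perm_map lab pK)).
have cK x : count (fun j => lab (nth N0 G j) == x) K <= 6.
  by apply: leq_trans (cl x); rewrite -(seq.permP pK) count_map.
have szC : size C = size cs by rewrite -(perm_size pC) size_map.
have szK : size K = size os by rewrite -(perm_size pK) size_map.
have RK j : j \in K -> nth false R j.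
  move=> jK; have := KG1 j jK; have /= := allP KG j jK.
  rewrite /R size_cat nth_cat size_nseq => h1 h2.
  by rewrite ltnNge h2 /= nth_nseq; case: ltnP => //; move: h1 h2; clear; ssrlia.
have fin k R' acc : search_sub rows leaf 6 4 k R' acc = true -> size os = k ->
    (forall j, j \in K -> nth false R' j) -> perm_eq acc cs ->
    exists2 s, leaf s = true & perm_eq s (cs ++ os).
  move=> H' ek RR part_mask.
  have [s hs ps] := search_sub_leaf KG rK H' (fun x h => h) sK (etrans szK ek) RR nK cK.
  exists (s ++ acc) => //; rewrite perm_sym perm_catC perm_sym.
  by apply: perm_cat => //; apply: perm_trans ps pK.
move: H; case E : (search_sub _ _ _ _ _ _ _) => // H.
case: (posnP (size C)) => [C0|Cpos].
  have e0 : cs = [::] by apply/size0nil; rewrite -szC.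
  by apply: (fin _ _ _ E) => //; rewrite ?e0 //; move: sz; rewrite e0.
have hC j : j \in C -> [/\ 0 <= j, j < size rows & nth false L (j - 0)].
  move=> jC; rewrite size_rows_of CG' // subn0; split=> //.
  have /= h := allP CG j jC; by rewrite /L nth_nseq h.
have dC : {in C &, forall j h : nat, j < h -> row_disj rows j (h - j.+1)}.
  move=> j h jC hC' jh; rewrite row_disj_rows_of ?subnKC ?CG' //.
  apply: relc; rewrite ?cE //; apply/negP => /eqP /(Cinj _ _ jC hC') e.
  by rewrite e ltnn in jh.
have uK : uniq K by apply: (sorted_uniq ltn_trans ltnn).
have sK6 : 6 <= size K by rewrite szK; move: sc3 sz; clear; ssrlia.
have oCK h j : h \in C -> j \in K -> row_meet1 rows h j.
  move=> hC' jK; rewrite row_meet1_rows_of; [|exact: CG'|exact: (allP KG j jK)].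
  by apply: relco; rewrite ?cE ?kE.
have szC' : 0 < size C <= 3 by rewrite Cpos szC.
rewrite -[X in extend_class _ _ X _ _ _ _](drop0 rows) in H.
have [R' [acc [RR kk part_mask]]] := extend_class_sound H sC szC' hC dC uK sK6 RK oCK.
rewrite cats0 in kk.
apply: (fin _ _ _ kk) => //; first by rewrite szC; move: sc3 sz; clear; ssrlia.
apply: (perm_trans part_mask); rewrite (_ : [seq _ | j <- C] = [seq nth N0 G j | j <- C]) //.
by apply: eq_map => j; rewrite row_mask_rows_of.
Qed.

(** * Concurrent triples *)

Definition conc (T : finType) (a b c : {set T}) : bool := a :&: b :&: c != set0.

Section Pattern.
Variables (n k : nat) (A : 'I_k -> {set 'I_n}).
Definition incidence (x : 'I_n) : {set 'I_k} := [set i | x \in A i].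
Definition incidence_card (P : {set 'I_k}) := #|[set x | incidence x == P]|.
Hypothesis A1 : forall i j, i != j -> #|A i :&: A j| = 1.

(** Two lines of [P] have a single common point, so at most one point has incidence set [P], and
    whether it does is decided by the lines concurrent with these two. *)
Lemma incidence_card_conc (P : {set 'I_k}) i j : i != j -> i \in P -> j \in P ->
  incidence_card P = [forall l, (l \in P) == conc (A i) (A j) (A l)].
Proof.
move=> ij iP jP; have /eqP/cards1P [x ex] := A1 ij.
have xE y : (y \in A i) && (y \in A j) = (y == x) by rewrite -in_setI ex inE.
have cE l : conc (A i) (A j) (A l) = (x \in A l).
  rewrite /conc ex; apply/set0Pn/idP => [[y]|xl]; first by rewrite !inE => /andP [/eqP ->].
  by exists x; rewrite !inE eqxx.
have -> : [forall l, (l \in P) == conc (A i) (A j) (A l)] = (incidence x == P).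
  apply/forallP/eqP => [h|<- l]; last by rewrite cE inE.
  by apply/setP => l; rewrite inE -cE (eqP (h l)).
rewrite /incidence_card; case: (eqVneq (incidence x) P) => e.
  rewrite (_ : [set _ | _] = [set x]) ?cards1 //.
  apply/setP => y; rewrite !inE; apply/eqP/eqP => [ey|-> //].
  apply/eqP; rewrite -xE.
  by move: iP jP; rewrite -ey !inE => -> ->.
rewrite (_ : [set _ | _] = set0) ?cards0 //; apply/setP => y; rewrite !inE.
apply/negbTE/negP => /eqP ey; move: iP jP; rewrite -ey !inE => yi yj.
by have := xE y; rewrite yi yj => /esym/eqP yx; move: e; rewrite -yx ey eqxx.
Qed.

Lemma sum_incidence_line i : \sum_(P : {set 'I_k} | i \in P) incidence_card P = #|A i|.
Proof.
rewrite -sum1_card (partition_big incidence (fun P => i \in P)) /=; last by move=> x; rewrite inE.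
apply: eq_bigr => P iP; rewrite /incidence_card -sum1_card; apply: eq_bigl => x.
rewrite inE; case: eqP => [e|]; rewrite ?andbF // andbT.
by move: iP; rewrite -e inE.
Qed.
Lemma sum_incidence : \sum_P incidence_card P = n.
Proof.
rewrite -[RHS]card_ord -sum1_card (partition_big incidence predT) //=.
by apply: eq_bigr => P _; rewrite /incidence_card -sum1_card; apply: eq_bigl => x; rewrite inE.
Qed.
End Pattern.

Lemma exists_other (T : finType) (P : {set T}) i : i \in P -> P != [set i] ->
  exists2 j, j != i & j \in P.
Proof.
move=> iP nP; have /set0Pn [j] : P :\ i != set0.
  by apply: contra nP => /eqP e; rewrite -(setD1K iP) e setU0.
by rewrite !inE => /andP [ji jP]; exists j.
Qed.

(* A family of lines meeting pairwise once is determined, up to a permutation of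
   the points, by its concurrent triples: these give the number of points lying
   on any two lines and no other ones of a given subset, and the number of
   points on one or no line follows from the cardinals. *)
Lemma conc_perm n k (A B : 'I_k -> {set 'I_n}) :
  (forall i j, i != j -> #|A i :&: A j| = 1) ->
  (forall i j, i != j -> #|B i :&: B j| = 1) ->
  (forall i, #|A i| = #|B i|) ->
  (forall i j l, i != j -> conc (A i) (A j) (A l) = conc (B i) (B j) (B l)) ->
  exists g : {perm 'I_n}, forall i, g @: A i = B i.
Proof.
move=> A1 B1 AB cAB.
have e2 (P : {set 'I_k}) i j : i != j -> i \in P -> j \in P -> incidence_card A P = incidence_card B P.
  move=> ij iP jP; rewrite (incidence_card_conc A1 ij iP jP) (incidence_card_conc B1 ij iP jP); congr nat_of_bool.
  by apply: eq_forallb => l; rewrite cAB.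
(* Every other set containing [i] has a second member, so the number of points on line [i] alone
   follows from [#|A i|] by subtraction. *)
have e1 i : incidence_card A [set i] = incidence_card B [set i].
  have := sum_incidence_line A i; have := sum_incidence_line B i; rewrite AB => <-.
  rewrite (bigD1 [set i]) /=; last by rewrite inE.
  rewrite [in RHS](bigD1 [set i]) /=; last by rewrite inE.
  rewrite (eq_bigr (fun P => incidence_card B P)); first by move/addIn.
  move=> P /andP [iP /(exists_other iP) [j ji jP]]; exact: (e2 P j i).
have eP (P : {set 'I_k}) : incidence_card A P = incidence_card B P.
  case: (set_0Vmem P) => [->|[i iP]]; last first.
    case: (eqVneq P [set i]) => [->|/(exists_other iP) [j ji jP]]; first exact: e1.
    exact: (e2 P j i).
  (* Likewise the number of points on no line follows from the total number of points. *)
  have := sum_incidence A; rewrite -[X in _ = X](sum_incidence B).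
  rewrite (bigD1 set0) //= [in RHS](bigD1 set0) //=.
  rewrite (eq_bigr (fun P => incidence_card B P)); first by move/addIn.
  move=> Q /set0Pn [i iQ].
  case: (eqVneq Q [set i]) => [->|/(exists_other iQ) [j ji jP]]; first exact: e1.
  exact: (e2 Q j i).
have cnt (C : 'I_k -> {set 'I_n}) (P : {set 'I_k}) : count_mem P [tuple incidence C x | x < n] = incidence_card C P.
  rewrite /incidence_card cardE /enum_mem size_filter /= count_map enumT; apply: eq_count => x.
  by rewrite /= inE.
(* Equal counts make the two incidence tuples rearrangements of each other; the rearrangement of
   positions is the permutation of the points. *)
have /tuple_permP [g eg] : perm_eq [tuple incidence B x | x < n] [tuple incidence A x | x < n].
  by apply/allP => P _ /=; rewrite !cnt eP.
have pE x : incidence B x = incidence A (g x).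
  have := congr1 (fun s => nth set0 s x) eg.
  by rewrite -!tnth_nth !tnth_mktuple.
exists (g^-1)%g => i; apply/setP => x.
rewrite -[x in LHS](permK g) mem_imset; last exact: perm_inj.
have := congr1 (fun s : {set 'I_k} => i \in s) (pE x).
by rewrite /= !inE => ->.
Qed.

(** * Enumeration of triple arrays up to symmetry *)

Section Eqs.
Variables (A : eqType) (e : A -> A -> bool).
Hypothesis eP : forall x y, e x y -> x = y.
Lemma eq_seqP s t : eq_seq e s t -> s = t.
Proof.
elim: s t => [|x s IH] [|y t] //=; case: ifP => // /eP -> /IH -> //.
Qed.
End Eqs.

Lemma eq_arrayP a b : eq_array a b -> a = b.
Proof.
apply: eq_seqP => {a b} a b; apply: eq_seqP => {a b} a b; apply: eq_seqP => {a b} [] [] [] //.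
Qed.
Lemma dedup_sub (A : eqType) (e : A -> A -> bool) : (forall x y, e x y -> x = y) ->
  forall s, {subset s <= dedup e s}.
Proof.
move=> eP; elim=> //= y s IH x.
have mE : mem_by e y s -> y \in s.
  elim: (s) => //= z t IHt; rewrite inE; case: ifP => [/eP -> _|_ /IHt ->]; by rewrite ?eqxx ?orbT.
rewrite inE => /orP [/eqP ->|/IH h]; last by case: ifP => // _; rewrite inE h orbT.
by case: ifP => [/mE /IH //|]; rewrite inE eqxx.
Qed.

Section Vecs.
Variables (n : nat) (full : bool) (T : triple_array).
Lemma layer_codesP m i avail (v : seq nat) : size v = m -> uniq [seq x <- v | x < n] ->
  (forall x, x \in v -> if x < n then x \in avail else (x == n) && ~~ full) ->
  (forall a, a < m -> nth 0 v a < n ->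
     ~~ has (fun L => nth false (nth [::] L (i + a)) (nth 0 v a)) T) ->
  uniq avail ->
  v \in layer_codes n full T m i avail.
Proof.
elim: m i avail v => [|m IH] i avail [|x v] //= [sv] uv xv hv ua.
have hv' a : a < m -> nth 0 v a < n ->
     ~~ has (fun L => nth false (nth [::] L (i.+1 + a)) (nth 0 v a)) T.
  by move=> am; have := hv a.+1 am; rewrite addSnnS.
rewrite mem_cat; have := xv x (mem_head _ _).
case: (ltnP x n) uv => [xn /= /andP [xnv uv] xa|xn uv /andP [/eqP ex nf]].
  apply/orP; left; apply/flattenP; eexists; first by apply/mapP; exists x.
  have := hv 0 isT xn; rewrite addn0 /= => /negPf ->.
  apply: map_f; apply: IH => //; last by rewrite rem_uniq.
  move=> y yv; have := xv y; rewrite inE yv orbT => /(_ isT).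
  case: ifP => // yn ya; rewrite mem_rem_uniq // inE ya andbT.
  by apply: contra xnv => /eqP <-; rewrite mem_filter yn.
apply/orP; right; rewrite ifN // ex; apply: map_f; apply: IH => //.
by move=> y yv; apply: xv; rewrite inE yv orbT.
Qed.
End Vecs.

Section Arrays.
Variable L : finType.
Variable cc : L -> L -> L -> bool.
Hypotheses (ccC : forall a b c, cc a b c = cc b a c) (ccA : forall a b c, cc a b c = cc a c b).
Variable l0 : L.
Implicit Type A : nat -> seq L.
Definition layer A s := [seq [seq cc r c s | c <- A 1] | r <- A 0].
Definition array_of A : triple_array := [seq layer A s | s <- A 2].

Lemma cell_array_of A i j k : i < size (A 0) -> j < size (A 1) -> k < size (A 2) ->
  cell (array_of A) i j k = cc (nth l0 (A 0) i) (nth l0 (A 1) j) (nth l0 (A 2) k).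
Proof. by move=> hi hj hk; rewrite /cell (nth_map l0) // (nth_map l0) // (nth_map l0). Qed.

Lemma mkseq_map (B : Type) (f F : nat -> B) (s : seq nat) n : size s = n ->
  (forall k, k \in s -> forall i, nth 0 s i = k -> f i = F k) -> mkseq f n = map F s.
Proof.
move=> <- h; apply: (@eq_from_nth _ (f 0)); rewrite size_mkseq ?size_map // => i hi.
by rewrite nth_mkseq // (nth_map 0) //; apply: h; rewrite ?mem_nth.
Qed.

Lemma perm_seq_perm (B : eqType) (x0 : B) (S : seq B) s : perm_seq (size S) s ->
  perm_eq [seq nth x0 S i | i <- s] S.
Proof.
case/and3P => /eqP es /allP ls us.
have p : perm_eq s (iota 0 (size S)).
  apply: uniq_perm; rewrite ?iota_uniq //.
  have [| |_ h] := @uniq_min_size _ s (iota 0 (size S)) us => //.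
  - by move=> x /ls; rewrite mem_iota.
  - by rewrite size_iota es.
by rewrite (perm_trans (perm_map _ p)) // -[X in perm_eq _ X](mkseq_nth x0).
Qed.

(** Concurrency is symmetric in its three lines, so relabelling inside the pencils and permuting the
    pencils both carry an array of lines to another one. Moving the third pencil requires it to be
    as large as the others. *)
Lemma act_hint_array_of n A s0 s1 s2 t : size (A 0) = n -> size (A 1) = n ->
  valid_hint n (size (A 2)) (s0, s1, s2, t) ->
  let A' g := [seq nth l0 (A (slot t g)) i | i <- sel s0 s1 s2 g] in
  [/\ act_hint n (s0, s1, s2, t) (array_of A) = array_of A',
      forall g, g < 3 -> perm_eq (A' g) (A (slot t g))
    & (t < 2) || (size (A 2) == n) && (t < 6)].
Proof.
move=> e0 e1 /and4P [ok0 ok1 ok2 ht] A'.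
have ht' : t < 6 by ssrlia.
have okg g : g < 3 -> perm_seq (size (A (slot t g))) (sel s0 s1 s2 g).
  move: ht' ht; case: t {A'} => [|[|[|[|[|[|t]]]]]] // _ ht; case: g => [|[|[|g]]] // _;
  rewrite /slot /= ?e0 ?e1 //; case/andP: ht => /eqP e2 _; rewrite e2 in ok2; by rewrite ?e2.
have szg g : g < 3 -> size (sel s0 s1 s2 g) = size (A (slot t g)).
  by move=> /okg /and3P [/eqP].
have ltg g x : g < 3 -> x \in sel s0 s1 s2 g -> x < size (A (slot t g)).
  by move=> /okg /and3P [_ /allP h _] /h.
split=> //; last by move=> g g3; exact: perm_seq_perm (okg g g3).
case/and3P: ok0 => /eqP z0 _ _; case/and3P: ok1 => /eqP z1 _ _; case/and3P: ok2 => /eqP z2 _ _.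
rewrite /act_hint /make_array size_map /array_of -map_comp.
apply: mkseq_map => // z zs k ek /=; rewrite /layer /A' /= -map_comp.
apply: mkseq_map => // x xs i ei /=; rewrite -map_comp.
apply: mkseq_map => // y ys j ej /=; rewrite ei ej ek -/(array_of A).
have {ltg okg szg} := (ltg 0 x isT xs, ltg 1 y isT ys, ltg 2 z isT zs).
move: ht'; case: t {ht A'} => [|[|[|[|[|[|t]]]]]] // _ [[h0 h1] h2];
  rewrite /slot_inv /= cell_array_of //;
  first [done | by rewrite ccC | by rewrite ccA | by rewrite ccC ccA | by rewrite ccA ccC
        | by rewrite ccC ccA ccC].
Qed.

Lemma normaliseP n A h : size (A 0) = n -> size (A 1) = n ->
  exists t A', [/\ normalise n h (array_of A) = array_of A',
      forall g, g < 3 -> perm_eq (A' g) (A (slot t g))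
    & (t < 2) || (size (A 2) == n) && (t < 6)].
Proof.
move=> e0 e1; rewrite /normalise size_map; case: ifP => [ok|_].
  case: h ok => [[[s0 s1] s2] t] ok.
  have [a b c] := act_hint_array_of e0 e1 ok.
  by exists t; eexists; split; [exact: a|exact: b|].
by exists 0, A; split=> // -[|[|[|]]].
Qed.

Lemma next_levelP n full K reps hs T e : T \in reps -> e \in extensions n full T ->
  exists2 h, e = h \/ (exists x, h = normalise n x e) & h \in next_level n full K reps hs.
Proof.
move=> hT he.
have {he hT} he : e \in flatten [seq extensions n full T | T <- reps].
  by apply/flattenP; exists (extensions n full T) => //; apply: map_f.
suff [h a b] : exists2 h, e = h \/ (exists x, h = normalise n x e) &
    h \in apply_hints n K (flatten [seq extensions n full T | T <- reps]) hs.
  by exists h => //; apply: dedup_sub => //; exact: eq_arrayP.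
elim: (flatten _) hs he => //= e' es IH [|h hs]; first by exists e; [left|].
rewrite inE => /orP [/eqP <-|/(IH hs) [x hx xin]].
  by exists (normalise n (decode_hint n K h) e); [right; eexists | rewrite mem_head].
by exists x => //; rewrite inE xin orbT.
Qed.
End Arrays.

Section Exts.
Variable L : finType.
Variable cc : L -> L -> L -> bool.
Implicit Type A : nat -> seq L.
Definition add_third A s g := sel (A 0) (A 1) (rcons (A 2) s) g.

Lemma array_of_add_third A s : array_of cc (add_third A s) = rcons (array_of cc A) (layer cc A s).
Proof. by rewrite /array_of /add_third /= map_rcons. Qed.

(** The layer of the new line has at most one true entry in each row and column, and none at a cell
    used by an earlier layer; these are the rules by which layers are generated. *)
Lemma extensions_array_of n (full : bool) A s : size (A 0) = n -> size (A 1) = n ->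
  uniq (A 0) -> uniq (A 1) ->
  (forall r c c', r \in A 0 -> c \in A 1 -> c' \in A 1 -> cc r c s -> cc r c' s -> c = c') ->
  (forall r r' c, r \in A 0 -> r' \in A 0 -> c \in A 1 -> cc r c s -> cc r' c s -> r = r') ->
  (forall r c s', r \in A 0 -> c \in A 1 -> s' \in A 2 -> cc r c s -> ~~ cc r c s') ->
  (full -> forall r, r \in A 0 -> has (fun c => cc r c s) (A 1)) ->
  (~~ full -> admissible (array_of cc A) (layer cc A s)) ->
  array_of cc (add_third A s) \in extensions n full (array_of cc A).
Proof.
move=> e0 e1 u0 u1 hr hc hs hf hok; rewrite array_of_add_third /extensions; apply: map_f.
(* On a row without true entry [find] returns the length [n] of the row, which is precisely the code
   of such a row. *)
pose v := [seq find (fun c => cc r c s) (A 1) | r <- A 0].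
have layE : layer cc A s = layer_of n v.
  rewrite /layer /layer_of -map_comp; apply/eq_in_map => r row0 /=.
  case El : (A 1) => [|c0 s1]; first by rewrite -e1 El.
  rewrite -El; apply: (@eq_from_nth _ false) => [|j]; rewrite ?size_map ?size_iota ?e1 // => hj.
  rewrite -e1 in hj; rewrite (nth_map c0) // (nth_map 0) ?size_iota -?e1 // nth_iota // add0n.
  set fi := find _ _; apply/idP/eqP => [hcc|e].
    have hh : has (fun c => cc r c s) (A 1) by apply/hasP; exists (nth c0 (A 1) j) => //; apply: mem_nth.
    have := nth_find c0 hh; rewrite -/fi => hfi.
    have lfi : fi < size (A 1) by rewrite /fi -has_find.
    have := hr r _ _ row0 (mem_nth c0 lfi) (mem_nth c0 hj) hfi hcc.
    by move/eqP; rewrite nth_uniq // => /eqP.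
  have hh : has (fun c => cc r c s) (A 1) by rewrite has_find -/fi e.
  by have := nth_find c0 hh; rewrite -/fi e.
rewrite mem_filter; apply/andP; split; first by case: full hok {hf} => // /(_ isT).
rewrite layE; apply: map_f; apply: layer_codesP.
- by rewrite size_map.
- have nthE r : r \in A 0 -> find (fun c => cc r c s) (A 1) < n ->
      exists2 c, c \in A 1 & cc r c s /\ index c (A 1) = find (fun c => cc r c s) (A 1).
    move=> row0; rewrite -e1 -has_find => hh; have /hasP [c0 _ _] := hh.
    have lf : find (fun c => cc r c s) (A 1) < size (A 1) by rewrite -has_find.
    exists (nth c0 (A 1) (find (fun c => cc r c s) (A 1))); first exact: mem_nth.
    by rewrite index_uniq //; split=> //; exact: (nth_find c0 hh).
  rewrite /v filter_map map_inj_in_uniq ?filter_uniq // => r r'.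
  rewrite !mem_filter /= => /andP [h row0] /andP [h' r'0] e.
  have [c c1 [a b]] := nthE r row0 h; have [c' c'1 [a' b']] := nthE r' r'0 h'.
  have ec : c = c' by rewrite -(nth_index c c1) -(nth_index c c'1) b b' e.
  by apply: (hc r r' c) => //; rewrite ec.
- move=> x /mapP [r row0 ->]; case: ifP => [h|/negbT h]; first by rewrite mem_iota.
  have hh := find_size (fun c => cc r c s) (A 1); rewrite e1 in hh.
  rewrite -leqNgt in h; rewrite eqn_leq hh h /=.
  apply/negP => ff; have := hf ff r row0; rewrite has_find e1; ssrlia.
- move=> a am; have hv : nth 0 v a = find (fun c => cc (nth s (A 0) a) c s) (A 1).
    by rewrite (nth_map s) // e0.
  rewrite hv => hlt; apply/hasPn => _ /mapP [s' s'2 ->].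
  have row0 : nth s (A 0) a \in A 0 by apply: mem_nth; rewrite e0.
  rewrite (nth_map s) ?e0 // (nth_map s) ?e1 //.
  have hh : has (fun c => cc (nth s (A 0) a) c s) (A 1) by rewrite has_find e1.
  apply: hs => //; first by apply: mem_nth; rewrite e1.
  exact: (nth_find s hh).
- exact: iota_uniq.
Qed.

Definition weight A s := \sum_(r <- A 0) count (fun c => cc r c s) (A 1).
Lemma layer_weightE A s : layer_weight (layer cc A s) = weight A s.
Proof.
rewrite /layer_weight /layer /weight -map_comp sumnE big_map; apply: eq_bigr => r _ /=.
by rewrite count_map.
Qed.
Lemma weight_perm A A' s : perm_eq (A' 0) (A 0) -> perm_eq (A' 1) (A 1) -> weight A' s = weight A s.
Proof.
move=> p0 p1; rewrite /weight (perm_big _ p0); apply: eq_bigr => r _; exact: seq.permP.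
Qed.
(** A normalisation may exchange the first two pencils, while the order of the layers by weight must
    keep its meaning. *)
Lemma weight_swap A A' s : (forall a b, cc a b s = cc b a s) ->
  perm_eq (A' 0) (A 1) -> perm_eq (A' 1) (A 0) -> weight A' s = weight A s.
Proof.
move=> h p0 p1; rewrite /weight (perm_big _ p0) /=.
under eq_bigr do rewrite (seq.permP p1) -sum1_count big_mkcond.
rewrite exchange_big /=; apply: eq_bigr => r _.
by rewrite -sum1_count [RHS]big_mkcond; apply: eq_bigr => c _; rewrite h.
Qed.

Lemma admissibleE A s n : size (A 0) = 4 -> size (A 1) = 4 -> size (A 2) = n ->
  2 <= weight A s -> (forall s', s' \in A 2 -> weight A s' <= weight A s) ->
  \sum_(s' <- rcons (A 2) s) weight A s' <= 4 + 2 * n.+1 ->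
  (forall r, r \in A 0 -> n.+1 <= \sum_(s' <- rcons (A 2) s) count (fun c => cc r c s') (A 1) + 2) ->
  (forall c, c \in A 1 -> n.+1 <= \sum_(s' <- rcons (A 2) s) count (fun r => cc r c s') (A 0) + 2) ->
  admissible (array_of cc A) (layer cc A s).
Proof.
move=> e0 e1 e2 w2 wm ws hr hc; rewrite /admissible size_map e2 layer_weightE.
apply/and5P; split=> //.
- by apply/allP => _ /mapP [s' hs ->]; rewrite layer_weightE; apply: wm.
- rewrite sumnE big_map /array_of -map_rcons big_map.
  by rewrite (eq_bigr (weight A)) // => s' _; rewrite layer_weightE.
- apply/allP => i; rewrite mem_iota add0n => /andP [_ i4].
  rewrite sumnE big_map /array_of -map_rcons big_map.
  rewrite (eq_bigr (fun s' => count (fun c => cc (nth s (A 0) i) c s') (A 1))).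
    by apply: hr; apply: mem_nth; rewrite e0.
  by move=> s' _; rewrite (nth_map s) ?e0 // count_map.
apply/allP => j; rewrite mem_iota add0n => /andP [_ j4].
rewrite sumnE big_map /array_of -map_rcons big_map.
rewrite (eq_bigr (fun s' => count (fun r => cc r (nth s (A 1) j) s') (A 0))).
  by apply: hc; apply: mem_nth; rewrite e1.
by move=> s' _; rewrite count_map; apply: eq_count => r /=; rewrite (nth_map s) ?e1.
Qed.
End Exts.

Local Notation pt := 'I_43.
Local Notation line := {set pt}.

(** * Lines through three points of a line *)

Lemma concC (T : finType) (a b c : {set T}) : conc a b c = conc b a c.
Proof. by rewrite /conc (setIC a). Qed.
Lemma concA (T : finType) (a b c : {set T}) : conc a b c = conc a c b.
Proof. by rewrite /conc setIAC. Qed.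
Lemma concP (T : finType) (a b c : {set T}) :
  reflect (exists x, [/\ x \in a, x \in b & x \in c]) (conc a b c).
Proof.
apply: (iffP (set0Pn _)) => [[x]|[x [h1 h2 h3]]].
  by rewrite !inE => /andP [/andP [? ?] ?]; exists x.
by exists x; rewrite !inE h1 h2.
Qed.

(** The number of lines is left free, so that the notion passes to sub-families and can be used to
    extend a family by a line. *)
Definition is_ppl (M : {set line}) : Prop :=
  (forall l, l \in M -> #|l| = 7) /\
  (forall l m, l \in M -> m \in M -> l != m -> #|l :&: m| = 1).

Section Ppl.
Variables (M : {set line}) (HM : is_ppl M).
Lemma meet_eq l m x y : l \in M -> m \in M -> l != m ->
  x \in l -> x \in m -> y \in l -> y \in m -> x = y.
Proof.
move=> lM mM lm xl xm yl ym; have [_ /(_ _ _ lM mM lm) /eqP/cards1P [z ez]] := HM.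
have := in_set1 x z; have := in_set1 y z; rewrite -!ez !inE xl xm yl ym.
by move=> /esym/eqP -> /esym/eqP ->.
Qed.
Lemma meet_ex l m : l \in M -> m \in M -> exists x, x \in l /\ x \in m.
Proof.
move=> lM mM; case: (eqVneq l m) => [<-|lm].
  have [/(_ _ lM) h _] := HM; have /set0Pn [x xl] : l != set0 by rewrite -cards_eq0 h.
  by exists x.
have [_ /(_ _ _ lM mM lm) /eqP/cards1P [z ez]] := HM.
by have := set11 z; rewrite -ez inE => /andP [? ?]; exists z.
Qed.
Definition meet_pt (l m : line) : pt := odflt ord0 [pick x in l :&: m].
Lemma meet_ptP l m : l \in M -> m \in M -> meet_pt l m \in l /\ meet_pt l m \in m.
Proof.
move=> lM mM; rewrite /meet_pt; case: pickP => [x|h]; first by rewrite inE => /andP.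
by have [x [a b]] := meet_ex lM mM; have := h x; rewrite inE a b.
Qed.
End Ppl.

Lemma sum_card_leq (T : finType) (S : seq {set T}) (D : {set T}) :
  pairwise (fun a b : {set T} => [disjoint a & b]) S ->
  all (fun a : {set T} => a \subset D) S ->
  \sum_(a <- S) #|a| <= #|D|.
Proof.
elim: S D => [|s S IH] D /=; first by rewrite big_nil.
move=> /andP [/allP ds pS] /andP [sD /allP aS].
rewrite big_cons -(cardsID s D) (setIidPr sD) leq_add2l; apply: IH => //.
by apply/allP => a aS'; rewrite subsetD aS // disjoint_sym ds.
Qed.

(** [A g] lists some lines through [p g], not necessarily all: seeds grow one line at a time, and a
    third point of large degree contributes only part of its pencil. *)
Record net (M : {set line}) (l0 : line) (p : nat -> pt) (A : nat -> seq line) : Prop := Net {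
  net_ppl : is_ppl M;
  net_l0 : l0 \in M;
  net_pl : forall g, g < 3 -> p g \in l0;
  net_inj : forall g h, g < 3 -> h < 3 -> p g = p h -> g = h;
  net_uniq : forall g, g < 3 -> uniq (A g);
  net_mem : forall g x, g < 3 -> x \in A g -> [/\ x \in M, x != l0 & p g \in x] }.

Section Net.
Variables (M : {set line}) (l0 : line) (p : nat -> pt) (A : nat -> seq line).
Hypothesis HN : net M l0 p A.
Let HM := net_ppl HN.

Lemma net_notin g h x : g < 3 -> h < 3 -> g != h -> x \in A g -> p h \notin x.
Proof.
move=> g3 h3 gh xA; have [xM xl px] := net_mem HN g3 xA; apply/negP => phx.
case/eqP: gh; apply: (net_inj HN) => //.
by apply: (meet_eq HM xM (net_l0 HN) xl) => //; apply: (net_pl HN).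
Qed.
Lemma net_neq g h x y : g < 3 -> h < 3 -> g != h -> x \in A g -> y \in A h -> x != y.
Proof.
move=> g3 h3 gh xA yA; apply/eqP => e; have [_ _ py] := net_mem HN h3 yA.
by have := net_notin g3 h3 gh xA; rewrite e py.
Qed.
(** Distinct lines through [p g] meet only there, and [p g] is not on [y]. *)
Lemma net_conc g h x x' y : g < 3 -> h < 3 -> g != h -> x \in A g -> x' \in A g ->
  y \in A h -> conc x x' y -> x = x'.
Proof.
move=> g3 h3 gh xA x'A yA /concP [z [zx zx' zy]]; apply/eqP; apply/negP => /negP ne.
have [xM _ px] := net_mem HN g3 xA; have [x'M _ px'] := net_mem HN g3 x'A.
have e := meet_eq HM xM x'M ne zx zx' px px'.
have hg : h != g by rewrite eq_sym.
by have := net_notin h3 g3 hg yA; rewrite -e zy.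
Qed.
Lemma net_off g x z : g < 3 -> x \in A g -> z \in x -> z \in l0 -> z = p g.
Proof.
move=> g3 xA zx zl; have [xM xl px] := net_mem HN g3 xA.
exact: (meet_eq HM xM (net_l0 HN) xl zx zl px (net_pl HN g3)).
Qed.

(** Among the seven points of [l] are [p g] and its intersections with the four lines of [A h]. Two
    points are left for the lines of [A k] that meet [l] elsewhere, and different such lines use
    different points. *)
Lemma hits_bound g h k l : g < 3 -> h < 3 -> k < 3 -> g != h -> g != k -> h != k ->
  l \in A g -> size (A h) = 4 ->
  count (fun s => ~~ has (fun x => conc l x s) (A h)) (A k) <= 2.
Proof.
move=> g3 h3 k3 gh gk hk lA s4; have [lM ll pl] := net_mem HN g3 lA.
rewrite -size_filter; set J := [seq s <- A k | _].
have mA i x : i < 3 -> x \in A i -> meet_pt l x \in l /\ meet_pt l x \in x.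
  by move=> i3 xA; have [xM _ _] := net_mem HN i3 xA; apply: (meet_ptP HM).
have JA s : s \in J -> s \in A k by rewrite mem_filter => /andP [].
have inj i x y : i < 3 -> g != i -> x \in A i -> y \in A i -> meet_pt l x = meet_pt l y -> x = y.
  move=> i3 gi xA yA e; apply: (@net_conc i g _ _ l) => //; first by rewrite eq_sym.
  apply/concP; exists (meet_pt l x); have [a b] := mA i x i3 xA; have [c d] := mA i y i3 yA.
  by split=> //; rewrite e.
have npg i x : i < 3 -> g != i -> x \in A i -> meet_pt l x != p g.
  move=> i3 gi xA; have [a b] := mA i x i3 xA; apply/eqP => e.
  have ig : i != g by rewrite eq_sym.
  by have := net_notin i3 g3 ig xA; rewrite -e b.
pose pts := p g :: map (meet_pt l) (A h) ++ map (meet_pt l) J.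
have upts : uniq pts.
  rewrite /pts cons_uniq mem_cat cat_uniq !map_inj_in_uniq ?filter_uniq ?(net_uniq HN) // ?andbT /=.
  - rewrite negb_or; apply/andP; split.
    + by apply/andP; split; apply/negP => /mapP [x xA e]; [have := npg h x h3 gh xA | have := npg k x k3 gk (JA _ xA)]; rewrite -e eqxx.
    apply/hasPn => _ /mapP [s sJ ->]; apply/negP => /mapP [x xA e].
    move: sJ; rewrite mem_filter => /andP [/hasPn /(_ x xA) /negP nc sA].
    apply: nc; apply/concP; exists (meet_pt l s).
    have [a b] := mA k s k3 sA; have [c d] := mA h x h3 xA; by split=> //; rewrite e.
  - by move=> x y /JA xA /JA yA; apply: (inj k).
  - by move=> x y xA yA; apply: (inj h).
have : size pts <= #|l|.
  rewrite cardE; apply: uniq_leq_size => // z; rewrite mem_enum inE mem_cat.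
  case/or3P => [/eqP -> //|/mapP [x xA ->]|/mapP [x /JA xA ->]]; by have [] := mA _ x _ xA.
have [-> // _] := HM; rewrite /= size_cat !size_map s4; ssrlia.
Qed.

Hypotheses (e0 : size (A 0) = 4) (e1 : size (A 1) = 4).
Let cc := @conc pt.
Let R := \bigcup_(r <- A 0) r.
Let O := ~: (l0 :|: R :|: \bigcup_(c <- A 1) c).

Let memR x : (x \in R) = has (fun r : line => x \in r) (A 0).
Proof. by rewrite /R; elim: (A 0) => [|r S IH] /=; rewrite ?big_nil ?big_cons inE ?IH. Qed.
Let memC x : (x \in \bigcup_(c <- A 1) c) = has (fun r : line => x \in r) (A 1).
Proof. by elim: (A 1) => [|r S IH] /=; rewrite ?big_nil ?big_cons inE ?IH. Qed.

Lemma meet_pt_eq g h l x z : g < 3 -> h < 3 -> g != h -> l \in A g -> x \in A h ->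
  z \in l -> z \in x -> z = meet_pt l x.
Proof.
move=> g3 h3 gh lA xA zl zx; have [lM _ _] := net_mem HN g3 lA.
have [xM _ _] := net_mem HN h3 xA; have [a b] := meet_ptP HM lM xM.
exact: (meet_eq HM lM xM (net_neq g3 h3 gh lA xA)).
Qed.

Lemma count_has (T : eqType) (P : pred T) (S : seq T) : uniq S ->
  {in S &, forall x y, P x -> P y -> x = y} -> count P S = has P S.
Proof.
elim: S => //= x S IH /andP [xS uS] h; rewrite IH //; last first.
  by move=> y z yS zS; apply: h; rewrite inE ?yS ?zS orbT.
case Px: (P x) => //=; case: hasP => // -[y yS Py].
by move: xS; rewrite (h x y) ?inE ?eqxx ?yS ?orbT.
Qed.

Lemma count_neg (T : Type) (P : T -> bool) S : count P S + count (fun x => ~~ P x) S = size S.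
Proof. exact: count_predC. Qed.

(** [l0] has 7 points and the lines through [p 0] add 4 * 6. A line through [p 1] has at most five
    points on these, namely [p 1] and four intersections, so it adds at least two. This covers 7 +
    24 + 8 = 39 points out of 43. *)
Lemma card_outside : #|O| <= 4.
Proof.
have c2 (c : line) : c \in A 1 -> 2 <= #|c :\: (l0 :|: R)|.
  move=> cA; have [cM cl pc] := net_mem HN (isT : 1 < 3) cA.
  have : #|c| <= size (enum (c :\: (l0 :|: R)) ++ p 1 :: map (meet_pt c) (A 0)).
    rewrite cardE; apply: uniq_leq_size; first exact: enum_uniq.
    move=> z; rewrite mem_enum => zc; rewrite mem_cat mem_enum in_setD zc andbT in_setU memR.
    case: hasP => [[r rA zr]|_]; last first.
      rewrite orbF; case zl : (z \in l0) => //=; rewrite inE.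
      by rewrite (net_off (isT : 1 < 3) cA zc zl) eqxx.
    rewrite orbT /= inE (@meet_pt_eq 1 0 c r z) // map_f ?orbT //.
  have [-> // _] := HM; by rewrite size_cat /= size_map e0 -cardE -[7]/(2 + 5) leq_add2r.
pose S := [:: O; l0] ++ map (fun r : line => r :\: l0) (A 0)
   ++ map (fun c : line => c :\: (l0 :|: R)) (A 1).
have : \sum_(a <- S) #|a| <= #|[set: pt]|.
  apply: sum_card_leq; last by apply/allP => a _; exact: subsetT.
  have pw g (F : line -> line) : g < 3 -> (forall x : line, F x \subset x) ->
     (forall x, p g \notin F x) ->
     pairwise (fun a b : line => [disjoint a & b]) (map F (A g)).
    move=> g3 hF pF; rewrite pairwise_map; have := net_uniq HN g3.
    rewrite uniq_pairwise; apply: sub_in_pairwise (allss _).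
    move=> x y xA yA /= xy; apply/pred0P => z /=; apply/negP => /andP [zx zy].
    have [xM _ px] := net_mem HN g3 xA; have [yM _ py] := net_mem HN g3 yA.
    have e := meet_eq HM xM yM xy (subsetP (hF x) _ zx) (subsetP (hF y) _ zy) px py.
    by move: (pF x); rewrite -e zx.
  rewrite /S !pairwise_cat /= andbT !pw //; first 1 last.
  - by move=> x; exact: subsetDl.
  - by move=> x; rewrite !inE (net_pl HN).
  - by move=> x; exact: subsetDl.
  - by move=> x; rewrite !inE (net_pl HN).
  rewrite !andbT /allrel /=; apply/and3P; split; last first.
  - apply/allP => _ /mapP [r rA ->]; apply/allP => _ /mapP [c cA ->].
    apply/pred0P => z /=; rewrite !inE memR; apply/negP => /andP [/andP [_ zr]].
    case/andP => /norP [_ /hasPn /(_ r rA) /negP h] _; exact: (h zr).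
  - by rewrite -setI_eq0; apply/eqP/setP => z; rewrite in_setI in_setC !in_setU in_set0; case: (z \in l0); rewrite ?andbF.
  have hO : all (fun y : line => [disjoint O & y])
       ([seq r :\: l0 | r <- A 0] ++ [seq c :\: (l0 :|: R) | c <- A 1]).
    rewrite all_cat; apply/andP; split; apply/allP => _ /mapP [r rA ->];
     apply/pred0P => z /=; rewrite !in_setC !in_setU in_setD memR memC; apply/negP.
      case/andP => /norP [/norP [_ /hasPn /(_ r rA) /negPf h] _]; by rewrite h andbF.
    by case/andP => /norP [_ /hasPn /(_ r rA) /negPf h]; rewrite h andbF.
  rewrite hO /= all_cat andbT; apply/andP; split; apply/allP => _ /mapP [r rA ->];
    apply/pred0P => z /=; rewrite !inE; by case: (z \in l0).
rewrite cardsT card_ord /S big_cat !big_cons big_nil big_cat /= !big_map.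
have [c7 m1] := HM; rewrite (c7 l0 (net_l0 HN)).
have -> : \sum_(r <- A 0) #|r :\: l0| = 24.
  rewrite (eq_big_seq (fun=> 6)); first by rewrite big_const_seq iter_addn_0 count_predT e0.
  move=> r rA; have [rM rl _] := net_mem HN (isT : 0 < 3) rA.
  have := cardsID l0 r; rewrite (c7 r rM) m1 ?(net_l0 HN) //; ssrlia.
have : 8 <= \sum_(c <- A 1) #|c :\: (l0 :|: R)|.
  have : \sum_(c <- A 1) 2 <= \sum_(c <- A 1) #|c :\: (l0 :|: R)|.
    by rewrite big_seq [X in _ <= X]big_seq; apply: leq_sum => c; exact: c2.
  by rewrite big_const_seq iter_addn_0 count_predT e1.
by move: (\sum_(c <- A 1) _) #|O| => x y; clear; ssrlia.
Qed.

(** The point common to [c] and [s] is on at most one line through [p 0], so concurrent triples can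
    be counted by their line through [p 1]. *)
Lemma weightE s : s \in A 2 ->
  weight cc A s = count (fun c => has (fun r => conc r c s) (A 0)) (A 1).
Proof.
move=> sA; rewrite /weight -sum1_count [RHS]big_mkcond /=.
under eq_bigr do rewrite -sum1_count big_mkcond.
rewrite exchange_big /= big_seq [RHS]big_seq; apply: eq_bigr => c cA.
rewrite -big_mkcond sum1_count count_has ?(net_uniq HN) //.
move=> r r' rA r'A /concP [z [h1 h2 h3]] /concP [y [h4 h5 h6]].
apply: (@net_conc 0 1 r r' c) => //; apply/concP; exists z; split=> //.
by rewrite (@meet_pt_eq 2 1 s c z) // -(@meet_pt_eq 2 1 s c y).
Qed.

(** The seven points of [s] are [p 2], four on the lines through [p 0], at most 4 minus the weight
    on the lines through [p 1] only, and those in [O]. *)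
Lemma weight_outside s : s \in A 2 -> weight cc A s <= #|s :&: O| + 2.
Proof.
move=> sA; have [sM sl ps] := net_mem HN (isT : 2 < 3) sA.
set F := [seq c <- A 1 | ~~ has (fun r => conc r c s) (A 0)].
have : #|s| <= size (enum (s :&: O) ++ p 2 :: map (meet_pt s) (A 0) ++ map (meet_pt s) F).
  rewrite cardE; apply: uniq_leq_size; first exact: enum_uniq.
  move=> z; rewrite mem_enum => zs; rewrite mem_cat mem_enum in_setI zs in_setC !in_setU memR memC.
  rewrite inE mem_cat; case: hasP => [[r rA zr]|nr] /=.
    by rewrite orbT /= (@meet_pt_eq 2 0 s r z) // map_f ?orbT.
  case zl : (z \in l0) => /=; first by rewrite (net_off (isT : 2 < 3) sA zs zl) eqxx.
  case: hasP => //= -[c cA zc]; rewrite (@meet_pt_eq 2 1 s c z) //.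
  apply/or3P; apply: Or33; apply: map_f; rewrite /F mem_filter cA andbT; apply/hasPn => r rA; apply/negP => /concP [y [yr yc ys]].
  apply: nr; exists r => //; by rewrite (@meet_pt_eq 2 1 s c z) // -(@meet_pt_eq 2 1 s c y).
have [-> // _] := HM; rewrite size_cat /= size_cat !size_map e0 -cardE size_filter.
rewrite weightE //; have := count_neg (fun c => has (fun r => conc r c s) (A 0)) (A 1).
by rewrite e1; move: (count _ _) (count _ _) #|_| => a b c; clear; ssrlia.
Qed.

(** The lines through [p 2] have no common point off [l0], so their traces on [O] are disjoint and
    have at most four points in all. *)
Lemma sum_weight : \sum_(s <- A 2) weight cc A s <= 4 + 2 * size (A 2).
Proof.
have h : \sum_(s <- A 2) weight cc A s <= \sum_(s <- A 2) (#|s :&: O| + 2).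
  by rewrite big_seq [X in _ <= X]big_seq; apply: leq_sum => c; exact: weight_outside.
apply: (leq_trans h); rewrite big_split /= big_const_seq iter_addn_0 count_predT leq_add2r.
apply: leq_trans card_outside.
rewrite -(big_map (fun s : line => s :&: O) predT (fun s : line => #|s|)).
apply: sum_card_leq; last by apply/allP => _ /mapP [s _ ->]; exact: subsetIr.
rewrite pairwise_map; have := net_uniq HN (isT : 2 < 3).
rewrite uniq_pairwise; apply: sub_in_pairwise (allss _).
move=> x y xA yA /= xy; apply/pred0P => z /=; apply/negP => /andP [].
rewrite !inE => /andP [zx /norP [/norP [zl _] _]] /andP [zy _].
have [xM _ px] := net_mem HN (isT : 2 < 3) xA; have [yM _ py] := net_mem HN (isT : 2 < 3) yA.
have e := meet_eq HM xM yM xy zx zy px py.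
by move: zl; rewrite e (net_pl HN).
Qed.

(** By [hits_bound] on [s], at most two of the four lines through [p 1] meet [s] away from the lines
    through [p 0]. *)
Lemma weight_ge2 s : s \in A 2 -> 2 <= weight cc A s.
Proof.
move=> sA; rewrite weightE //.
have := @hits_bound 2 0 1 s isT isT isT isT isT isT sA e0.
have := count_neg (fun c => has (fun r => conc r c s) (A 0)) (A 1); rewrite e1.
rewrite (@eq_count _ (fun c => ~~ has (fun r => conc r c s) (A 0)) (fun c => ~~ has (fun r => conc s r c) (A 0))).
  by move: (count _ _) (count _ _) => a b; clear; ssrlia.
by move=> c /=; congr negb; apply: eq_has => r; rewrite concA concC.
Qed.

Let nomiss g h k l : g < 3 -> h < 3 -> k < 3 -> g != h -> g != k -> h != k ->
  l \in A g -> size (A h) = 4 ->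
  size (A k) <= \sum_(s <- A k) count (fun x => conc l x s) (A h) + 2.
Proof.
move=> g3 h3 k3 gh gk hk lA s4.
rewrite -(count_neg (fun s => has (fun c => conc l c s) (A h))).
apply: leq_add; last exact: (@hits_bound g h k).
by rewrite -sum1_count big_mkcond; apply: leq_sum => s _; rewrite has_count; case: ifP.
Qed.

Lemma row_ge r : r \in A 0 ->
  size (A 2) <= \sum_(s <- A 2) count (fun c => conc r c s) (A 1) + 2.
Proof. by move=> rA; exact: (@nomiss 0 1 2). Qed.
Lemma col_ge c : c \in A 1 ->
  size (A 2) <= \sum_(s <- A 2) count (fun r => conc r c s) (A 0) + 2.
Proof.
move=> cA; apply: leq_trans (@nomiss 1 0 2 c isT isT isT isT isT isT cA e0) _.
rewrite leq_add2r; apply: leq_sum => s _.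
by rewrite (eq_count (fun r => concC c r s)).
Qed.
End Net.

(** [l0] and six more lines through [x] have 7 + 6 * 6 = 43 points, leaving no room for [z]. *)
Lemma pencil6_cover M l0 (x : pt) (S : seq line) z : is_ppl M -> l0 \in M -> x \in l0 -> uniq S ->
  (forall m, m \in S -> [/\ m \in M, m != l0 & x \in m]) -> size S = 6 -> z \notin l0 ->
  has (fun c : line => z \in c) S.
Proof.
move=> HM l0M x0 uS hS e6 zl; apply/negPn/negP => /hasPn zn.
have [c7 m1] := HM.
pose W := [:: l0; [set z]] ++ map (fun r : line => r :\: l0) S.
have : \sum_(a <- W) #|a| <= #|[set: pt]|.
  apply: sum_card_leq; last by apply/allP => a _; exact: subsetT.
  rewrite /W /= all_map; apply/and3P; split.
  - apply/andP; split; first by rewrite disjoint_sym disjoints1.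
    by apply/allP => c _ /=; rewrite -setI_eq0; apply/eqP/setP => y; rewrite !inE; case: (y \in l0).
  - apply/allP => _ /mapP [c cA ->]; rewrite disjoints1 !inE zl /=; exact: zn.
  rewrite pairwise_map; move: uS.
  rewrite uniq_pairwise; apply: sub_in_pairwise (allss _).
  move=> a b aS bS /= ab; apply/pred0P => v /=; apply/negP; rewrite !inE.
  case/andP => /andP [vl va] /andP [_ vb].
  have [aM _ xa] := hS _ aS; have [bM _ xb] := hS _ bS.
  have e := meet_eq HM aM bM ab va vb xa xb.
  by move: vl; rewrite e x0.
rewrite cardsT card_ord /W big_cat !big_cons big_nil !big_map cards1 /= (c7 _ l0M).
rewrite (eq_big_seq (fun=> 6)); first by rewrite big_const_seq iter_addn_0 count_predT e6.
move=> r rA; have [rM rl _] := hS _ rA.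
by have := cardsID l0 r; rewrite (c7 r rM) m1 // => /(@addnI 1 _ 6) ->.
Qed.

Lemma net_cover M l0 p A g z : net M l0 p A -> g < 3 -> size (A g) = 6 -> z \notin l0 ->
  has (fun c : line => z \in c) (A g).
Proof.
move=> HN g3; apply: (pencil6_cover (net_ppl HN) (net_l0 HN) (net_pl HN g3) (net_uniq HN g3)).
by move=> m; exact: net_mem.
Qed.

Lemma net_sub M l0 p A s : net M l0 p (add_third A s) -> net M l0 p A.
Proof.
case=> a b c d e f; split=> // g.
  by move=> g3; have := e g g3; case: g g3 => [|[|[|g]]] //= _; rewrite /add_third /= rcons_uniq => /andP [].
move=> x g3 h; apply: f => //; move: g3 h; case: g => [|[|[|g]]] //= _ h.
by rewrite mem_rcons inE h orbT.
Qed.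

Lemma net_perm M l0 p A A' (r : nat -> nat) : net M l0 p A ->
  (forall g, g < 3 -> r g < 3) ->
  (forall g h, g < 3 -> h < 3 -> r g = r h -> g = h) ->
  (forall g, g < 3 -> perm_eq (A' g) (A (r g))) -> net M l0 (p \o r) A'.
Proof.
case=> a b c d e f r3 rI pA; split=> //.
- by move=> g g3 /=; apply: c; apply: r3.
- by move=> g h g3 h3 /= /(d _ _ (r3 g g3) (r3 h h3)); apply: rI.
- by move=> g g3; rewrite (perm_uniq (pA g g3)); apply: e; apply: r3.
- by move=> g x g3; rewrite (perm_mem (pA g g3)); apply: f; apply: r3.
Qed.

Section NetExts.
Variables (M : {set line}) (l0 : line) (p : nat -> pt) (A : nat -> seq line) (s : line).
Hypothesis HN : net M l0 p (add_third A s).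
Let cc := @conc pt.
Let HA := net_sub HN.
Let s2 : s \in add_third A s 2. Proof. by rewrite /add_third /= mem_rcons mem_head. Qed.

Lemma net_exts n (full : bool) : (if full then n = 6 else n = 4) ->
  size (A 0) = n -> size (A 1) = n ->
  (~~ full -> forall s', s' \in A 2 -> weight cc A s' <= weight cc A s) ->
  array_of cc (add_third A s) \in extensions n full (array_of cc A).
Proof.
move=> nf e0 e1 ws.
have hcr r c c' : r \in A 0 -> c \in A 1 -> c' \in A 1 -> cc r c s -> cc r c' s -> c = c'.
  move=> rA cA c'A /concP [z [h1 h2 h3]] /concP [y [h4 h5 h6]].
  apply: (@net_conc _ _ _ _ HN 1 0 c c' r) => //; apply/concP; exists z; split=> //.
  by rewrite (@meet_pt_eq _ _ _ _ HN 0 2 r s z) // -(@meet_pt_eq _ _ _ _ HN 0 2 r s y).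
apply: extensions_array_of => //.
- exact: (net_uniq HA (isT : 0 < 3)).
- exact: (net_uniq HA (isT : 1 < 3)).
- move=> r r' c rA r'A cA /concP [z [h1 h2 h3]] /concP [y [h4 h5 h6]].
  apply: (@net_conc _ _ _ _ HN 0 1 r r' c) => //; apply/concP; exists z; split=> //.
  by rewrite (@meet_pt_eq _ _ _ _ HN 1 2 c s z) // -(@meet_pt_eq _ _ _ _ HN 1 2 c s y).
- move=> r c s' rA cA s'A /concP [z [h1 h2 h3]]; apply/negP => /concP [y [h4 h5 h6]].
  have s'2 : s' \in add_third A s 2 by rewrite /add_third /= mem_rcons inE s'A orbT.
  have es : s = s'.
    apply: (@net_conc _ _ _ _ HN 2 0 s s' r) => //; apply/concP; exists z; split=> //.
    by rewrite (@meet_pt_eq _ _ _ _ HN 0 1 r c z) // -(@meet_pt_eq _ _ _ _ HN 0 1 r c y).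
  have := net_uniq HN (isT : 2 < 3); rewrite /add_third /= rcons_uniq => /andP [/negP ns _].
  by apply: ns; rewrite es.
(* Here [p 1] has degree 7, so the common point of [r] and [s], which is off [l0], is on a line
   through [p 1]: every row of the layer has a true entry. *)
- case: full nf {ws} => // n6 _ r rA; rewrite n6 in e0 e1.
  have [rM rl pr] := net_mem HN (isT : 0 < 3) rA.
  have [sM sl ps] := net_mem HN (isT : 2 < 3) s2.
  have [z1 z2] := meet_ptP (net_ppl HN) rM sM.
  have zl : meet_pt r s \notin l0.
    apply/negP => zl; have e := net_off HN (isT : 0 < 3) rA z1 zl.
    have e' := net_off HN (isT : 2 < 3) s2 z2 zl.
    by have := net_inj HN (isT : 0 < 3) (isT : 2 < 3) (etrans (esym e) e').
  have /hasP [c cA zc] := net_cover HN (isT : 1 < 3) e1 zl.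
  by apply/hasP; exists c => //; apply/concP; exists (meet_pt r s).
case: full nf ws => //= n4 /(_ isT) ws _; rewrite n4 in e0 e1.
have wA s' : weight cc (add_third A s) s' = weight cc A s' by [].
apply: (@admissibleE _ _ _ _ (size (A 2))) => //.
- by rewrite -wA; apply: (weight_ge2 HN).
- by have := sum_weight HN e0 e1; rewrite /add_third /= size_rcons.
- by move=> r rA; have := row_ge HN e1 rA; rewrite /add_third /= size_rcons.
- by move=> c cA; have := col_ge HN e0 cA; rewrite /add_third /= size_rcons.
Qed.
End NetExts.

(** * Induction on the lines through the third point *)

Section Reach.
Variables (n : nat) (full : bool).
Hypothesis nf : if full then n = 6 else n = 4.
Let cc := @conc pt.
(** The invariant of the enumeration. As long as [K < n], lines will still be added through the
    third point, so it must remain the third. Sorting by weight is demanded of the given net only: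
    the relabelled one may list the same lines in any order. *)
Definition reaches (K : nat) (reps : seq triple_array) : Prop :=
  forall M l0 p A, net M l0 p A -> size (A 0) = n -> size (A 1) = n -> size (A 2) = K ->
  (~~ full -> sorted (fun s s' => weight cc A s <= weight cc A s') (A 2)) ->
  exists r A', [/\ forall g, g < 3 -> r g < 3,
    forall g h, g < 3 -> h < 3 -> r g = r h -> g = h, K < n -> r 2 = 2,
    forall g, g < 3 -> perm_eq (A' g) (A (r g)) & array_of cc A' \in reps].

Lemma reaches0 : reaches 0 [:: [::]].
Proof.
move=> M l0 p A _ _ _ e2 _; exists id, A; split=> //.
by rewrite /array_of; move/size0nil: e2 => ->.
Qed.

Lemma reaches_next K reps reps' : K < n -> reaches K reps ->
  (forall T e, T \in reps -> e \in extensions n full T ->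
     exists2 h, e = h \/ (exists x, h = normalise n x e) & h \in reps') ->
  reaches K.+1 reps'.
Proof.
move=> Kn rK hreps M l0 p A HN e0 e1; move eA: (A 2) => S2; case: (lastP S2) eA => // S s eA.
rewrite size_rcons => -[eS] srt.
pose B g := sel (A 0) (A 1) S g.
have BA g : g < 3 -> add_third B s g = A g by case: g => [|[|[|]]] //= _; rewrite eA.
have HB : net M l0 p (add_third B s).
  case: HN => a b c d e f; split=> // g g3; first by rewrite BA ?e.
  by move=> g3'; rewrite BA //; apply: f.
have wB x : weight cc B x = weight cc A x by [].
have tr : transitive (fun s s' => weight cc A s <= weight cc A s') by move=> x y z; apply: leq_trans.
have srtB : ~~ full -> sorted (fun s s' => weight cc B s <= weight cc B s') (B 2).
  by move=> nf'; have := srt nf'; rewrite /B /= -cats1 => /cat_sorted2 [].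
have [r [A' [r3 rI rK2 pA' hA']]] := rK _ _ _ _ (net_sub HB) e0 e1 eS srtB.
have r2 := rK2 Kn.
have r01 : (r 0 = 0 /\ r 1 = 1) \/ (r 0 = 1 /\ r 1 = 0).
  have := r3 0 isT; have := r3 1 isT; have := rI 0 1 isT isT.
  have := rI 0 2 isT isT; have := rI 1 2 isT isT; rewrite r2.
  case: (r 0) => [|[|[|a]]]; case: (r 1) => [|[|[|b]]] // h1 h2 h3 _ _;
  first [by left | by right | by have := h1 erefl | by have := h2 erefl | by have := h3 erefl].
have HA' : net M l0 (p \o r) (add_third A' s).
  apply: (net_perm HB) => // g g3; case: g g3 => [|[|[|g]]] // _.
  - by apply: perm_trans (pA' 0 isT) _; case: r01 => -[-> _].
  - by apply: perm_trans (pA' 1 isT) _; case: r01 => -[_ ->].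
  - have := pA' 2 isT; rewrite r2 /add_third /= => h.
    by rewrite -!cats1 perm_cat2r.
have wA' x : weight cc A' x = weight cc A x.
  have := pA' 0 isT; have := pA' 1 isT; case: r01 => -[-> ->] p1 p0; first exact: weight_perm.
  by apply: weight_swap => //; move=> a b; exact: concC.
have e0' : size (A' 0) = n.
  by rewrite (perm_size (pA' 0 isT)); case: r01 => -[-> _].
have e1' : size (A' 1) = n.
  by rewrite (perm_size (pA' 1 isT)); case: r01 => -[_ ->].
(* [s] comes last in the sorted list, so it is at least as heavy as each earlier line, in whatever
   order these are now listed. *)
have ex : array_of cc (add_third A' s) \in extensions n full (array_of cc A').
  apply: (net_exts HA') => // nf' s'; rewrite (perm_mem (pA' 2 isT)) r2 /= => s'S.
  rewrite !wA'; have := srt nf'; rewrite sorted_pairwise // pairwise_rcons.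
  by case/andP => /allP h _; exact: h.
have [h hh hin] := hreps _ _ hA' ex.
have [t [A'' [hA'' pA'' tK]]] : exists t A'', [/\ h = array_of cc A'',
   forall g, g < 3 -> perm_eq (A'' g) (add_third A' s (slot t g)) & (t < 2) || (size (add_third A' s 2) == n) && (t < 6)].
  case: hh => [<-|[x ->]].
    by exists 0, (add_third A' s); split=> // -[|[|[|]]].
  exact: (@normaliseP _ cc (@concC pt) (@concA pt) l0 n (add_third A' s) x e0' e1').
have szA'2 : size (add_third A' s 2) = K.+1.
  by rewrite /add_third /= size_rcons (perm_size (pA' 2 isT)) r2 /= eS.
rewrite szA'2 in tK.
have t6 : t < 6 by case/orP: tK => [h'|/andP [_ h']] //; exact: leq_trans h' _.
have [t3 tI] : (forall g, g < 3 -> slot t g < 3) /\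
    (forall g h, g < 3 -> h < 3 -> slot t g = slot t h -> g = h).
  by move: (t) t6 => [|[|[|[|[|[|]]]]]] // _; split; move=> [|[|[|g]]] // [|[|[|g']]].
exists (r \o slot t), A''; split.
- by move=> g g3 /=; apply: r3; apply: t3.
- by move=> g g' g3 g3' /= /(rI _ _ (t3 g g3) (t3 g' g3')); apply: tI.
(* While the third pencil is incomplete, a hint can only fix or exchange the first two points. *)
- move=> Kn'; have t2 : t < 2 by move: tK; case/orP => // /andP [/eqP e _]; rewrite e ltnn in Kn'.
  by move: (t) t2 => [|[|]] //= _; rewrite /slot /= r2.
- move=> g g3; apply: perm_trans (pA'' g g3) _ => /=.
  have := t3 g g3; case: (slot t g) => [|[|[|]]] // _.
  + by apply: perm_trans (pA' 0 isT) _; case: r01 => -[-> _].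
  + by apply: perm_trans (pA' 1 isT) _; case: r01 => -[_ ->].
  + have := pA' 2 isT; rewrite r2 /add_third /= eA => h'.
    by rewrite -!cats1 perm_cat2r.
- by rewrite -hA''.
Qed.
End Reach.

(** * Realisation of a seed by its model *)

Lemma all_pointsE : all_points = mask_of setT.
Proof.
apply: mask_inj => i; case: (ltnP i 43) => hi.
  by rewrite (bit_mask_of _ (Ordinal hi)) inE; move: i hi; do 43 (case=> //).
rewrite bit_mask_of_ge //; apply/negbTE/negP; rewrite -mem_positions => h.
have : all (gtn 43) (positions all_points) by vm_compute.
by move/allP/(_ _ h) => /=; rewrite ltnNge hi.
Qed.
Lemma bounded m : null (N.ldiff m all_points) -> forall i, bit m i -> i < 43.
Proof.
move/nullP => h i ti; have := h i; rewrite bit_ldiff ti all_pointsE ltnNge.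
by case: leqP => // hi; rewrite bit_mask_of_ge.
Qed.
Lemma card7_set m : null (N.ldiff m all_points) -> card7 m -> #|set_of_mask m| = 7.
Proof.
move=> /bounded b; rewrite /card7 !mask_geE => /andP [h1 h2].
by rewrite (card_set_of_mask b); apply/eqP; rewrite eqn_leq h1 leqNgt h2.
Qed.
Lemma single_card m : single m -> (forall i, bit m i -> i < 43) -> #|set_of_mask m| = 1.
Proof. by move=> h b; rewrite (card_set_of_mask b); apply/eqP; rewrite -singleE. Qed.
Lemma null_set m : (forall i, bit m i -> i < 43) -> null m = (set_of_mask m == set0).
Proof. by move=> b; rewrite -null_mask_of set_of_maskK. Qed.

Lemma group_of_mono n a b : a <= b -> group_of n a <= group_of n b.
Proof. by rewrite /group_of; repeat case: ifP; ssrlia. Qed.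
Lemma three_groups a b c : a <= b -> b <= c -> c < 3 -> a != b -> b != c -> [&& a == 0, b == 1 & c == 2].
Proof. ssrlia. Qed.

Section Lines.
Variables (M : {set line}) (l0 : line) (p : nat -> pt) (A : nat -> seq line) (n : nat).
Hypotheses (HN : net M l0 p A) (e0 : size (A 0) = n) (e1 : size (A 1) = n).
Definition seed_seq := l0 :: A 0 ++ A 1 ++ A 2.
Let HM := net_ppl HN.

Lemma uniq_seed_seq : uniq seed_seq.
Proof.
rewrite /seed_seq /= !mem_cat !cat_uniq !(net_uniq HN) // !andbT.
have nl g : g < 3 -> l0 \notin A g.
  by move=> g3; apply/negP => /(net_mem HN g3) [_ /eqP].
have nh g h : g < 3 -> h < 3 -> g != h -> ~~ has (mem (A g)) (A h).
  move=> g3 h3 gh; apply/hasPn => x xh; apply/negP => /= xg.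
  by have := net_neq HN g3 h3 gh xg xh; rewrite eqxx.
by rewrite !negb_or !nl //= has_cat negb_or !nh.
Qed.
Lemma seed_seq_sub x : x \in seed_seq -> x \in M.
Proof.
rewrite /seed_seq inE !mem_cat => /or4P [/eqP ->|xA|xA|xA]; first exact: (net_l0 HN).
- by have [] := net_mem HN (isT : 0 < 3) xA.
- by have [] := net_mem HN (isT : 1 < 3) xA.
- by have [] := net_mem HN (isT : 2 < 3) xA.
Qed.

Let nthL := nth l0 seed_seq.
Lemma group_ofP i : 0 < i < size seed_seq -> [/\ group_of n i < 3, nthL i \in A (group_of n i) &
   nthL i = nth l0 (A (group_of n i)) (i - n * group_of n i).-1 /\ (i - n * group_of n i).-1 < size (A (group_of n i)) ].
Proof.
case: i => // i /andP [_]; rewrite /seed_seq /= ltnS !size_cat e0 e1 /nthL /= /group_of.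
rewrite nth_cat e0; case: (ltnP i n) => [hi _|ni].
  by split=> //; rewrite ?mem_nth ?muln0 ?subn0 ?e0.
rewrite nth_cat e1 => hi; case: (leqP i.+1 (n + n)) => h2.
  have h : i - n < n by ssrlia.
  rewrite h muln1 subSn //; split=> //; first by rewrite mem_nth ?e1.
  by rewrite e1.
have h : (i - n < n) = false by ssrlia.
rewrite h (_ : (i.+1 - n * 2).-1 = i - n - n); last by ssrlia.
have h' : i - n - n < size (A 2) by ssrlia.
by split=> //; rewrite mem_nth.
Qed.

Lemma seed_seq_conc x y z : x < y -> y < z -> z < size seed_seq ->
  conc (nthL x) (nthL y) (nthL z) = conc_array n (array_of (@conc pt) A) x y z.
Proof.
move=> xy yz zs.
have [gy3 yA [ey ly]] : [/\ group_of n y < 3, nthL y \in A (group_of n y) &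
   nthL y = nth l0 (A (group_of n y)) (y - n * group_of n y).-1 /\ (y - n * group_of n y).-1 < size (A (group_of n y))].
  by apply: group_ofP; rewrite (leq_ltn_trans _ xy) //= (ltn_trans yz zs).
have [gz3 zA [ez lz]] : [/\ group_of n z < 3, nthL z \in A (group_of n z) &
   nthL z = nth l0 (A (group_of n z)) (z - n * group_of n z).-1 /\ (z - n * group_of n z).-1 < size (A (group_of n z))].
  by apply: group_ofP; rewrite (leq_ltn_trans _ yz).
have [yM yl py] := net_mem HN gy3 yA; have [zM zl pz] := net_mem HN gz3 zA.
case: x xy => [|x] xy.
  rewrite /conc_array; case: eqP => [e|/eqP ne].
    apply/concP; exists (p (group_of n y)); split=> //; first exact: (net_pl HN).
    by rewrite e.
  apply/negbTE/negP => /concP [v [v0 vy vz]].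
  have v1 := net_off HN gy3 yA vy v0; have v2 := net_off HN gz3 zA vz v0.
  by case/eqP: ne; apply: (net_inj HN) => //; rewrite -v1.
have [gx3 xA [ex lx]] : [/\ group_of n x.+1 < 3, nthL x.+1 \in A (group_of n x.+1) &
   nthL x.+1 = nth l0 (A (group_of n x.+1)) (x.+1 - n * group_of n x.+1).-1
     /\ (x.+1 - n * group_of n x.+1).-1 < size (A (group_of n x.+1))].
  by apply: group_ofP; rewrite /= (ltn_trans xy) // (ltn_trans yz zs).
have [xM xl px] := net_mem HN gx3 xA.
have gxy := group_of_mono n (ltnW xy); have gyz := group_of_mono n (ltnW yz).
have neq a b : a < b -> b < size seed_seq -> nthL a <> nthL b.
  by move=> ab bs /eqP; rewrite /nthL nth_uniq ?uniq_seed_seq ?(ltn_trans ab) // ltn_eqF.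
rewrite /conc_array; case: eqP => [e|/eqP ne].
  have e' : group_of n y = group_of n x.+1 by apply/eqP; rewrite eqn_leq gxy e gyz.
  by apply/concP; exists (p (group_of n x.+1)); split=> //; [rewrite -e'|rewrite e].
case: (boolP [&& group_of n x.+1 == 0, group_of n y == 1 & group_of n z == 2]) => [/and3P [gx gy gz]|ng].
  rewrite gx gy gz /=; move: lx ly lz; rewrite ex ey ez (eqP gx) (eqP gy) (eqP gz) => lx ly lz.
  by rewrite -cell_array_of // muln0 subn0 muln1 muln2 -addnn subnDA.
have -> : [&& group_of n x.+1 == 0, group_of n y == 1, group_of n z == 2
   & cell (array_of (@conc pt) A) x.+1.-1 (y - n).-1 (z - n - n).-1] = false.
  by apply/negP => /and4P [a b c _]; move: ng; rewrite a b c.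
apply/negbTE/negP => hc.
have [exy|nxy] := eqVneq (group_of n x.+1) (group_of n y).
  apply: (neq x.+1 y xy); first exact: ltn_trans yz zs.
  apply: (net_conc HN gx3 gz3) hc => //; by rewrite exy.
have [eyz|nyz] := eqVneq (group_of n y) (group_of n z).
  apply: (neq y z yz) => //; apply: (@net_conc _ _ _ _ HN (group_of n y) (group_of n x.+1) _ _ (nthL x.+1)) => //.
  - by rewrite eq_sym.
  - by rewrite eyz.
  - by move: hc; rewrite concC concA.
by case/negP: ng; apply: three_groups.
Qed.
End Lines.

Lemma disj_set_of_mask a b : (forall i, bit a i -> i < 43) -> ~~ disj a b = (set_of_mask a :&: set_of_mask b != set0).
Proof.
move=> ha; rewrite disjE null_set ?set_of_mask_land // => i; rewrite bit_land => /andP [/ha //].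
Qed.

(** A model is tested on increasing triples of lines only; symmetry extends the agreement to all
    triples of distinct lines. *)
Lemma sym_ternary k (c d : 'I_k -> 'I_k -> 'I_k -> bool) :
  (forall i j l, c i j l = c j i l) -> (forall i j l, c i j l = c i l j) ->
  (forall i j l, d i j l = d j i l) -> (forall i j l, d i j l = d i l j) ->
  (forall x y z : 'I_k, x < y -> y < z -> c x y z = d x y z) ->
  forall i j l : 'I_k, i != j -> l != i -> l != j -> c i j l = d i j l.
Proof.
move=> cC cA dC dA cd i j l; rewrite -!val_eqE /=.
case: (ltngtP i j) => // h1 _; case: (ltngtP l i) => // h2 _; case: (ltngtP l j) => // h3 _.
- by rewrite (cA i) (cC i) (dA i) (dC i) cd.
- by have := ltn_trans h2 h1; rewrite ltnNge (ltnW h3).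
- by rewrite (cA i) (dA i) cd.
- exact: cd.
- by rewrite (cC i) (cA j) (cC j) (dC i) (dA j) (dC j) cd.
- by rewrite (cC i) (cA j) (dC i) (dA j) cd.
- by have := ltn_trans h2 h3; rewrite ltnNge (ltnW h1).
- by rewrite (cC i) (dC i) cd.
Qed.

(** [conc_perm] applied to the actual seed and to its model, both having the concurrent triples
    prescribed by [T]. *)
Lemma valid_seed_perm n T B M l0 p A : valid_seed n T B -> net M l0 p A ->
  size (A 0) = n -> size (A 1) = n -> T = array_of (@conc pt) A ->
  exists g : {perm pt}, B = [seq mask_of (g @: l) | l : line <- seed_seq l0 A].
Proof.
move=> /and4P [/allP c7 /allP bd /eqP sB ok] HN e0 e1 eT.
have HM := net_ppl HN; have [M7 M1] := HM.
have sL : size B = size (seed_seq l0 A).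
  by rewrite sB eT size_map /= !size_cat e0 e1 addnA.
set k := size B in sL; pose F (i : 'I_k) := nth l0 (seed_seq l0 A) i.
pose G (i : 'I_k) := set_of_mask (nthN B i).
have bB (i : 'I_k) j : bit (nthN B i) j -> j < 43 by apply: bounded; apply: bd; apply: mem_nth.
have FM (i : 'I_k) : F i \in M by apply: (seed_seq_sub HN); apply: mem_nth; rewrite -sL.
have hx (x : 'I_k) : (x : nat) \in iota 0 k by rewrite mem_iota /=.
have hy (x y : 'I_k) : x < y -> (y : nat) \in iota x.+1 (k - x.+1).
  by move=> xy; rewrite mem_iota xy subnKC //=; exact: leq_trans xy (ltnW (ltn_ord y)).
have ok2 (x y : 'I_k) : x < y -> single (N.land (nthN B x) (nthN B y)).
  by move=> xy; have /andP [] := allP (allP ok _ (hx x)) _ (hy x y xy).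
have ok3 (x y z : 'I_k) : x < y -> y < z -> conc (G x) (G y) (G z) = conc (F x) (F y) (F z).
  move=> xy yz; rewrite (seed_seq_conc HN e0 e1) -?sL // -eT.
  have /andP [_ h] := allP (allP ok _ (hx x)) _ (hy x y xy).
  have /eqP <- := allP h _ (hy y z yz).
  by rewrite disj_set_of_mask ?set_of_mask_land //; move=> j; rewrite bit_land => /andP [/bB].
have G1 (i j : 'I_k) : i != j -> #|G i :&: G j| = 1.
  move=> ij; wlog lij : i j ij / i < j.
    move=> h; case: (ltngtP i j) => [||/val_inj e]; [exact: h|by move=> ji; rewrite setIC h // eq_sym|by rewrite e eqxx in ij].
  rewrite -set_of_mask_land; apply: single_card; first exact: ok2.
  by move=> x; rewrite bit_land => /andP [/bB].
have F1 (i j : 'I_k) : i != j -> #|F i :&: F j| = 1.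
  move=> ij; apply: M1 => //; by rewrite /F nth_uniq -?sL // (uniq_seed_seq HN).
have Gc (i j l : 'I_k) : i != j -> conc (F i) (F j) (F l) = conc (G i) (G j) (G l).
  (* A triple with a repeated line is concurrent, since two distinct lines always meet. *)
  have t2 (H : 'I_k -> line) (a b : 'I_k) : (forall i j : 'I_k, i != j -> #|H i :&: H j| = 1) ->
      a != b -> conc (H a) (H b) (H a) = true.
    by move=> H1 ab; rewrite /conc -setIA [H b :&: _]setIC setIA setIid -cards_eq0 H1.
  move=> ij; case: (eqVneq l i) => [->|li]; first by rewrite !t2.
  case: (eqVneq l j) => [->|lj]; first by rewrite concC [RHS]concC !t2 // eq_sym.
  by apply: (@sym_ternary k (fun i j l => conc (F i) (F j) (F l)) (fun i j l => conc (G i) (G j) (G l))) => //;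
    try (by move=> *; exact: concC); try (by move=> *; exact: concA); move=> x y z xy yz; rewrite ok3.
have F7 (i : 'I_k) : #|F i| = #|G i|.
  by rewrite M7 // card7_set //; [apply: bd|apply: c7]; apply: mem_nth.
have [g hg] := conc_perm F1 G1 F7 Gc.
exists g; apply: (@eq_from_nth _ N0) => [|i hi]; first by rewrite size_map -sL.
rewrite (nth_map l0) -?sL // -[nth _ B i]/(nthN B (Ordinal hi)) -(set_of_maskK (@bB (Ordinal hi))).
by congr mask_of; rewrite -[LHS](hg (Ordinal hi)).
Qed.

Lemma is_ppl_imset (M : {set line}) (g : {perm pt}) : is_ppl M -> is_ppl [set g @: l | l : line in M].
Proof.
case=> c7 m1; split.
  by move=> _ /imsetP [l lM ->]; rewrite card_imset ?c7 //; exact: perm_inj.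
move=> _ _ /imsetP [l lM ->] /imsetP [m mM ->] ne.
rewrite -imsetI; last by move=> x y _ _; exact: perm_inj.
rewrite card_imset; last exact: perm_inj.
by apply: m1 => //; apply: contra ne => /eqP ->.
Qed.
Lemma net_imset (M : {set line}) l0 p A (g : {perm pt}) : net M l0 p A ->
  net [set g @: l | l : line in M] (g @: l0) (g \o p) (fun i => [seq g @: l | l : line <- A i]).
Proof.
case=> a b c d e f; split.
- exact: is_ppl_imset.
- exact: imset_f.
- by move=> i i3 /=; rewrite mem_imset ?c //; exact: perm_inj.
- by move=> i j i3 j3 /perm_inj; exact: d.
- move=> i i3; rewrite map_inj_uniq ?e //; exact: imset_inj (@perm_inj _ g).
- move=> i _ i3 /mapP [x xA ->]; have [xM xl px] := f i x i3 xA; split.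
  + exact: imset_f.
  + by apply: contra xl => /eqP /(imset_inj (@perm_inj _ g)) ->.
  + by rewrite /= mem_imset //; exact: perm_inj.
Qed.
(** Containment rather than equality: the search stops at 25 lines, whatever the size of [M]. *)
Definition found (M : {set line}) : Prop :=
  exists (f : {perm pt}) (P : {set line}), P \in [:: P1; P2; P3; P4] /\
    forall l : line, l \in P -> f @: l \in M.
Lemma imset_permM (f g : {perm pt}) (l : line) : f @: (g @: l) = (g * f)%g @: l.
Proof. by rewrite -imset_comp; apply: eq_imset => x /=; rewrite permM. Qed.
Lemma found_imset (M : {set line}) (g : {perm pt}) : found [set g @: l | l : line in M] -> found M.
Proof.
case=> f [P [hP h]]; exists (f * g^-1)%g, P; split=> // l /h /imsetP [m mM e].
rewrite -imset_permM e imset_permM mulgV (_ : _ @: m = m) //.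
by rewrite -[RHS]imset_id; apply: eq_imset => x; rewrite perm1.
Qed.

(** * Recognising the four planes *)

Section PartConc.
Variables (k : nat) (T : finType).
Implicit Type F : 'I_k.+1 -> {set T}.
Definition meets1 F := forall i j, i != j -> #|F i :&: F j| = 1.
Definition part F i := F i :\: F ord0.

Lemma meet_unique F i j x y : meets1 F -> i != j -> x \in F i -> x \in F j ->
  y \in F i -> y \in F j -> x = y.
Proof.
move=> F1 ij xi xj yi yj; have /eqP/cards1P [z ez] := F1 _ _ ij.
have := in_set1 x z; have := in_set1 y z; rewrite -!ez !inE xi xj yi yj.
by move=> /esym/eqP -> /esym/eqP ->.
Qed.

Lemma conc0 F i j : meets1 F -> i != j -> i != ord0 -> j != ord0 ->
  conc (F ord0) (F i) (F j) = (part F i :&: part F j == set0).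
Proof.
move=> F1 ij i0 j0; have /eqP/cards1P [z ez] := F1 _ _ ij.
have [zi zj] : z \in F i /\ z \in F j by apply/andP; rewrite -in_setI ez set11.
apply/concP/eqP => [[x [x0 xi xj]]|e].
  apply/setP => y; rewrite !inE; apply/negP => /andP [/andP [y0 yi] /andP [_ yj]].
  by rewrite (meet_unique F1 ij yi yj xi xj) x0 in y0.
exists z; split=> //; apply/negPn/negP => z0; have := in_set0 z.
by rewrite -e !inE z0 zi zj.
Qed.

Lemma conc_parts F i j l : meets1 F -> i != j -> i != l -> i != ord0 -> j != ord0 -> l != ord0 ->
  conc (F i) (F j) (F l) = conc (part F i) (part F j) (part F l)
     || conc (F ord0) (F i) (F j) && conc (F ord0) (F i) (F l).
Proof.
move=> F1 ij il i0 j0 l0; apply/idP/idP => [/concP [x [xi xj xl]]|].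
  case x0 : (x \in F ord0); last first.
    by apply/orP; left; apply/concP; exists x; rewrite /part !inE x0 xi xj xl.
  by apply/orP; right; apply/andP; split; apply/concP; exists x.
case/orP => [/concP [x []]|/andP [/concP [x [x0 xi xj]] /concP [y [y0 yi yl]]]].
  by rewrite !inE => /andP [_ xi] /andP [_ xj] /andP [_ xl]; apply/concP; exists x.
apply/concP; exists x; split=> //.
by rewrite (meet_unique F1 i0 xi x0 yi y0).
Qed.

Lemma conc_ii F i j : meets1 F -> i != j -> conc (F i) (F j) (F i) = true.
Proof. by move=> F1 ij; rewrite /conc -setIA [F j :&: _]setIC setIA setIid -cards_eq0 F1. Qed.

Lemma parts_conc F G : meets1 F -> meets1 G -> (forall i, part F i = part G i) ->
  forall i j l, i != j -> conc (F i) (F j) (F l) = conc (G i) (G j) (G l).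
Proof.
move=> F1 G1 FG i j l ij.
have c0 a b : a != b -> a != ord0 -> b != ord0 ->
    conc (F ord0) (F a) (F b) = conc (G ord0) (G a) (G b).
  by move=> *; rewrite !conc0 // !FG.
case: (eqVneq l i) => [->|li]; first by rewrite !conc_ii.
case: (eqVneq l j) => [->|lj]; first by rewrite concC [RHS]concC !conc_ii // eq_sym.
case: (eqVneq i ord0) => [i0|i0]; first by rewrite i0 c0 // -?i0 // eq_sym.
case: (eqVneq j ord0) => [j0|j0].
  by rewrite j0 concC [RHS]concC c0 // -?j0 // eq_sym.
case: (eqVneq l ord0) => [l0|l0].
  by rewrite l0 concA concC [RHS]concA [RHS]concC c0.
have il : i != l by rewrite eq_sym.
by rewrite (conc_parts F1 ij il) // (conc_parts G1 ij il) // !FG (c0 i j) // (c0 i l).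
Qed.
End PartConc.

Definition planeok (P : seq N) : bool :=
  [&& size P == 25, all card7 P, all (fun m => null (N.ldiff m all_points)) P
    & pairwise (fun a b => single (N.land a b)) P].
Lemma planes_ok : all planeok planes.
Proof. by vm_compute. Qed.

Lemma lines_ofE s : lines_of s = [set:: [seq set_of_mask m | m <- plane_masks s]].
Proof.
rewrite /lines_of /plane_masks -map_comp.
suff e : (fun l : seq nat => [set i : 'I_43 | val i \in l]) =1
    set_of_mask \o (fun l : seq nat => ofbits [seq q \in l | q <- iota 0 43]) by rewrite (eq_map e).
move=> l; rewrite /comp /set_of_mask; apply/setP => i.
by rewrite !in_set bit_ofbits (nth_map 0) ?size_iota ?ltn_ord // nth_iota ?ltn_ord.
Qed.
Lemma plane_set P : P \in planes -> [set:: [seq set_of_mask m | m <- P]] \in [:: P1; P2; P3; P4].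
Proof.
have -> : [:: P1; P2; P3; P4] = [seq lines_of l | l <- [:: P1_lines; P2_lines; P3_lines; P4_lines]] by [].
by case/mapP => l hl ->; rewrite -lines_ofE; exact: map_f.
Qed.
Lemma planeokP P : planeok P -> [/\ uniq P, size P = 25, 
   forall m, m \in P -> #|set_of_mask m| = 7 /\ forall i, bit m i -> i < 43 &
   forall a b, a \in P -> b \in P -> a != b -> #|set_of_mask a :&: set_of_mask b| = 1].
Proof.
case/and4P => /eqP sP /allP c7 /allP bd pw.
have h m : m \in P -> #|set_of_mask m| = 7 /\ forall i, bit m i -> i < 43.
  by move=> mP; split; [apply: card7_set; [apply: bd|apply: c7]|apply: bounded; apply: bd].
have pw' (x0 : N) i j : i < j < size P -> #|set_of_mask (nth x0 P i) :&: set_of_mask (nth x0 P j)| = 1.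
  move=> /andP [ij jP]; rewrite -set_of_mask_land; apply: single_card.
    by apply: (pairwiseP x0 pw) => //; rewrite inE //; exact: ltn_trans ij jP.
  by move=> k; rewrite bit_land => /andP [/(proj2 (h _ (mem_nth x0 (ltn_trans ij jP))))].
split=> //.
- rewrite (@uniq_pairwise _); apply: (sub_in_pairwise _ (allss _) pw).
  move=> a b aP bP /= s1; apply/eqP => e; move: s1; rewrite e singleE.
  have [c b43] := h b bP; have -> : N.land b b = b by apply: mask_inj => i; rewrite bit_land andbb.
  by rewrite -(card_set_of_mask b43) c.
move=> a b /(nthP N0) [i iP <-] /(nthP N0) [j jP <-] ne.
case: (ltngtP i j) => [h'|h'|e]; last by rewrite e eqxx in ne.
  by rewrite pw' // h' jP.
by rewrite setIC pw' // h' iP.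
Qed.

Lemma lazy_hasP (A : Type) (p : A -> bool) s : lazy_has p s -> exists2 x, List.In x s & p x.
Proof. by elim: s => //= x s IH; case: ifP => [px _|_ /IH [y ys py]]; [exists x; auto|exists y; auto]. Qed.
Lemma mem_masksP x s : mem_masks x s = (x \in s).
Proof.
elim: s => //= y s IH; rewrite /mem_masks /= -/(mem_masks x s) IH inE.
by case: N.eqb_spec => [->|/eqP/negPf ->]; rewrite ?eqxx.
Qed.
Lemma lazy_allE (A : Type) (p : A -> bool) s : lazy_all p s = all p s.
Proof. by elim: s => //= x s ->; case: (p x). Qed.

Lemma preim_maskE r (X : {set pt}) (rho : {perm pt}) : size r = 43 ->
  (forall q : pt, rho q = nth 0 r q :> nat) -> preim_mask r (mask_of X) = mask_of (rho @^-1: X).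
Proof.
move=> sr rE; apply: mask_inj => i; rewrite /preim_mask bit_ofbits; case: (ltnP i 43) => hi; last first.
  by rewrite nth_default ?size_map ?sr // bit_mask_of_ge.
by rewrite (nth_map 0) ?sr // (bit_mask_of _ (Ordinal hi)) inE -bit_mask_of rE.
Qed.
Lemma perm_of_seq r : perm_seq 43 r -> exists rho : {perm pt}, forall q : pt, rho q = nth 0 r q :> nat.
Proof.
case/and3P => /eqP sr /allP lr ur.
have lt (q : pt) : nth 0 r q < 43 by apply: lr; apply: mem_nth; rewrite sr.
have inj : injective (fun q : pt => Ordinal (lt q)).
  move=> q q' /(congr1 val) /= /eqP; rewrite nth_uniq ?sr ?ltn_ord // => /eqP; exact: val_inj.
by exists (perm inj) => q; rewrite permE.
Qed.

Lemma leaf_found (M : {set line}) l0 Ks B hs acc : is_ppl M -> uniq (l0 :: Ks) ->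
  {subset l0 :: Ks <= M} -> size Ks = 24 -> head N0 B = mask_of l0 ->
  (forall m : line, m \in Ks -> mask_of (m :\: l0) \in acc ++ parts_off B) ->
  leaf_ok B hs acc -> found M.
Proof.
move=> HM uK KM sK hB hK /lazy_hasP [[j r] _]; cbv zeta.
case: ifP => // /[!lazy_allE] /allP hall.
set P := nth [::] planes j in hall *; rewrite hB mem_masksP in hall *; case: ifP => // hl0 okr.
have [sr _ _] := and3P okr; have [rho rE] := perm_of_seq okr.
rewrite (preim_maskE l0 (eqP sr) rE) in hall hl0.
set l0' := mask_of _ in hall hl0.
(* An index beyond the list of planes would yield the empty list, which has no member matching
   [l0]. *)
have hP : P \in planes.
  rewrite /P; case: (ltnP j (size planes)) => h; first exact: mem_nth.
  by move: hl0; rewrite /P nth_default.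
have [uP sP P7 P1'] := planeokP (allP planes_ok _ hP).
pose lift a := nth N0 P (find (fun l => N.ldiff l l0' == a) P).
have liftP m : m \in Ks -> lift (mask_of (rho @^-1: (m :\: l0))) \in P
     /\ N.ldiff (lift (mask_of (rho @^-1: (m :\: l0)))) l0' = mask_of (rho @^-1: (m :\: l0)).
  move=> /hK /hall; rewrite (preim_maskE _ (eqP sr) rE) mem_masksP => /mapP [l lP e].
  have hh : has (fun l => N.ldiff l l0' == mask_of (rho @^-1: (m :\: l0))) P.
    by apply/hasP; exists l => //; rewrite e.
  split; first by apply: mem_nth; rewrite -has_find.
  by apply/eqP; exact: (nth_find N0 hh).
pose F (i : 'I_25) := rho @^-1: nth l0 (l0 :: Ks) i.
pose Gs := l0' :: [seq lift (mask_of (rho @^-1: (m :\: l0))) | m : line <- Ks].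
pose G (i : 'I_25) := set_of_mask (nth N0 Gs i).
have sGs : size Gs = 25 by rewrite /= size_map sK.
have KsM (i : 'I_25) : nth l0 (l0 :: Ks) i \in M by apply: KM; apply: mem_nth; rewrite /= sK.
have F1 : meets1 F.
  move=> a b ab; rewrite -preimsetI card_preimset; last exact: perm_inj.
  by apply: (proj2 HM) => //; rewrite nth_uniq //= sK.
have GsP (i : 'I_25) : nth N0 Gs i \in P.
  have : nth N0 Gs i \in Gs by apply: mem_nth; rewrite sGs.
  by rewrite inE => /orP [/eqP -> //|/mapP [m mK ->]]; exact: (proj1 (liftP m mK)).
have FG i : part F i = part G i.
  rewrite /part /F /G /= -set_of_mask_ldiff /=; case: i => -[|i] hi /=.
    rewrite -(mask_ofK (_ :\: _)); congr set_of_mask; rewrite -mask_of_ldiff //.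
  rewrite (nth_map l0); last by rewrite sK.
  have mK : nth l0 Ks i \in Ks by apply: mem_nth; rewrite sK.
  by rewrite (proj2 (liftP _ mK)) mask_ofK preimsetD.
have Fne i : i != ord0 -> #|part F i| = 6.
  move=> i0; have := cardsID (F ord0) (F i); rewrite F1 //.
  rewrite {1}/F card_preimset; last exact: perm_inj.
  by rewrite (proj1 HM _ (KsM i)) => /(@addnI 1 _ 6).
(* Lines of [F] with equal parts would share six points; so distinct indices have distinct parts,
   hence distinct lines of [P]. *)
have Ginj : injective G.
  move=> a b e; apply/eqP; apply/negPn/negP => ab.
  have ep : part F a = part F b by rewrite !FG /part e.
  have p0 : part F ord0 = set0 by rewrite /part setDv.
  have [a0|a0] := eqVneq a ord0.
    by have := Fne b; rewrite -ep a0 p0 cards0 eq_sym -a0 ab => /(_ isT).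
  have : part F a \subset F a :&: F b by rewrite subsetI subsetDl ep subsetDl.
  by move/subset_leq_card; rewrite Fne // F1.
have G1 : meets1 G.
  move=> a b ab; apply: P1' => //; apply/eqP => e.
  by case/eqP: ab; apply: Ginj; rewrite /G e.
have F7 i : #|F i| = #|G i|.
  rewrite /F card_preimset; last exact: perm_inj.
  by rewrite (proj1 HM _ (KsM i)); have [-> _] := P7 _ (GsP i).
have [g hg] := conc_perm F1 G1 F7 (parts_conc F1 G1 FG).
pose Ps := [set:: [seq set_of_mask m | m <- P]].
(* 25 distinct lines of [P] exhaust [P]. *)
have eG : [set G i | i : 'I_25] = Ps.
  apply/eqP; rewrite eqEcard; apply/andP; split.
    by apply/subsetP => _ /imsetP [i _ ->]; rewrite inE; apply: map_f.
  rewrite card_imset // card_ord /Ps cardsE (leq_trans (card_size _)) //.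
  by rewrite size_map sP.
exists (g^-1 * rho)%g, Ps; split; first exact: plane_set.
move=> l; rewrite -eG => /imsetP [i _ ->].
rewrite -hg imset_permM mulgA mulgV mul1g.
suff -> : rho @: F i = nth l0 (l0 :: Ks) i by exact: KsM.
apply/setP => x; rewrite -(permKV rho x) mem_imset; last exact: perm_inj.
by rewrite inE.
Qed.

(** * Lines as their parts off a fixed line *)

Definition part_mask (l0 m : line) : N := mask_of (m :\: l0).

Section Parts.
Variables (M : {set line}) (l0 : line).
Hypotheses (HM : is_ppl M) (l0M : l0 \in M).
Lemma card_part m : m \in M -> m != l0 -> #|m :\: l0| = 6.
Proof.
move=> mM ml; have := cardsID l0 m; rewrite (proj1 HM _ mM) (proj2 HM) //.
by move/(@addnI 1 _ 6).
Qed.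
Lemma part_meet0 m m' x : m \in M -> m' \in M -> m != m' -> x \in l0 -> x \in m -> x \in m' ->
  (m :\: l0) :&: (m' :\: l0) = set0.
Proof.
move=> mM m'M mm x0 xm xm'; apply/setP => y; rewrite !inE; apply/negP.
case/andP => /andP [y0 ym] /andP [_ ym'].
by rewrite (meet_eq HM mM m'M mm ym ym' xm xm') x0 in y0.
Qed.
Lemma part_meet1 m m' : m \in M -> m' \in M -> m != m' ->
  (forall x, x \in l0 -> x \in m -> x \notin m') -> #|(m :\: l0) :&: (m' :\: l0)| = 1.
Proof.
move=> mM m'M mm h; rewrite -setDIl -[RHS](proj2 HM _ _ mM m'M mm).
rewrite -[RHS](cardsID l0) [X in _ = X + _](_ : _ = 0) //.
apply/eqP; rewrite cards_eq0; apply/eqP/setP => x; rewrite !inE; apply/negP.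
by case/andP => /andP [xm xm'] x0; have := h x x0 xm; rewrite xm'.
Qed.
(** Two distinct lines with the same part would share six points. *)
Lemma part_mask_inj m m' : m \in M -> m' \in M -> m != l0 -> part_mask l0 m = part_mask l0 m' -> m = m'.
Proof.
move=> mM m'M ml e; apply/eqP/negPn/negP => mm.
have e' : m :\: l0 = m' :\: l0 by rewrite -[LHS]mask_ofK -[RHS]mask_ofK; congr set_of_mask.
have : m :\: l0 \subset m :&: m' by rewrite subsetI subsetDl e' subsetDl.
by move/subset_leq_card; rewrite (proj2 HM _ _ mM m'M mm) card_part.
Qed.

(** The point of [l0] on the line with part [a], as a number, and 0 if there is no such line. The
    soundness lemmas of the search take this labelling as the partition into classes. *)
Definition label (a : N) : nat :=
  odflt ord0 [pick x in l0 | [exists m in M, [&& m != l0, part_mask l0 m == a & x \in m]]].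
Lemma labelE m x : m \in M -> m != l0 -> x \in l0 -> x \in m -> label (part_mask l0 m) = x.
Proof.
move=> mM ml x0 xm; rewrite /label; case: pickP => [y /andP [y0 /existsP [m' /and4P [m'M m'l /eqP e ym']]]|h].
  have em := part_mask_inj m'M mM m'l e; rewrite em in ym'.
  by rewrite /= (meet_eq HM mM l0M ml ym' y0 xm x0).
have := h x; rewrite x0 /= => /existsP []; exists m; by rewrite mM ml eqxx.
Qed.
Lemma label_ex m : m \in M -> m != l0 -> exists x, [/\ x \in l0, x \in m & label (part_mask l0 m) = x].
Proof.
move=> mM ml; have [x [x0 xm]] := meet_ex HM l0M mM.
by exists x; split=> //; exact: labelE.
Qed.

Lemma part_mask_candidates (S : seq line) (U : {set pt}) m : m \in M -> m != l0 -> m :\: l0 \subset U ->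
  (forall a, a \in S -> [/\ a \in M, m != a & forall x, x \in l0 -> x \in m -> x \notin a]) ->
  part_mask l0 m \in candidates [seq part_mask l0 a | a <- S] (mask_of U) 6.
Proof.
move=> mM ml mU mS.
have := @candidatesP [seq part_mask l0 a | a <- S] (mask_of U) (part_mask l0 m).
rewrite size_positions_mask_of card_part //; apply.
  by move=> i /bit_mask_ofP [x xm ->]; rewrite bit_mask_of (subsetP mU).
move=> _ /mapP [a aS ->]; have [aM ma h] := mS a aS.
by rewrite mask_of_land single_mask_of part_meet1.
Qed.

Lemma part_mask_meet (S : seq line) : (forall m, m \in S -> m \in M /\ m != l0) ->
  {in [seq part_mask l0 m | m <- S] &, forall a b, a != b ->
    if label a == label b then null (N.land a b) else single (N.land a b)}.
Proof.
move=> hS _ _ /mapP [m mS ->] /mapP [m' m'S ->] ab.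
have [mM ml] := hS m mS; have [m'M m'l] := hS m' m'S.
have mm : m != m' by apply: contra ab => /eqP ->.
have [x [x0 xm ->]] := label_ex mM ml; have [y [y0 ym ->]] := label_ex m'M m'l.
rewrite mask_of_land; case: eqP => [/val_inj e|ne].
  by rewrite null_mask_of (part_meet0 mM m'M mm x0) // e.
rewrite single_mask_of part_meet1 // => z z0 zm; apply/negP => zm'; apply: ne.
by rewrite (meet_eq HM mM l0M ml xm x0 zm z0) (meet_eq HM m'M l0M m'l ym y0 zm' z0).
Qed.
Lemma part_mask_nonnull m : m \in M -> m != l0 -> ~~ null (part_mask l0 m).
Proof. by move=> mM ml; rewrite null_mask_of -cards_eq0 card_part. Qed.
Lemma part_mask_uniq (S : seq line) : (forall m, m \in S -> m \in M /\ m != l0) -> uniq S ->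
  uniq [seq part_mask l0 m | m <- S].
Proof.
move=> hS uS; rewrite map_inj_in_uniq // => m m' mS m'S.
have [mM ml] := hS m mS; have [m'M m'l] := hS m' m'S; exact: part_mask_inj.
Qed.
Lemma count_lab (S : seq line) (x : pt) : (forall m, m \in S -> m \in M /\ m != l0) -> x \in l0 ->
  count (fun a => label a == x) [seq part_mask l0 m | m <- S] = count (fun m : line => x \in m) S.
Proof.
move=> hS x0; rewrite count_map; apply: eq_in_count => m mS /=.
have [mM ml] := hS m mS; have [y [y0 ym ->]] := label_ex mM ml.
apply/eqP/idP => [/val_inj <- //|xm]; congr val.
exact: (meet_eq HM mM l0M ml ym y0 xm x0).
Qed.
Lemma count_lab_le (S : seq line) c : (forall m, m \in S -> m \in M /\ m != l0) ->
  (forall x, x \in l0 -> count (fun m : line => x \in m) S <= c) ->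
  forall x, count (fun a => label a == x) [seq part_mask l0 m | m <- S] <= c.
Proof.
move=> hS hc x; have [|] := boolP (has (fun a => label a == x) [seq part_mask l0 m | m <- S]); last first.
  by rewrite has_count -leqNgt => /leq_trans; apply.
case/hasP => _ /mapP [m mS ->]; have [mM ml] := hS m mS.
by have [y [y0 ym ->]] := label_ex mM ml => /eqP <-; rewrite count_lab // hc.
Qed.
(** Lines avoiding the three chosen points meet [l0] in one of its four other points. *)
Lemma labels_le4 (S : seq line) (p : nat -> pt) : (forall m, m \in S -> m \in M /\ m != l0) ->
  (forall g, g < 3 -> p g \in l0) -> (forall g h, g < 3 -> h < 3 -> p g = p h -> g = h) ->
  (forall m, m \in S -> forall g, g < 3 -> p g \notin m) ->
  size (undup (map label [seq part_mask l0 m | m <- S])) <= 4.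
Proof.
move=> hS pl pI pS.
pose Q := l0 :\: [set p 0; p 1; p 2].
have cQ : #|Q| = 4.
  have c3 : #|[set p 0; p 1; p 2]| = 3.
    rewrite setUC cardsU1 !inE cards2 ![p 2 == _]eq_sym.
    have n01 : p 0 != p 1 by apply/eqP => /pI; move/(_ isT isT).
    have n02 : p 0 != p 2 by apply/eqP => /pI; move/(_ isT isT).
    have n12 : p 1 != p 2 by apply/eqP => /pI; move/(_ isT isT).
    by rewrite n01 (negPf n02) (negPf n12).
  have s3 : [set p 0; p 1; p 2] \subset l0.
    by apply/subsetP => x; rewrite !inE => /orP [/orP [] |] /eqP ->; apply: pl.
  by have := cardsID [set p 0; p 1; p 2] l0; rewrite (setIidPr s3) c3 (proj1 HM _ l0M) => /(@addnI 3 _ 4).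
suff: size (undup (map label [seq part_mask l0 m | m <- S])) <= #|Q| by rewrite cQ.
rewrite cardE -(size_map val); apply: uniq_leq_size; first exact: undup_uniq.
move=> _ /[!mem_undup] /mapP [_ /mapP [m mS ->] ->].
have [mM ml] := hS m mS; have [y [y0 ym ->]] := label_ex mM ml.
apply: map_f; rewrite mem_enum !inE y0 andbT; apply/negP.
by case/orP => [/orP [] |] /eqP e; move: (ym); rewrite e; apply/negP; apply: pS.
Qed.
End Parts.

Definition others (M : {set line}) (l0 : line) (p : nat -> pt) (os : seq line) : Prop :=
  uniq os /\ forall m, m \in os -> [/\ m \in M, m != l0 & forall g, g < 3 -> p g \notin m].

Section Run.
Variables (M : {set line}) (l0 : line) (p : nat -> pt) (A : nat -> seq line).
Hypothesis HN : net M l0 p A.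
Let HM := net_ppl HN.
Let l0M := net_l0 HN.
Let S := A 0 ++ A 1 ++ A 2.
Let B := [seq mask_of l | l : line <- seed_seq l0 A].

Let linesE : parts_off B = [seq part_mask l0 a | a <- S].
Proof. by rewrite /B /= -map_comp; apply: eq_map => m; rewrite /= mask_of_ldiff. Qed.
Let offE : points_off B = mask_of (~: l0).
Proof. by rewrite /points_off -[head _ _]/(mask_of l0) all_pointsE mask_of_ldiff setTD. Qed.
Let memS a : a \in S -> exists g, [/\ g < 3 & a \in A g].
Proof. by rewrite !mem_cat => /or3P [] h; [exists 0|exists 1|exists 2]. Qed.

Lemma others_candidates os : others M l0 p os ->
  {subset [seq part_mask l0 m | m <- os] <= candidates (parts_off B) (points_off B) 6}.
Proof.
case=> uo ho _ /mapP [m /ho [mM ml pm] ->]; rewrite linesE offE.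
apply: (part_mask_candidates HM l0M) => //; first by apply/subsetP => x; rewrite !inE => /andP [].
move=> a /memS [g [g3 aA]]; have [aM al pa'] := net_mem HN g3 aA; split=> //.
  by apply/eqP => e; have := pm g g3; rewrite e pa'.
by move=> x x0 xm; apply/negP => xa; have := pm g g3; rewrite -(net_off HN g3 aA xa x0) xm.
Qed.
Lemma others_notin os m : others M l0 p os -> m \in os -> m \notin l0 :: S.
Proof.
case=> uo ho /ho [mM ml pm]; rewrite inE negb_or ml; apply/negP => /memS [g [g3 aA]].
by have := pm g g3; have [_ _ ->] := net_mem HN g3 aA.
Qed.
Let osMl os : others M l0 p os -> forall m, m \in os -> m \in M /\ m != l0.
Proof. by case=> _ h m /h []. Qed.

Lemma found_leaf (ks : seq line) hs s : uniq ks ->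
  (forall m, m \in ks -> m \in M /\ m \notin l0 :: S) -> size S + size ks = 24 ->
  leaf_ok B hs s -> perm_eq s [seq part_mask l0 m | m <- ks] -> found M.
Proof.
move=> uk hk sz hl pk; apply: (@leaf_found M l0 (S ++ ks) B hs s) => //.
- rewrite -cat_cons cat_uniq uk andbT; have := uniq_seed_seq HN; rewrite /seed_seq -/S => ->.
  by apply/hasPn => m /hk [].
- move=> m; rewrite -cat_cons mem_cat => /orP [|/hk [] //]; exact: (seed_seq_sub HN).
- by rewrite size_cat.
- move=> m; rewrite mem_cat => /orP [mS|mk]; rewrite mem_cat.
    by rewrite linesE (map_f (part_mask l0)) ?orbT.
  by rewrite (perm_mem pk) (map_f (part_mask l0)).
Qed.

Lemma search4_found os hs : others M l0 p os -> size S = 12 -> size os = 12 ->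
  (forall x, x \in l0 -> count (fun m : line => x \in m) os <= 4) \/
  (exists2 x, x \in l0 & count (fun m : line => x \in m) os = 6) ->
  search4 B (leaf_ok B hs) -> found M.
Proof.
move=> ho sS so hc hs4; have [uo ho'] := ho; have hMl := osMl ho.
have [s hl ps] : exists2 s, leaf_ok B hs s = true & perm_eq s [seq part_mask l0 m | m <- os].
  apply: (search4_sound hs4 (lab := label M l0)).
  - exact: (part_mask_uniq HM l0M).
  - by rewrite size_map.
  - exact: others_candidates.
  - exact: (part_mask_meet HM l0M).
  - by move=> _ /mapP [m /hMl [mM ml] ->]; exact: (part_mask_nonnull HM l0M).
  - apply: (labels_le4 HM l0M hMl (net_pl HN)).
      exact: (net_inj HN).
    by move=> m /ho' [].
  case: hc => [hc|[x x0 cx]]; [left|right].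
    exact: (count_lab_le HM l0M hMl).
  exists (val x); first by rewrite (count_lab HM l0M).
  (* Six lines besides [l0] pass through [x], so by [pencil6_cover] their parts fill the complement
     of [l0]. *)
  move=> i; rewrite offE; apply/bit_mask_ofP/hasP => [[z]|[_ /mapP [m mo ->] /andP [_]]].
    rewrite inE => z0 ->; have := @pencil6_cover M l0 x [seq m : line <- os | x \in m] z HM l0M x0.
    rewrite filter_uniq // size_filter cx => /(_ isT) h.
    have /hasP [m] : has (fun c : line => z \in c) [seq m : line <- os | x \in m].
      by apply: h => // m; rewrite mem_filter => /andP [xm /hMl []].
    rewrite mem_filter => /andP [xm mo] zm; exists (part_mask l0 m); first exact: map_f.
    have [mM ml] := hMl m mo.
    by rewrite (labelE HM l0M mM ml x0 xm) eqxx bit_mask_of !inE z0.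
  by case/bit_mask_ofP => z; rewrite !inE => /andP [z0 _] ->; exists z; rewrite ?inE.
apply: (found_leaf uo _ _ hl ps); last by rewrite sS so.
by move=> m mo; split; [case: (hMl m mo)|exact: others_notin mo].
Qed.

Lemma search6_found cs os hs : others M l0 p os -> uniq cs ->
  (forall m, m \in cs -> [/\ m \in M, m != l0, p 2 \in m & m \notin A 2]) ->
  size (A 0) = 6 -> size (A 1) = 6 -> size (A 2) = 3 -> size cs <= 3 -> size cs + size os = 9 ->
  (forall x, x \in l0 -> count (fun m : line => x \in m) os <= 6) ->
  search6 B (leaf_ok B hs) -> found M.
Proof.
move=> ho uc hc e0 e1 e2 sc sz co hs6; have [uo ho'] := ho; have hMl := osMl ho.
have hcMl m : m \in cs -> m \in M /\ m != l0 by case/hc.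
have e12 : size (A 0 ++ A 1) = 12 by rewrite size_cat e0 e1.
have p2 := net_pl HN (isT : 2 < 3).
have c3 : p 2 \in l0 by exact: (net_pl HN).
have [s hl ps] : exists2 s, leaf_ok B hs s = true &
    perm_eq s ([seq part_mask l0 m | m <- cs] ++ [seq part_mask l0 m | m <- os]).
  apply: (search6_sound hs6 (lab := label M l0)).
  - exact: (part_mask_uniq HM l0M).
  - exact: (part_mask_uniq HM l0M).
  - by rewrite size_map.
  - by rewrite !size_map.
  - move=> _ /mapP [m mc ->]; have [mM ml pm mA] := hc m mc.
    have -> : take 12 (parts_off B) = [seq part_mask l0 a | a <- A 0 ++ A 1].
      by rewrite linesE /S catA map_cat take_size_cat // size_map.
    have -> : drop 12 (parts_off B) = [seq part_mask l0 a | a <- A 2].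
      by rewrite linesE /S catA map_cat drop_size_cat // size_map.
    (* Lines of [cs] meet those of [A 2] at [p 2] only, so their parts avoid every point of the
       latter. *)
    pose V := ~: l0 :\: \bigcup_(a <- A 2) a.
    have -> : N.ldiff (points_off B) (foldr N.lor 0%num [seq part_mask l0 a | a <- A 2]) = mask_of V.
      apply: mask_inj => i; rewrite bit_ldiff offE; case: (ltnP i 43) => hi; last by rewrite !bit_mask_of_ge.
      rewrite !(bit_mask_of _ (Ordinal hi)) /V in_setD andbC; case i0: (_ \in ~: l0); rewrite ?andbF // !andbT.
      congr negb; elim: (A 2) => [|a T IH] /=; first by rewrite big_nil inE.
      rewrite big_cons in_setU bit_lor IH (bit_mask_of _ (Ordinal hi)) in_setD.
      by move: i0; rewrite in_setC => ->.
    apply: (part_mask_candidates HM l0M) => //.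
      apply/subsetP => x; rewrite !inE => /andP [x0 xm]; rewrite x0 andbT.
      apply/negP => xU; have {xU} /hasP [a aA xa] : has (fun a : line => x \in a) (A 2).
        by elim: (A 2) xU => [|a T IH]; rewrite ?big_nil ?big_cons inE //= => /orP [->|/IH ->] //; rewrite orbT.
      have [aM al pa'] := net_mem HN (isT : 2 < 3) aA.
      have am : a != m by apply: contra mA => /eqP <-.
      by move: x0; rewrite (meet_eq HM aM mM am xa xm pa' pm) c3.
    move=> a; rewrite mem_cat => aA.
    have [g [g3 g2 {}aA]] : exists g, [/\ g < 3, g != 2 & a \in A g].
      by case/orP: aA => h; [exists 0|exists 1].
    have [aM al pa'] := net_mem HN g3 aA.
    have n2 : p 2 \notin a by exact: (net_notin HN g3 (isT : 2 < 3) g2 aA).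
    split=> //; first by apply/eqP => e; rewrite -e pm in n2.
    by move=> x x0 xm; rewrite (meet_eq HM mM l0M ml xm x0 pm c3).
  - exact: others_candidates.
  - move=> _ _ /mapP [m mc ->] /mapP [m' m'c ->] ab.
    have mm : m != m' by apply: contra ab => /eqP ->.
    have [mM ml pm _] := hc m mc; have [m'M m'l pm' _] := hc m' m'c.
    by rewrite mask_of_land null_mask_of (part_meet0 HM mM m'M mm c3).
  - move=> _ _ /mapP [m mc ->] /mapP [m' m'o ->].
    have [mM ml pm _] := hc m mc; have [m'M m'l pm'] := ho' m' m'o.
    have mm : m != m' by apply/eqP => e; have := pm' 2 isT; rewrite -e pm.
    rewrite mask_of_land single_mask_of (part_meet1 HM mM m'M mm) // => x x0 xm.
    by rewrite (meet_eq HM mM l0M ml xm x0 pm c3) pm'.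
  - exact: (part_mask_meet HM l0M).
  - apply: (labels_le4 HM l0M hMl (net_pl HN)).
      exact: (net_inj HN).
    by move=> m /ho' [].
  - exact: (count_lab_le HM l0M hMl).
rewrite -map_cat in ps.
apply: (found_leaf _ _ _ hl ps); last by rewrite /S !size_cat e0 e1 e2 sz.
- rewrite cat_uniq uc uo andbT; apply/hasPn => m mo; apply/negP => /= mc.
  have [_ _ pm _] := hc m mc; have [_ _ pm'] := ho' m mo.
  by have := pm' 2 isT; rewrite pm.
move=> m; rewrite mem_cat => /orP [mc|mo]; last by split; [case: (hMl m mo)|exact: others_notin mo].
have [mM ml pm mA] := hc m mc; split=> //; rewrite inE (negPf ml) /= !mem_cat !negb_or mA andbT.
by apply/andP; split; apply/negP => aA; [have := net_notin HN (isT : 0 < 3) (isT : 2 < 3) isT aA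
  | have := net_notin HN (isT : 1 < 3) (isT : 2 < 3) isT aA]; rewrite pm.
Qed.
End Run.

Lemma check_seedsP n search hs i Ts : check_seeds n search hs i Ts -> forall T, T \in Ts ->
  exists2 hs', valid_seed n T (seed_lines n T) & search (seed_lines n T) (leaf_ok (seed_lines n T) hs').
Proof.
elim: Ts i => //= T0 Ts IH i; case: ifP => // h1; case: ifP => // h2 h3 T.
rewrite inE => /orP [/eqP ->|]; last exact: IH h3 T.
by eexists; [exact: h1 | exact: h2].
Qed.

Lemma others_imset (M : {set line}) l0 p os (g : {perm pt}) : others M l0 p os ->
  others [set g @: l | l : line in M] (g @: l0) (g \o p) [seq g @: l | l : line <- os].
Proof.
case=> uo ho; have gi := @perm_inj _ g; split.
  by rewrite map_inj_uniq //; exact: imset_inj.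
move=> _ /mapP [m mo ->]; have [mM ml pm] := ho m mo; split.
- exact: imset_f.
- by apply: contra ml => /eqP /(imset_inj gi) ->.
- by move=> i i3 /=; rewrite mem_imset // pm.
Qed.
Lemma count_imset (g : {perm pt}) x (os : seq line) :
  count (fun m : line => x \in m) [seq g @: l | l : line <- os] =
  count (fun m : line => (g^-1)%g x \in m) os.
Proof.
rewrite count_map; apply: eq_count => m /=.
by rewrite -{1}(permKV g x) mem_imset //; exact: perm_inj.
Qed.
Lemma others_reindex (M : {set line}) l0 p os r : others M l0 p os -> (forall g, g < 3 -> r g < 3) ->
  others M l0 (p \o r) os.
Proof.
case=> uo ho hr; split=> // m /ho [a b c]; split=> // g /hr; exact: c.
Qed.
Lemma mem_imsetV (g : {perm pt}) x (l0 : line) : x \in g @: l0 -> (g^-1)%g x \in l0.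
Proof. by rewrite -{1}(permKV g x) mem_imset //; exact: perm_inj. Qed.

(** Sorts the third pencil by weight as [reaches] demands, relabels the net, and moves it onto the
    model on which the search was run. That [r 2 = 2] when [K < n] is kept because the search then
    treats the third point apart. *)
Lemma seeded n full K R search hs (M : {set line}) l0 p A :
  K <= n -> reaches n full K R -> check_seeds n search hs 0 R ->
  net M l0 p A -> size (A 0) = n -> size (A 1) = n -> size (A 2) = K ->
  exists r A' (g : {perm pt}) hs',
   [/\ forall i, i < 3 -> r i < 3, K < n -> r 2 = 2,
      [/\ size (A' 0) = n, size (A' 1) = n & size (A' 2) = K],
      net M l0 (p \o r) A' /\ (forall i, i < 3 -> perm_eq (A' i) (A (r i))) &
    let B := [seq mask_of l | l : line <- seed_seq (g @: l0) (fun i => [seq g @: l | l : line <- A' i])] in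
    search B (leaf_ok B hs')].
Proof.
move=> Kn HR HC HN e0 e1 e2.
pose le s s' := weight (@conc pt) A s <= weight (@conc pt) A s'.
pose A1 g := sel (A 0) (A 1) (sort le (A 2)) g.
have pA g : g < 3 -> perm_eq (A1 g) (A g).
  by case: g => [|[|[|g]]] // _; rewrite /A1 /= ?perm_refl // perm_sort.
have HN1 : net M l0 p A1.
  have := @net_perm M l0 p A A1 id HN; apply=> //.
have [|r [A' [r3 rI rK pA' hA']]] := HR M l0 p A1 HN1 e0 e1 (etrans (perm_size (pA 2 isT)) e2).
  by move=> _; apply: sort_sorted => x y; exact: leq_total.
have HN2 := net_perm HN1 r3 rI pA'.
have pA2 i : i < 3 -> perm_eq (A' i) (A (r i)).
  by move=> i3; apply: perm_trans (pA' i i3) (pA _ (r3 i i3)).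
have [hs' ok sr] := check_seedsP HC hA'.
have szA g : g < 3 -> size (A g) = if g == 2 then K else n by case: g => [|[|[|g]]].
have szK i : i < 3 -> size (A' i) = if i == 2 then K else n.
  move=> i3; rewrite (perm_size (pA2 i i3)) szA ?r3 //.
  have [e|lt] := eqVneq K n; first by rewrite e !if_same.
  have r2 : r 2 = 2 by apply: rK; rewrite ltn_neqAle lt.
  case: (eqVneq i 2) => [-> |i2]; first by rewrite r2.
  by case: eqP => // ri; case/eqP: i2; apply: rI => //; rewrite ri r2.
have [e0' e1' e2'] : [/\ size (A' 0) = n, size (A' 1) = n & size (A' 2) = K].
  by rewrite !szK.
have [g eB] := valid_seed_perm ok HN2 e0' e1' erefl.
exists r, A', g, hs'; split=> //; cbv zeta.
suff -> : [seq mask_of l | l : line <- seed_seq (g @: l0) (fun i => [seq g @: l | l : line <- A' i])]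
   = seed_lines n (array_of (@conc pt) A') by [].
by rewrite eB /seed_seq /= -!map_cat -map_comp.
Qed.

Lemma found_triple5 hs R (M : {set line}) l0 p A os : reaches 4 false 4 R -> check_seeds 4 search4 hs 0 R ->
  net M l0 p A -> size (A 0) = 4 -> size (A 1) = 4 -> size (A 2) = 4 ->
  others M l0 p os -> size os = 12 ->
  (forall x, x \in l0 -> count (fun m : line => x \in m) os <= 4) \/
  (exists2 x, x \in l0 & count (fun m : line => x \in m) os = 6) -> found M.
Proof.
move=> HR HC HN e0 e1 e2 ho so hc.
have [r [A' [g [hs' [r3 _ [e0' e1' e2'] [HN' _]] sr]]]] := seeded (leqnn 4) HR HC HN e0 e1 e2.
apply: (@found_imset M g).
have ho' := others_imset g (others_reindex ho r3).
apply: (search4_found (net_imset g HN') ho') sr; rewrite ?size_cat ?size_map ?e0' ?e1' ?e2' //.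
case: hc => [hc|[x x0 hx]]; [left|right].
  by move=> x /mem_imsetV x0; rewrite count_imset hc.
exists (g x); first by rewrite imset_f.
by rewrite count_imset permK.
Qed.

Lemma found_pair7 hs R (M : {set line}) l0 p A cs os : reaches 6 true 3 R -> check_seeds 6 search6 hs 0 R ->
  net M l0 p A -> size (A 0) = 6 -> size (A 1) = 6 -> size (A 2) = 3 ->
  others M l0 p os -> uniq cs ->
  (forall m, m \in cs -> [/\ m \in M, m != l0, p 2 \in m & m \notin A 2]) ->
  size cs <= 3 -> size cs + size os = 9 ->
  (forall x, x \in l0 -> count (fun m : line => x \in m) os <= 6) -> found M.
Proof.
move=> HR HC HN e0 e1 e2 ho uc hc sc sz hco.
have [r [A' [g [hs' [r3 r2 [e0' e1' e2'] [HN' pA']] sr]]]] := seeded (isT : 3 <= 6) HR HC HN e0 e1 e2.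
apply: (@found_imset M g); have gi := @perm_inj _ g.
have ho' := others_imset g (others_reindex ho r3).
apply: (search6_found (net_imset g HN') ho' (cs := [seq g @: l | l : line <- cs])) sr;
  rewrite ?size_map ?e0' ?e1' ?e2' //.
- by rewrite map_inj_uniq //; exact: imset_inj.
- move=> _ /mapP [m mc ->]; have [mM ml pm mA] := hc m mc; split.
  + exact: imset_f.
  + by apply: contra ml => /eqP /(imset_inj gi) ->.
  + by rewrite /= r2 // mem_imset.
  + rewrite mem_map; last exact: imset_inj.
    by rewrite (perm_mem (pA' 2 isT)) r2.
- by move=> x /mem_imsetV x0; rewrite count_imset hco.
Qed.

(** * Degrees of points *)

Definition pencil (M : {set line}) (x : pt) : {set line} := [set a in M | x \in a].
Definition deg (M : {set line}) x := #|pencil M x|.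
Definition is_pplb (M : {set line}) : bool :=
  [forall l in M, #|l| == 7] && [forall l in M, forall m in M, (l != m) ==> (#|l :&: m| == 1)].
Lemma is_pplP M : reflect (is_ppl M) (is_pplb M).
Proof.
apply: (iffP andP) => [[/forall_inP h1 /forall_inP h2]|[h1 h2]]; split.
- by move=> l /h1 /eqP.
- by move=> l m lM mM lm; have /forall_inP/(_ m mM)/implyP/(_ lm)/eqP := h2 l lM.
- by apply/forall_inP => l lM; rewrite h1.
- apply/forall_inP => l lM; apply/forall_inP => m mM; apply/implyP => lm; by rewrite h2.
Qed.

Lemma sum_deg (S : {set line}) (X : {set pt}) :
  \sum_(x in X) deg S x = \sum_(a in S) #|X :&: a|.
Proof.
transitivity (\sum_(x in X) \sum_(a in S) (x \in a)).
  apply: eq_bigr => x _; rewrite /deg -sum1_card big_mkcond [RHS]big_mkcond.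
  by apply: eq_bigr => a _; rewrite inE; case: (a \in S); case: (x \in a).
rewrite exchange_big; apply: eq_bigr => a _ /=.
rewrite -sum1_card big_mkcond [RHS]big_mkcond; apply: eq_bigr => x _.
by rewrite inE; case: (x \in X); case: (x \in a).
Qed.

Section Deg.
Variable M : {set line}.
Hypothesis HM : is_ppl M.

Lemma deg_pencil z x : x != z -> deg (pencil M z) x <= 1.
Proof.
move=> xz; rewrite leqNgt; apply/negP => /card_gt1P [a [b [] ]].
rewrite !inE => /andP [/andP [aM za] xa] /andP [/andP [bM zb] xb] ab.
by case/eqP: xz; apply: (meet_eq HM aM bM).
Qed.
Lemma sum_pencil z : \sum_(x | x != z) deg (pencil M z) x = 6 * deg M z.
Proof.
rewrite (eq_bigl (mem (~: [set z]))); last by move=> x; rewrite !inE.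
rewrite sum_deg mulnC -sum_nat_const; apply: eq_bigr => a; rewrite inE => /andP [aM za].
have := cardsID [set z] a; rewrite (proj1 HM _ aM) (setIidPr _) ?sub1set // cards1.
by move/(@addnI 1 _ 6); rewrite setDE setIC.
Qed.
Lemma sum_other_points z : \sum_(x : pt | x != z) 1 = 42.
Proof. by rewrite sum_nat_cond_const muln1 cardsE; have := cardC1 z; rewrite card_ord. Qed.
Lemma deg_le7 z : deg M z <= 7.
Proof.
have : \sum_(x | x != z) deg (pencil M z) x <= \sum_(x : pt | x != z) 1.
  by apply: leq_sum => x; exact: deg_pencil.
by rewrite sum_pencil sum_other_points; move: (deg M z); ssrlia.
Qed.
(** Seven lines through [z] have 7 * 6 = 42 further points, which is every point other than [z]. *)
Lemma deg7_line z x : deg M z = 7 -> x != z -> exists2 a, a \in pencil M z & x \in a.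
Proof.
move=> d7 xz; have [e|] := posnP (deg (pencil M z) x); last first.
  by case/card_gt0P => a; rewrite inE => /andP [h1 h2]; exists a.
have := sum_pencil z; rewrite d7 (bigD1 x) //= e add0n => e'.
have := sum_other_points z; rewrite (bigD1 x) //= => e1.
have : \sum_(i | (i != z) && (i != x)) deg (pencil M z) i <= \sum_(i : pt | (i != z) && (i != x)) 1.
  by apply: leq_sum => i /andP [iz _]; exact: deg_pencil.
by rewrite e'; move: e1; move: (\sum_(i | _) 1) => n; clear; ssrlia.
Qed.

(** The six lines through [z] miss exactly 42 - 36 = 6 points, which together with [z] form [l]. A
    line not through [z] meets these six lines in six distinct points, so exactly one of its seven
    points is on [l]. *)
Lemma deg6_extend z : deg M z = 6 -> exists2 l, l \notin M & is_ppl (l |: M).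
Proof.
move=> d6; pose l : line := z |: [set x | (x != z) && (deg (pencil M z) x == 0)].
have zl : z \in l by rewrite !inE eqxx.
have cl : #|l| = 7.
  rewrite /l cardsU1 !inE eqxx /=; apply/eqP; rewrite -[7]/(1 + 6) eqn_add2l.
  have := sum_other_points z; rewrite (bigID (fun x => deg (pencil M z) x == 0)) /=.
  rewrite sum_nat_cond_const muln1.
  have -> : \sum_(i | (i != z) && (deg (pencil M z) i != 0)) 1 = 36; last by move/(@addIn 36 _ 6) ->.
  have := sum_pencil z; rewrite d6 (bigID (fun x => deg (pencil M z) x == 0)) /=.
  rewrite big1 ?add0n; last by move=> x /andP [_ /eqP].
  move=> e; rewrite -[RHS]/(6 * 6) -e; apply: eq_bigr => x /andP [xz]; have := deg_pencil xz.
  by case: (deg _ _) => [|[|]].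
have ml m : m \in M -> #|l :&: m| = 1.
  move=> mM; case zm : (z \in m).
    have -> : l :&: m = [set z]; last by rewrite cards1.
    apply/setP => x; rewrite in_set1 in_setI; case: (eqVneq x z) => [->|xz]; first by rewrite zl zm.
    rewrite !inE (negPf xz) /=; apply/negP => /andP [/eqP/cards0_eq e xm].
    by have := in_set0 m; rewrite -e !inE mM zm xm.
  have s6 : \sum_(x in m) deg (pencil M z) x = 6.
    rewrite sum_deg -[RHS]d6 /deg -sum1_card; apply: eq_bigr => a; rewrite inE => /andP [aM za].
    by apply: (proj2 HM) => //; apply/eqP => e; rewrite -e zm in za.
  have xz x : x \in m -> x != z by move=> xm; apply: contraFneq zm => <-.
  have := proj1 HM _ mM; rewrite -sum1_card (bigID (fun x => deg (pencil M z) x == 0)) /=.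
  have -> : \sum_(i in m | deg (pencil M z) i != 0) 1 = 6.
    rewrite -[RHS]s6 [in RHS](bigID (fun x => deg (pencil M z) x == 0)) /=.
    rewrite [X in _ = X + _]big1 ?add0n; last by move=> x /andP [_ /eqP].
    apply: eq_bigr => x /andP [xm]; have := deg_pencil (xz x xm).
    by case: (deg _ _) => [|[|]].
  move/(@addIn 6 _ 1) => e; rewrite -[RHS]e sum_nat_cond_const muln1; apply: eq_card => x.
  rewrite !inE andbC; case xm : (x \in m) => //=.
  by rewrite (negPf (xz x xm)).
have lM : l \notin M.
  by apply/negP => /ml; rewrite setIid cl.
exists l => //; split.
  by move=> a /setU1P [->|/(proj1 HM)].
move=> a b /setU1P [->|aM] /setU1P [->|bM] ab; first by rewrite eqxx in ab.
- exact: ml.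
- by rewrite setIC ml.
- exact: (proj2 HM).
Qed.

(** Double counting: [l] itself contributes 7 and each other line contributes 1. *)
Lemma sum_line l : l \in M -> \sum_(x in l) deg M x = #|M| + 6.
Proof.
move=> lM; rewrite sum_deg (bigD1 l) //= setIid (proj1 HM) //.
rewrite (eq_bigr (fun=> 1)); last by move=> a /andP [aM al]; rewrite (proj2 HM) // eq_sym.
rewrite sum_nat_cond_const muln1 (cardsD1 l M) lM.
rewrite (_ : [set x in M | x != l] = M :\ l); first by rewrite addnC add1n addSn -addnS.
by apply/setP => a; rewrite !inE andbC.
Qed.
End Deg.

Lemma is_ppl_sub (M S : {set line}) : is_ppl M -> S \subset M -> is_ppl S.
Proof.
move=> [h1 h2] /subsetP sub; split=> [l /sub /h1 //|l m /sub lM /sub mM]; exact: h2.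
Qed.

(** * Choice of the line and its three points *)

Lemma pick_points (Q : {set pt}) : 3 <= #|Q| ->
  exists p : nat -> pt, (forall g, g < 3 -> p g \in Q) /\
    (forall g h, g < 3 -> h < 3 -> p g = p h -> g = h).
Proof.
move=> c3; exists (nth ord0 (enum Q)); split.
  by move=> g g3; rewrite -mem_enum mem_nth // -cardE (leq_trans g3).
move=> g h g3 h3 /eqP; rewrite nth_uniq ?enum_uniq -?cardE ?(leq_trans g3) ?(leq_trans h3) //.
by move/eqP.
Qed.

Section Cases.
Variables (M : {set line}) (l0 : line) (p : nat -> pt).
Hypotheses (HM : is_ppl M) (l0M : l0 \in M) (pl : forall g, g < 3 -> p g \in l0)
  (pI : forall g h, g < 3 -> h < 3 -> p g = p h -> g = h).
Definition rest (x : pt) : seq line := enum (pencil M x :\ l0).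
Definition other_lines : {set line} := [set a in M | (a != l0) && [forall g : 'I_3, p g \notin a]].

Lemma mem_rest x m : m \in rest x = [&& m != l0, m \in M & x \in m].
Proof. by rewrite mem_enum !inE. Qed.
Lemma rest_mem x m : m \in rest x -> [/\ m \in M, m != l0 & x \in m].
Proof. by rewrite mem_rest => /and3P []. Qed.
Lemma size_rest x : x \in l0 -> (size (rest x)).+1 = deg M x.
Proof.
by move=> x0; rewrite -cardE /deg (cardsD1 l0 (pencil M x)) inE l0M x0 add1n.
Qed.
Lemma other_linesP m : m \in other_lines -> [/\ m \in M, m != l0 & forall g, g < 3 -> p g \notin m].
Proof.
rewrite inE => /and3P [mM ml /forallP h]; split=> // g g3; exact: (h (Ordinal g3)).
Qed.
Lemma other_lines_others s : uniq s -> {subset s <= other_lines} -> others M l0 p s.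
Proof. by move=> us sub; split=> // m /sub /other_linesP. Qed.
(** A line other than [l0] meets it once, so it passes through at most one of the three points. *)
Lemma card_other_lines : #|other_lines| + (size (rest (p 0)) + size (rest (p 1)) + size (rest (p 2))) = #|M|.-1.
Proof.
have -> : #|M|.-1 = \sum_(a in M :\ l0) 1 by rewrite sum1_card (cardsD1 l0 M) l0M.
have rE x : x \in l0 -> size (rest x) = \sum_(a in M :\ l0) (x \in a).
  move=> x0; rewrite -cardE -sum1_card big_mkcond [RHS]big_mkcond; apply: eq_bigr => a _.
  by rewrite !inE; case: (a == l0); case: (a \in M) => //=; case: (x \in a).
rewrite !rE ?pl // -sum1_card -!big_split big_mkcond [RHS]big_mkcond.
rewrite [X in _ + X]big_mkcond -big_split; apply: eq_bigr => a _ /=.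
rewrite !inE; case aM : (a \in M); case al : (a == l0) => //=.
have n g h : g < 3 -> h < 3 -> p g \in a -> p h \in a -> g = h.
  move=> g3 h3 ga ha; apply: pI => //.
  by apply: (meet_eq HM aM l0M) => //; [rewrite al|apply: pl|apply: pl].
have := n 0 1 isT isT; have := n 0 2 isT isT; have := n 1 2 isT isT.
case: forallP => [h|nh].
  have h0 := h (Ordinal (isT : 0 < 3)); have h1 := h (Ordinal (isT : 1 < 3)).
  by have h2 := h (Ordinal (isT : 2 < 3)); rewrite /= in h0 h1 h2; rewrite (negPf h0) (negPf h1) (negPf h2).
case a0 : (p 0 \in a); case a1 : (p 1 \in a); case a2 : (p 2 \in a) => //= h1 h2 h3;
  try by [have := h1 isT isT | have := h2 isT isT | have := h3 isT isT].
by case: nh => -[[|[|[|g]]] g3] //=; rewrite ?a0 ?a1 ?a2.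
Qed.
Lemma count_others (os : seq line) x : uniq os -> (forall m, m \in os -> m \in M /\ m != l0) -> x \in l0 ->
  (count (fun m : line => x \in m) os).+1 <= deg M x.
Proof.
move=> uo ho x0; rewrite -size_rest // ltnS -size_filter; apply: uniq_leq_size; first exact: filter_uniq.
by move=> m; rewrite mem_filter mem_rest => /andP [-> /ho [-> ->]].
Qed.
Lemma rest_net A : (forall g, g < 3 -> uniq (A g)) ->
  (forall g, g < 3 -> {subset A g <= rest (p g)}) -> net M l0 p A.
Proof.
move=> uA sA; split=> // g x g3 /(sA g g3); exact: rest_mem.
Qed.
End Cases.

Lemma found_sub (S M : {set line}) : S \subset M -> found S -> found M.
Proof. by move=> /subsetP sub [f [P [hP h]]]; exists f, P; split=> // l /h /sub. Qed.

Section Case6.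
Variables (R6 : seq triple_array) (hs6 : seq (nat * (nat * N))).
Hypotheses (HR6 : reaches 6 true 3 R6) (HC6 : check_seeds 6 search6 hs6 0 R6).

Lemma found_two_deg7 (M : {set line}) z z' : is_ppl M -> 25 <= #|M| -> z' != z ->
  deg M z = 7 -> deg M z' = 7 -> found M.
Proof.
move=> HM c25 zz d7 d7'; have [l0] := deg7_line HM d7 zz.
rewrite inE => /andP [l0M z0] z'0.
(* The degrees on [l0] sum to at least 31; without [r] the sum would be at most 7 + 7 + 5 * 3 =
   29. *)
have [r /and4P [row0 rz rz' rd]|no] := pickP (fun r => [&& r \in l0, r != z, r != z' & 3 < deg M r]); last first.
  have := sum_line HM l0M; rewrite (bigD1 z) //= (bigD1 z') ?z'0 //= d7 d7'.
  have : \sum_(i in l0 | (i != z) && (i != z')) deg M i <= \sum_(i in l0 | (i != z) && (i != z')) 3.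
    apply: leq_sum => x /and3P [h1 h2 h3]; rewrite leqNgt; apply/negP => h4.
    by have := no x; rewrite h1 h2 h3 h4.
  have : \sum_(i in l0) 3 = 21 by rewrite sum_nat_const (proj1 HM).
  rewrite (bigD1 z) //= (bigD1 z') ?z'0 //= (eq_bigl _ _ (fun i => esym (andbA _ _ _))).
  rewrite [X in _ -> _ -> 7 + (7 + X) = _ -> _](eq_bigl _ _ (fun i => esym (andbA _ _ _))).
  by move: c25; move: #|M| (\sum_(i in l0 | _) _) (\sum_(i in l0 | _) _) => a b c; clear; ssrlia.
pose p g := sel z z' r g.
(* Only three lines through [r] enter the seed, so the same seeds serve for every possible degree of
   [r]; the others form [cs]. *)
pose A g := sel (rest M l0 z) (rest M l0 z') (take 3 (rest M l0 r)) g.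
have pl g : g < 3 -> p g \in l0 by case: g => [|[|[|g]]].
have pI g h : g < 3 -> h < 3 -> p g = p h -> g = h.
  case: g => [|[|[|g]]] //; case: h => [|[|[|h]]] // _ _ /eqP; rewrite /p /=;
   by rewrite ?(negPf rz) ?(negPf rz') ?(negPf zz) 1?eq_sym ?(negPf rz) ?(negPf rz') ?(negPf zz).
have HN : net M l0 p A.
  apply: (@rest_net _ _ _ HM l0M pl pI).
    by case=> [|[|[|g]]] // _; rewrite /A /= ?take_uniq ?enum_uniq.
  by case=> [|[|[|g]]] // _ m //=; exact: mem_take.
have s7 x : x \in l0 -> deg M x = 7 -> size (rest M l0 x) = 6.
  by move=> x0 d; apply: succn_inj; rewrite size_rest.
have k3 : 3 <= size (rest M l0 r) by rewrite -ltnS size_rest.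
have k6 : size (rest M l0 r) <= 6 by rewrite -ltnS size_rest ?deg_le7.
have := card_other_lines HM l0M pl pI; rewrite /p /= (s7 z) // (s7 z') // => co.
pose cs := drop 3 (rest M l0 r).
have scs : size cs = size (rest M l0 r) - 3 by rewrite size_drop.
(* [l0], the 6 + 6 + 3 lines of the seed and these nine lines, [cs] included, make 25. *)
pose os := take (9 - size cs) (enum (other_lines M l0 p)).
have sos : size os = 9 - size cs.
  rewrite size_takel // -cardE scs; move: co c25 k3 k6; rewrite -/p.
  by move: #|other_lines _ _ _| #|M| (size _) => a b c; clear; ssrlia.
have ho : others M l0 p os.
  apply: other_lines_others; first by rewrite take_uniq ?enum_uniq.
  by move=> m /mem_take; rewrite mem_enum.
apply: (found_pair7 HR6 HC6 HN _ _ _ ho (cs := cs)); rewrite /A /= ?(size_takel k3) ?drop_uniq ?enum_uniq ?(s7 z) ?(s7 z') //.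
- move=> m mc; have [mM ml rm] := rest_mem (mem_drop mc); split=> //.
  apply/negP => mt; have := enum_uniq (pencil M r :\ l0); rewrite -/(rest M l0 r).
  rewrite -(cat_take_drop 3 (rest M l0 r)) cat_uniq => /and3P [_ /hasPn h _].
  by have := h m mc; rewrite /= mt.
- by rewrite scs; move: k6; move: (size _) => k; clear; ssrlia.
- by rewrite sos scs; move: k6; move: (size _) => k; clear; ssrlia.
move=> x x0; rewrite -ltnS; apply: leq_trans (deg_le7 HM x).
have [uo ho'] := ho; apply: (@count_others _ _ l0M) => // m /ho' [] //.
Qed.

End Case6.

Section Case4.
Variables (R4 : seq triple_array) (hs4 : seq (nat * (nat * N))).
Hypotheses (HR4 : reaches 4 false 4 R4) (HC4 : check_seeds 4 search4 hs4 0 R4).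

Lemma found_no_deg7 S : is_ppl S -> #|S| = 25 -> (forall x, deg S x <= 5) -> found S.
Proof.
move=> HS c25 d5; have /card_gt0P [l0 l0S] : 0 < #|S| by rewrite c25.
pose Q := [set x in l0 | deg S x == 5].
have Q3 : 3 <= #|Q|.
  (* The left side is 25 + 6 = 28 + 3, and the terms 4 on the right account for 28. *)
  have : \sum_(x in l0) deg S x <= \sum_(x in l0) (4 + (deg S x == 5)).
    by apply: leq_sum => x _; have := d5 x; move: (deg S x) => d; case: eqP => [->|]; rewrite /nat_of_bool; ssrlia.
  rewrite sum_line // c25 big_split /= sum_nat_const (proj1 HS) //.
  suff -> : \sum_(i in l0) (deg S i == 5) = #|Q| by rewrite -[25 + 6]/(28 + 3) leq_add2l.
  rewrite -sum1_card [RHS]big_mkcond [LHS]big_mkcond; apply: eq_bigr => x _.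
  by rewrite inE; case: (x \in l0); case: eqP.
have [p [pQ pI]] := pick_points Q3.
have pl g : g < 3 -> p g \in l0 by move=> /pQ; rewrite inE => /andP [].
have sr g : g < 3 -> size (rest S l0 (p g)) = 4.
  move=> g3; apply: succn_inj; rewrite size_rest ?pl //.
  by have := pQ g g3; rewrite inE => /andP [_ /eqP].
have HN : net S l0 p (fun g => rest S l0 (p g)).
  by apply: rest_net => // g g3; [exact: enum_uniq|move=> m].
have ho : others S l0 p (enum (other_lines S l0 p)).
  apply: other_lines_others; first exact: enum_uniq.
  by move=> m; rewrite mem_enum.
apply: (found_triple5 HR4 HC4 HN) ho _ _; rewrite ?sr //.
  by have := card_other_lines HS l0S pl pI; rewrite !sr // c25 -cardE => /(@addIn 12 _ 12).
left=> x x0; rewrite -ltnS; apply: leq_trans (d5 x).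
apply: (@count_others _ _ l0S) => //; first exact: enum_uniq.
by move=> m; rewrite mem_enum => /other_linesP [].
Qed.

Section B2.
Variables (M : {set line}) (z : pt).
Hypotheses (HM : is_ppl M) (c25 : 25 <= #|M|) (d7 : deg M z = 7) (d5 : forall x, x != z -> deg M x <= 5).
(** Every point other than [z] is on exactly one line through [z], so removing these lines lowers
    all other degrees by one: in [M1] they are at most 4, and [z] has degree 0. *)
Let M1 := M :\: pencil M z.
Let w := #|M1|.
Let HM1 : is_ppl M1. Proof. by apply: is_ppl_sub HM _; exact: subsetDl. Qed.
Let wE : #|M| = 7 + w.
Proof.
have sub : pencil M z \subset M by apply/subsetP => a; rewrite inE => /andP [].
by rewrite -(cardsID (pencil M z) M) (setIidPr sub) -/(deg M z) d7.
Qed.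
Let Rz : deg M1 z = 0.
Proof.
apply/eqP; rewrite cards_eq0; apply/eqP/setP => a; rewrite !inE; apply/negP.
by case/andP => /andP [/nandP [/negP h|/negP h] aM] za; apply: h.
Qed.
Let degP x : x != z -> deg (pencil M z) x = 1.
Proof.
move=> xz; apply/eqP; rewrite eqn_leq deg_pencil //=; apply/card_gt0P.
by have [a h1 h2] := deg7_line HM d7 xz; exists a; rewrite inE h1.
Qed.
Let RE x : x != z -> deg M x = (deg M1 x).+1.
Proof.
move=> xz; rewrite -[RHS]addn1 -(degP xz) addnC /deg.
rewrite -(cardsID (pencil M z) (pencil M x)); congr (_ + _); apply: eq_card => a; rewrite !inE.
  by case: (a \in M); case: (x \in a); case: (z \in a).
by case: (a \in M); case: (x \in a); case: (z \in a).
Qed.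
Let R4' x : deg M1 x <= 4.
Proof.
by case: (eqVneq x z) => [->|xz]; [rewrite Rz | have := d5 xz; rewrite RE].
Qed.
(** Summing the degrees of the points along each line counts a point as often as its degree; by
    [sum_line] each of the [w] lines contributes [w + 6]. *)
Let sum2 : \sum_x deg M1 x * deg M1 x = w * (w + 6).
Proof.
rewrite -sum_nat_const.
transitivity (\sum_x \sum_(a in M1) (x \in a) * deg M1 x).
  apply: eq_bigr => x _; rewrite -big_distrl /=; congr (_ * _).
  rewrite /deg -sum1_card big_mkcond [RHS]big_mkcond; apply: eq_bigr => a _.
  by rewrite inE; case: (a \in M1); case: (x \in a).
rewrite exchange_big; apply: eq_bigr => a aM1 /=; rewrite -(sum_line HM1 aM1).
rewrite [RHS]big_mkcond; apply: eq_bigr => x _; by case: (x \in a); rewrite ?mul1n.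
Qed.
(** The lines through [z] partition the points other than [z], and [z] contributes nothing. *)
Let sum2' : \sum_(l in pencil M z) \sum_(x in l) deg M1 x * deg M1 x = w * (w + 6).
Proof.
rewrite -sum2 (exchange_big_dep predT) //=; apply: eq_bigr => x _.
rewrite sum_nat_cond_const; case: (eqVneq x z) => [->|xz]; first by rewrite Rz !muln0.
by rewrite -[RHS]mul1n -[X in _ = X * _](degP xz).
Qed.
(** Each line of [M1] meets [l] exactly once. *)
Let suml l : l \in pencil M z -> \sum_(x in l) deg M1 x = w.
Proof.
move=> lP; have lM : l \in M by move: lP; rewrite inE => /andP [].
rewrite sum_deg (eq_bigr (fun=> 1)) ?sum1_card // => a /setDP [aM aP].
by apply: (proj2 HM) => //; apply/eqP => e; rewrite -e lP in aP.
Qed.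
Let cnt (l : line) j := \sum_(x in l) (deg M1 x == j).
Let perline l : l \in pencil M z -> cnt l 4 <= 2 ->
  7 * \sum_(x in l) deg M1 x * deg M1 x < w * (w + 6).
Proof.
move=> lP c4; have [lM zl] : l \in M /\ z \in l by move: lP; rewrite inE => /andP [].
have e1 : \sum_(x in l) deg M1 x = cnt l 1 + 2 * cnt l 2 + 3 * cnt l 3 + 4 * cnt l 4.
  rewrite /cnt !big_distrr -!big_split /=; apply: eq_bigr => x _.
  by have := R4' x; case: (deg M1 x) => [|[|[|[|[|]]]]].
have e2 : \sum_(x in l) deg M1 x * deg M1 x = cnt l 1 + 4 * cnt l 2 + 9 * cnt l 3 + 16 * cnt l 4.
  rewrite /cnt !big_distrr -!big_split /=; apply: eq_bigr => x _.
  by have := R4' x; case: (deg M1 x) => [|[|[|[|[|]]]]].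
have e0 : 7 = cnt l 0 + cnt l 1 + cnt l 2 + cnt l 3 + cnt l 4.
  rewrite /cnt -!big_split /= -[LHS](proj1 HM _ lM) -sum1_card; apply: eq_bigr => x _.
  by have := R4' x; case: (deg M1 x) => [|[|[|[|[|]]]]].
(* The value 0 at [z] leaves six points of [l]; with at most two values 4 their sum [w] is at most 2
   * 4 + 4 * 3 = 20. *)
have c0 : 1 <= cnt l 0 by rewrite /cnt (bigD1 z) //= Rz.
have w18 : 18 <= w by move: c25; rewrite wE; move: (w) => n; clear => h; ssrlia.
rewrite suml // in e1; rewrite e2; move: c4 e1 e0 c0 w18.
move: (w) (cnt l 0) (cnt l 1) (cnt l 2) (cnt l 3) (cnt l 4) => v a b c d e.
clear; move=> h1 h2 h3 h4 h5.
(* At most two values are 4, so the sum of the squares is at most 3 * v + 8.  For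
   v = 18 this misses the bound by one, but then the values other than 4 cannot
   all be multiples of 3. *)
have [v18|[v19|v20]] : v = 18 \/ v = 19 \/ v = 20 by ssrlia.
- by rewrite v18 in h2 *; ssrlia.
- by rewrite v19 in h2 *; ssrlia.
- by rewrite v20 in h2 *; ssrlia.
Qed.

(** By [perline] the seven lines through [z] cannot all have at most two points of degree 4 in [M1]:
    each would then fall short of a seventh of the sum of squares. A line with three such points, of
    degree 5 in [M], serves as [l0]. *)
Lemma found_one_deg7 : found M.
Proof.
have [l0 /andP [lP c4]|no] := pickP (fun l => (l \in pencil M z) && (2 < cnt l 4)); last first.
  (* The seven strict inequalities add up to [7 * (w * (w + 6)) + 7] being at most
     [7 * (w * (w + 6))]. *)
  have : \sum_(l in pencil M z) (7 * \sum_(x in l) deg M1 x * deg M1 x).+1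
     <= \sum_(l in pencil M z) w * (w + 6).
    apply: leq_sum => l lP; apply: perline => //; rewrite leqNgt; apply/negP => h.
    by have := no l; rewrite lP h.
  under eq_bigr do rewrite -addn1.
  rewrite big_split /= -big_distrr /= sum2' !sum_nat_const -/(deg M z) d7.
  by move: (w * _) => n; clear; ssrlia.
have [l0M z0] : l0 \in M /\ z \in l0 by move: lP; rewrite inE => /andP [].
pose Q := [set x in l0 | deg M1 x == 4].
have Q3 : 3 <= #|Q|.
  suff <- : cnt l0 4 = #|Q| by [].
  rewrite /cnt -sum1_card [RHS]big_mkcond [LHS]big_mkcond; apply: eq_bigr => x _.
  by rewrite inE; case: (x \in l0); case: eqP.
have [p [pQ pI]] := pick_points Q3.
have pl g : g < 3 -> p g \in l0 by move=> /pQ; rewrite inE => /andP [].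
have pz g : g < 3 -> p g != z.
  by move=> /pQ; rewrite inE => /andP [_]; apply: contraTneq => ->; rewrite Rz.
have sr g : g < 3 -> size (rest M l0 (p g)) = 4.
  move=> g3; apply: succn_inj; rewrite size_rest ?pl // RE ?pz //.
  by have := pQ g g3; rewrite inE => /andP [_ /eqP ->].
have srz : size (rest M l0 z) = 6 by apply: succn_inj; rewrite size_rest.
have HN : net M l0 p (fun g => rest M l0 (p g)).
  by apply: rest_net => // g g3; [exact: enum_uniq|move=> m].
pose O := other_lines M l0 p :\: pencil M z.
(* Besides [l0] and the twelve lines of the seed there are at least twelve lines, of which at most
   six pass through [z]. *)
have O6 : 6 <= #|O|.
  have := card_other_lines HM l0M pl pI; rewrite !sr //.
  rewrite -(cardsID (pencil M z) (other_lines M l0 p)) -/O.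
  have : #|other_lines M l0 p :&: pencil M z| <= size (rest M l0 z).
    rewrite -cardE; apply: subset_leq_card; apply/subsetP => a /setIP [/other_linesP [aM al _]].
    by rewrite !inE => /andP [_ ->]; rewrite al aM.
  by rewrite srz; move: c25; move: #|M| #|O| #|_ :&: _| => a b c; clear => h1 h2 h3; ssrlia.
(* The six lines through [z] form the class of six handled by [exact_cover]; six more lines complete
   the twelve. *)
pose os := rest M l0 z ++ take 6 (enum O).
have osP m : m \in take 6 (enum O) -> m \in other_lines M l0 p /\ z \notin m.
  move/mem_take; rewrite mem_enum in_setD => /andP [mz mo]; split=> //.
  by have [mM _ _] := other_linesP mo; move: mz; rewrite inE mM.
have ho : others M l0 p os.
  apply: other_lines_others.
    rewrite cat_uniq take_uniq ?enum_uniq //= andbT; apply/hasPn => m /osP [_ zm].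
    by apply/negP => /rest_mem [_ _]; rewrite (negPf zm).
  move=> m; rewrite mem_cat => /orP [|/osP [] //]; case/rest_mem => mM ml zm.
  rewrite inE mM ml; apply/forallP => g; apply/negP => pm.
  by have := pz g (ltn_ord g); rewrite (meet_eq HM mM l0M ml pm (pl g (ltn_ord g)) zm z0) eqxx.
apply: (found_triple5 HR4 HC4 HN) ho _ _; rewrite ?sr //.
  by rewrite size_cat srz size_takel // -cardE.
right; exists z => //; rewrite count_cat.
have -> : count (fun m : line => z \in m) (take 6 (enum O)) = 0.
  apply/eqP; rewrite eqn0Ngt -has_count; apply/hasPn => m /osP [] //.
rewrite addn0 -[RHS]srz; apply/eqP; rewrite -all_count; apply/allP => m; by case/rest_mem.
Qed.
End B2.
End Case4.

(** * Classification *)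

(* The hints merge equivalent arrays.  They were found by computer and need no
   justification: an invalid hint leaves the array unchanged. *)
Definition hints62 : seq N := [::
15150461046; 15150461046; 14848123686; 14495396766; 15100071486; 15100071486; 
14445007206; 14747344566; 14747344566; 15150461046; 14848123686; 14281707706; 
15150461046; 14848123686; 14495396766; 14644465881; 15100071486; 14445007206; 
14747344566; 15006990771; 13979370346; 14134271586; 14083882026; 15142062786; 
15142062786; 14688556746; 15067411586; 14839725426; 14839725426; 14704886696; 
15041283666; 14025094206; 14039791161; 14125873326; 14327431566; 15127599116; 
15083274966; 15083274966; 14478600246; 14402549336; 14478600246; 15032885406; 
14016695946; 14067085506; 14099978691; 14319033306; 14825261756; 14722149786; 
14722149786; 14462736866; 14419812426; 14671760226; 14419812426; 15149061336; 
14846723976; 13626643426; 13771746696; 13721357136; 13662569316; 13687064241; 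
13763348436; 13654171056; 13704560616; 13747251771; 15149061336; 15149061336; 
14846723976; 14231318146; 15149061336; 14846723976; 14267244036; 15137630371; 
15073476996; 15073476996; 14258845776; 14835293011; 14712351816; 14712351816; 
14493997056; 15098671776; 15098671776; 14493997056; 14594076321; 15098671776; 
15132264816; 15132264816; 14628369216; 15077442841; 14472768121; 14410014456; 
14611572696; 14410014456; 14443607496; 14745944856; 14745944856; 14443607496; 
14745944856; 14956601211; 14829927456; 14829927456; 14714917951; 14981096136; 
14468802276; 14412580591; 14468802276; 14972697876; 13576253866; 13602381786; 
13593983526; 15139263366; 13770346986; 13694762646; 13757283026; 14836926006; 
13719957426; 13697095496; 13753550466; 13878591226; 13904719146; 13896320886; 
15139263366; 15147428341; 14845090981; 15139263366; 15139263366; 14652164286; 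
14652164286; 14836926006; 14836926006; 15013289466; 15013289466; 14131472166; 
15130865106; 14120041201; 14047489566; 14131472166; 15130865106; 14601774726; 
14047489566; 15038484246; 15038484246; 14604107576; 15038484246; 14626969506; 
15027053281; 14081082606; 14828527746; 14106277386; 14059853671; 14081082606; 
14828527746; 14106277386; 14962899906; 14685757326; 14685757326; 14685757326; 
14966632466; 14664528391; 14979696426; 13584185556; 13586285121; 13600982076; 
13634575116; 13767080996; 15079075836; 13760549016; 13659769896; 13646705936; 
14474401116; 13752150756; 13886522916; 13888622481; 13903319436; 14492364061; 
15079075836; 15097038781; 14289639396; 14289639396; 15079075836; 15079075836; 
14474401116; 15011889756; 14474401116; 15011889756; 14129839171; 13987302036; 
14121674196; 15070677576; 14239249836; 13987302036; 14121674196; 15070677576; 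
14251380656; 14264444616; 15028686276; 15036851251; 15028686276; 15028686276; 
14466002856; 14104877676; 14020895076; 14009464111; 14466002856; 14104877676; 
14020895076; 14961500196; 14323232436; 14311801471; 14323232436; 14969898456; 
14323232436; 14976430436; 13582785846; 13591184106; 13596083091; 13633175406; 
13716691436; 13700361486; 14716550946; 13656503906; 13649971926; 13691963226; 
14414213586; 13885123206; 13893521466; 13898420451; 14441974501; 14744311861; 
14716550946; 14288239686; 14288239686; 14716550946; 14716550946; 14649364866; 
14414213586; 14649364866; 14414213586; 14079449611; 13985902326; 14708152686; 
14061486666; 14237850126; 13985902326; 14708152686; 14061486666; 14254646646; 
14261178626; 14684124331; 14666161386; 14666161386; 14666161386; 14044690146; 
14405815326; 14019262081; 14011097106; 14044690146; 14405815326; 14598975306; 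
14011097106; 14321599441; 14313434466; 14607373566; 14313434466; 14623703516; 
14313434466]%num.
Definition hints63 : seq N := [::
171878789238; 171878789238; 171223724958; 171475672758; 171876922958; 
171878789238; 171878789238; 170582891063; 84777380803; 171221858678; 
170584757343; 84112297153; 171223724958; 171223724958; 171473806478; 
171475672758; 171475672758; 84354209383; 170581724638; 171875756533; 
169929693063; 19188373458; 106463342358; 171472640053; 171876922958; 
105628881913; 106463342358; 106463342358; 106028965688; 171878789238; 
29921591478; 105628881913; 84795568938; 170179774583; 105530435643; 
83737429758; 171878789238; 105038904148; 104753130023; 170181640863; 
171220692253; 105748090548; 171875756533; 19430286318; 169926660358; 
84130485288; 170181640863; 105096058973; 170584757343; 18372147138; 
104815183833; 105411227008; 171223724958; 105971810863; 171221858678; 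
171223724958; 105971810863; 105748090548; 30264521058; 105748090548; 
106401288548; 171472640053; 169927826783; 18765205908; 171220692253; 
106091019498; 171473806478; 106344133723; 29549291928; 105686036738; 
106344133723; 106091019498; 171475672758; 106091019498; 170178608158; 
84372397518; 104695975198; 171475672758; 169929693063; 105468381833; 
105158112783; 18412489068; 106272748513; 575061289079; 29981779098; 
498600272049; 106271582088; 30356669173; 106498335108; 17936837303; 
576730209969; 84285384158; 576355320974; 104977550193; 104721869833; 
17503168228; 28932229673; 84805600008; 29123989943; 29430067633; 
105836505563; 105893660388; 30357835598; 18797145943; 104602661198; 
106463342358; 30310477483; 105602987278; 28497199798; 19172036198; 
83787825978; 106463342358; 106028265833; 19244595393; 28497199798; 
105602987278; 19389921168; 500269186459; 105530435643; 83850307663; 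
30238626963; 575921644159; 83511614553; 499834117704; 29357508438; 
18023376518; 105096758828; 28688921188; 29863736708; 105966212023; 
575496365604; 105096758828; 29357508438; 83777794908; 105411227008; 
19379890098; 30238626963; 29863736708; 84371923163; 29430067633; 
105530435643; 83946691048; 29272127208; 83136724478; 29982945343; 
499408838939; 105839071698; 83064166363; 29549268708; 498975162304; 
106345300148; 18362116068; 574988737444; 106344133723; 28615242008; 
28932229673; 106028265833; 17648494003; 500341699214; 104721869833; 
29876801928; 28616408433; 171878789238; 171878789238; 171878789238; 
171878789238; 160684133473; 160684133473; 106523529888; 641358319974; 
171878789238; 641358086689; 641945964889; 29729831178; 641946198174; 
160289181258; 160289181258; 160289181258; 171450244693; 171450244693; 
171450244693; 171450244693; 171878555953; 171878555953; 171878555953; 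
171878555953; 160683900198; 160683900198; 170862599778; 170862599778; 
170862599778; 170862599778; 160877297773; 160877297773; 641752804909; 
160683900198; 641753038194; 29921596608; 105505940718; 170862599778; 
640929775429; 640930008714; 171055759758; 641358319974; 105899259228; 
641358086689; 641945964889; 160877064498; 641946198174; 30314910798; 
170862366493; 170862366493; 170862366493; 170862366493; 160877064498; 
160877064498; 171055759758; 171055759758; 159861134233; 171055759758; 
171055759758; 159861134233; 160289414533; 160289414533; 171450477978; 
171450477978; 171450477978; 171450477978; 641752804909; 29297351868; 
641753038194; 159860900958; 171450477978; 106091019498; 640929775429; 
640930008714; 171055526473; 171055526473; 159860900958; 171055526473; 
171055526473; 159860900958; 171878789238; 160692313218; 160994637618; 
171576451878; 171878789238; 171878789238; 169898899443; 160171841413; 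
171055526473; 159317318828; 160994637618; 160994637618; 171576451878; 
171576451878; 160163443513; 169907297703; 159325716728; 171047128213; 
160692313218; 160692313218; 160986239718; 171568053618; 171870390978; 
160683915318; 170753189113; 159317552103; 160986239718; 160986239718; 
171870390978; 171870390978; 169899132728; 159869517013; 159325950003; 
170744790853; 160683915318; 160683915318; 171568053618; 171568053618; 
159861119113; 169907530988; 170201236803; 160171608138; 171055759758; 
171878555953; 160994870893; 160171608138; 171055759758; 159014994428; 
160986472993; 159869283738; 170753422398; 159015227703; 170201470088; 
159869283738; 170753422398; 171870157693; 171055759758; 160171608138; 
159869283738; 170753422398; 160163210238; 170209635063; 171576218593; 
171047361498; 160163210238; 160692546493; 159023392328; 171047361498; 
159860885838; 160684148593; 159023625603; 170745024138; 159860885838; 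
170209868348; 171567820333; 170745024138; 160163210238; 171047361498; 
170745024138; 159860885838]%num.
Definition hints42 : seq N := [::
320740; 320740; 308404; 119476; 317656; 317656; 103396; 91096; 302236; 
320740; 320740; 1369316; 320740; 320740; 320740; 320740; 320740; 1151972; 
320740; 316114; 100321; 100273; 320740; 1368545; 316114; 1139636; 320740; 
317656; 119524; 319969; 319969; 1148897; 319969; 317656; 317656; 317656; 
317656; 1151864; 317656; 1366232; 317656; 1139672; 317656; 84850; 317656; 
313030; 103396; 103348; 91060; 313801; 91096; 313801; 313801; 91036; 1361606; 
103288; 91000; 103276; 1362377; 1369316; 313030; 1369316; 319969; 1366232; 
313801; 1362377; 313801; 313801; 72502; 316114; 1366232; 313030; 75577; 
320740; 320740; 308452; 308452; 320692; 308404; 320740; 320740; 320740; 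
320692; 320740; 320692; 320692; 320740; 308452; 308452; 308404; 308452; 
308404; 308404; 308452; 1368545; 1368497; 1168100; 1356257; 320740; 320740; 
1356209; 308452; 308452; 1151972; 320692; 308404; 319969; 319969; 319921; 
319969; 319921; 319921; 119524; 320740; 320740; 320692; 307681; 320692; 
307633; 320740; 1369316; 320740; 119512; 1357028; 320740; 320740; 320692; 
320692; 320740; 119452; 320692; 320692; 307681; 307681; 307633; 307681; 
307633; 307633; 103396; 308452; 308452; 308404; 319969; 308404; 319921; 
308452; 1369268; 308452; 103384; 1356980; 308452; 308452; 308404; 308404; 
308452; 103324; 308404; 308404; 1369316; 1369268; 1369316; 1357028; 319969; 
319969; 1356980; 307681; 307681; 1357028; 319921; 307633; 1356257; 319969; 
319969; 1368545; 319969; 116425; 319921; 319921; 319969; 319921; 116365; 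
319921; 1356209; 307681; 307681; 1368497; 307681; 100297; 307633; 307633; 
307681; 307633; 100237; 307633; 1369316; 1369316; 1369268; 1357028; 1368545; 
1368497; 1357028; 1356257; 320740; 1356980; 1356209; 308452]%num.
Definition hints43 : seq N := [::
2417892; 2417892; 2417892; 2220504; 2417892; 2417892; 2220504; 2220504; 
2220504; 2410953; 2213601; 2213601; 2413266; 2413266; 2410953; 2410953; 
2410953; 2218182; 2218182; 2417892; 2417892; 2417892; 2417892; 2169798; 
2417892; 2417892; 5821138; 1628376; 5818825; 4841782; 2169798; 2417892; 
2417892; 2417892; 2169798; 600018; 4839469; 2169798; 2169798; 2169798; 
2169798; 2169798; 2169798; 2417892; 2417892; 2417892; 2417892; 2417892; 
2417892; 2417892; 2417892; 2208228; 2208228; 2208228; 2208228; 2208228; 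
2208228; 2208228; 2208228; 2417121; 2417121; 2417121; 2417121; 2208993; 
2208993; 2208993; 2208993; 2417892; 1628376; 2208945; 2417892; 629901; 
2208945; 5822680; 6611425; 2417892; 6403249; 2208180; 2417121; 2417121; 
1624521; 2208180; 626076; 4824205; 6612196; 6402484; 2208180; 6612196; 
5818825; 6402484; 2417121; 6403249; 2208945; 4820380; 6611425; 2417892; 
1628376; 4625353; 604524; 2417892; 1628376; 2417892; 1628376; 604524; 
4625209; 444012; 1210482; 599922; 599922; 427992; 1217460; 2417892; 1205208; 
2169678; 1194438; 2417892; 4623670; 433266; 427896; 1623750; 5384137; 420894; 
5818825; 5388598; 1626834; 1623750; 2417892; 1233636; 2417892; 1630689; 
444060; 604572; 5404882; 5404786; 5818825; 4616761; 5399416; 4824121; 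
1217508; 433329; 2172849; 1624521; 2172849; 1193673; 601524; 401073; 4829479; 
2417892; 5825764; 2172849; 5384137; 4599118; 5818825; 4599070; 4601419; 
4824121; 1233636; 2417892; 1630689; 448689; 2417892; 1628376; 6604486; 
4641337; 604596; 400305; 5821138; 5818825; 2417892; 4829494; 2417892; 
1217508; 427932; 424077; 4824109; 2417892; 2417892; 4616749; 5381062; 
2417892; 423981; 597645; 597645; 6604486; 4597534; 2417892; 2417892; 2405556; 
2405556; 2417892; 2417892; 2417892; 2417892; 2417892; 2417892; 2417892; 
2417892; 2417121; 2417121; 2417121; 2417121; 6612196; 6612196; 6611425; 
6611425; 2417121; 2417121; 2417121; 2417121; 6612196; 6612196; 6611425; 
6611425; 2417892; 2220516; 2417892; 2220516; 2417844; 2220468; 2405604; 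
2208228; 2405604; 2208228; 2405556; 2208180; 2221281; 2417121; 2221233; 
2417073; 2208993; 2404833; 2208945; 2404785; 2417892; 2405604; 2417892; 
2417892; 5825716; 2417892; 2417892; 2417892; 2417892; 2417892; 2417892; 
2417892; 2417892; 2417892; 2417892; 6611425; 2417892; 2417892; 2417892; 
6611425; 6611425; 2417892; 2417892; 6611425; 2417892; 6611425; 2417892; 
6611425; 6611425; 2417892; 6611425; 1631460; 1631412; 1631412; 1618401; 
2417892; 2417892; 1630641; 2417892; 2417892; 2417892; 2417892; 2417892; 
2417892; 2417892; 2417892; 2417892; 2417892; 2417892; 1618353; 2417892; 
2417892; 2417892; 2417892; 2417892; 2417892; 2417892; 2417892; 2417892; 
5813476; 2417892; 2417892; 2417892; 2417892; 2417892; 2417892; 2417892; 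
1630689; 2417892; 1630689; 1630641; 2417892; 2417892; 2417892; 2417892; 
2417892; 2417892; 6599089; 6611425; 2417892; 2417892; 2405556; 1618401; 
1618353; 1618353; 2405556; 2405556; 2405556; 2405556; 2405556; 2405556; 
6599089; 2405556; 6611425; 2405556; 5825764; 5813428; 2417892; 6599089; 
6611425; 2417892; 6599089; 6599089; 2405556; 6611425; 6611425; 2417892; 
2417844; 2417892; 2417844; 2417892; 2417892; 2417844; 2417844; 2213553; 
2213601; 2417892; 2417892; 2417844; 2417892; 2417844; 2417844; 2213601; 
2213601; 2213553; 2213553; 2213553; 2213553; 2213601; 2213553; 2213601; 
2213601; 2417892; 2417892; 2213601; 2417844; 2417844; 2213553; 2417892; 
2417892; 1631412; 1618353; 2417892; 1631412; 1631412; 5812705; 1631460; 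
5812657; 1631412; 2417892; 2417892; 1618353; 1618353; 2417892; 2417892; 
2417892; 2417892; 2417892; 2417892; 2417892; 5825764; 5825716; 5813476; 
1618353; 5813428; 1618401; 2417892; 2417892; 2417892; 2417892; 1631460; 
2417892; 5824945; 1631412; 1631460; 2417892; 1631460; 1631412; 6611425; 
5824945; 2417892; 1619172; 1619124; 1619124; 5824993; 5812705; 5812657; 
1631412; 2417892; 1618401; 1618353; 1618353; 2417892; 1619172; 1619124; 
1630641; 5825716; 1619172; 1619124; 2417892; 5813476; 5813428; 1630641; 
5812705; 2417892; 5812705; 5812657; 5825716; 2417892; 5812657; 1631460; 
2417892; 5825716; 1631412; 2417892; 1631460; 1631412; 2417892; 1619172; 
1619124; 1619124; 5812705; 5812657; 1631412; 6612196; 5825716; 6612196; 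
1618401; 5813428; 1618353; 2417892; 1630689; 1619124; 1630641; 5813428; 
2417892; 2417892; 2417892; 5825764; 5813476; 5813428; 5825716; 5824993; 
6612196; 2417892; 5824945; 6612196; 6612196; 2417892; 2417892; 2417892; 
2417892; 2417892; 2417892; 2417892; 2213592; 2213592; 2417892; 2417892; 
2213592; 2213592; 2213592; 2213592; 1619124; 2417892; 2417892; 2417892; 
2417892; 2417892; 2417892; 2213592; 2213592; 2213592; 2213592; 1217436; 
2417892; 400236; 2417892; 6611425; 2417892; 1618353; 2417892; 2417892; 
6410953; 2417892; 6611425; 2213592; 2213592; 6410953; 2417892; 5408653; 
2417892; 2213592; 604530; 2213592; 4606765; 2213592; 2417892; 2417892; 
2417892; 2417892; 2417892; 2417892; 2417892; 2417892; 2417892; 2417892; 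
2417892; 2417892; 6611425; 2417892; 2417892; 2417892; 6611425; 2417892; 
2417892; 6611425; 2417892; 6611425; 6611425; 1217436; 2417892; 2417892; 
6611425; 6611425; 2417892; 2417892; 2417892; 6611425; 2417892; 6611425; 
2417892; 6611425; 6611425; 6611425; 6611425; 2417892; 5408653; 2417892; 
6611425; 6611425; 6611425; 6611425; 2417892; 2417892; 2417844; 2417892; 
2417844; 2417892; 2417892; 2417844; 2417892; 2417844; 2417844; 2182836; 
2182884; 2182884; 2182836; 2182884; 2182836; 2182836; 2182836; 2182884; 
2182884; 2404833; 2404833; 2404785; 2404785; 2404785; 2404833; 2169777; 
2169777; 2169825; 2169777; 2169825; 2169825; 2417892; 2417892; 2417892; 
2417844; 2182836; 2404833; 2182884; 2182884; 2182884; 2417844; 2169825; 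
2182836; 2417892; 2417892; 2417892; 2417892; 2417892; 2417892; 2417892; 
2417892; 2417892; 2417892; 2417892; 2417892; 2417892; 2417892; 5411812; 
1631412; 1619124; 2182872; 2182872; 2182872; 2182872; 2182872; 2182872; 
2182872; 2182872; 2182872; 2182872; 2182872; 2182872; 2182872; 2182872; 
609912; 597624; 4612942; 2417892; 2417892; 2417892; 2182872; 5813476; 
1630641; 1618353; 2417892; 2182872; 2417892; 2417892; 1630641; 5408713; 
4839502; 2182872; 2182872; 2417892; 2182872; 2182872; 2182872; 1618353; 
5408653; 4814926; 5825764; 609138; 4606819; 5813476; 596850; 4606759; 609138; 
596850; 4814926; 2417892; 2417892; 2405556; 1631460; 2417892; 2417892; 
2417892; 2417892; 1230561; 2405556; 2405556; 2405556; 2405556; 1214385; 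
2181963; 5427940; 2182734; 2182734; 1619172; 5411764; 1631412; 2417121; 
2417121; 2417121; 2417121; 1233636; 2417892; 2417892; 2417892; 2417892; 
2404785; 2404785; 1199844; 2182734; 1233624; 2181963; 407922; 2182734; 
2170398; 4618318; 1233564; 1230492; 2404785; 2404785; 2404785; 2404785; 
1217460; 2405556; 2417121; 2405556; 2417121; 2405556; 2405556; 1199028; 
2182734; 2181963; 1217496; 2181963; 2169627; 1214424; 1217436; 404835; 
4615243; 2169627; 5424865; 2170398; 2170398; 1618401; 5408689; 1630641; 
2169627; 423990; 2170398; 1230537; 2182734; 2170398; 4602142; 1233549; 
1230477; 2169627; 2181963; 1217481; 2170398; 2169627; 1214409; 420903; 
1214349; 4599067; 451662; 424014; 439371; 407838; 420939; 404763; 609870]%num.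
Definition hints44 : seq N := [::
72043318; 43818200; 40660124; 43803617; 72031789; 36120440; 38695544; 
76408033; 40054046; 38721746; 40052681; 52305636; 68897734; 41054840; 
68898361; 72031111; 40056377; 72031789; 52311768; 72034093; 41054936; 
52121223; 40056365; 55286823; 72035623; 42415832; 42452696; 45199796; 
45212084; 43833452; 43833452; 42452696; 45212084; 43808876; 54125667; 
15000804; 68897761; 76407268; 76407268; 76762732; 38505926; 76762066; 
72044146; 72044086; 42452696; 45212132; 42415832; 45404897; 55298379; 
73616248; 72278488; 42840548; 42408932; 35331725; 35331785; 36562145; 
52156614; 70677193; 53921400; 40093364; 53290929; 40663148; 41083211; 
88846649; 2575143; 40687772; 55463652; 68886196; 68898424; 52918302; 
72044260; 72031852; 56847438; 68885356; 52899147; 76394932; 59630004; 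
36125006; 75964051; 59186763; 35330972; 42408812; 36129581; 43207565; 
43224530; 69684196; 43223000; 73604038; 38504393; 43807457; 69121234; 
38476772; 43824344; 40050221; 43196105; 52137243; 45212132; 52925262; 
45404897; 72031879; 45212132; 56845134; 45404897; 52304865; 52923726; 
69684196; 68886061; 55297611; 38712518; 72044089; 42452636; 45199844; 
42415772; 69678622; 69105778; 43833464; 70889926; 45212132; 43808888; 
15000804; 30559090; 52137246; 52146462; 69684961; 76407865; 40094162; 
76749703; 38712518; 40687832; 52304817; 72043378; 52146459; 68898424; 
45406364; 73616338; 56847438; 68893075; 70701769; 69679459; 40687772; 
40094051; 40687724; 41071049; 61982385; 38711609; 9248397; 52128966; 
70703134; 45199796; 54082020; 45199844; 70889782; 43202843; 15000804; 
45199844; 45406364; 68893027; 52128966; 52317138; 35551346; 36549044; 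
54124980; 85675718; 35575922; 37347812; 15000804; 56829753; 72038695; 
57822840; 90381878; 11855076; 41083337; 91808984; 58254516; 38711609; 
40661729; 68886163; 68885293; 76395697; 59630004; 75975469; 41054936; 
59972382; 15000804; 15000804; 15000804; 15000804; 15000804; 31778020; 
15000804; 31778020; 31778020; 15000804; 35331764; 38477468; 35331800; 
38677901; 35532233; 69086644; 52355367; 69086584; 52351527; 72232372; 
55501095; 72232312; 55497255; 52137243; 52121115; 52141083; 52309287; 
52128795; 52305447; 55483431; 55266843; 55479591; 55455015; 55274523; 
55451175; 55501095; 52343079; 69086572; 52115739; 72232420; 72232408; 
72031942; 52337703; 52333863; 52152603; 52325415; 52156443; 52309287; 
55483431; 55479591; 55277595; 55261467; 15000804; 55300638; 72031033; 
11855076; 88855085; 11855076; 40077272; 38479673; 73616344; 40052681; 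
72031117; 55479606; 72031021; 89055533; 24700084; 85903661; 41037257; 
74244529; 73616284; 41037257; 15000804; 72031096; 55260702; 11855076; 
85684766; 36117464; 11855076; 35330873; 36549857; 73604041; 15000804; 
72235384; 55256862; 36549857; 11855076; 85680926; 28631521; 35535161; 
56826654; 15000804; 15000804; 72235339; 72235291; 11855076; 88808246; 
73604743; 52120350; 11855076; 68885278; 73603981; 56838990; 74233012; 
73603870; 15000804; 68893003; 14201313; 72037918; 69088843; 72235294; 
35338571; 35337806; 14213553; 68892238; 14988468; 72038683; 69089614; 
72234523; 35534411; 35535182; 38483486; 38484251; 38680862; 38680091; 
15000804; 15000804; 52343883; 15000804; 15000804; 68897677; 11650737; 
15000804; 15000804; 15000804; 15000804; 15000804; 52343115; 15000804; 
52326939; 15000804; 15000804; 15000804; 15000804; 15000804; 52326939; 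
15000804; 15000804; 15000804; 11855076; 11855028; 11650785; 11650737; 
15000804; 11650785; 15000804; 15000804; 15000804; 11855076; 52130334; 
11855028; 11650785; 55474254; 11650737; 15000804; 55474254; 11650785; 
52135755; 52343115; 52343886; 52146510; 11650785; 11650737; 15000804; 
15000804; 52158747; 35331044; 68886136; 52349223; 72031852; 55458087; 
55450407; 52159515; 69086674; 38476772; 68886073; 55474215; 72031789; 
55292955; 52355367; 52351527; 52355367; 52351527; 35535281; 72232312; 
35535329; 72031864; 55455015; 55451175; 52146459; 52130331; 52309287; 
52305447; 55300635; 55479591; 55304475; 72232267; 72031153; 55479606; 
38483657; 55284507; 38676422; 55479606; 11855076; 41035574; 38483513; 
74245300; 52108077; 52326969; 68888398; 15000804; 52326969; 52111149; 
69676435; 69676315; 23913700; 23901364; 68889931; 15000804; 52128807; 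
47765720; 72031885; 55483446; 88852025; 41060324; 55297563; 55483446; 
41472722; 38676422; 38483513; 73604749; 52312359; 52126521; 15000804; 
52126521; 52311597; 53899821; 53901351; 70682425; 40057223; 55451181; 
69085003; 15000804; 55451181; 72031945; 38476724; 68886217; 52351527; 
38681009; 55256859; 55260699; 55260699; 52325415; 68886193; 52317735; 
72031801; 72031789; 72232219; 52326951; 52323111; 52326951; 52323111; 
72031960; 72031900; 72232408; 72232348; 55256859; 52323111; 69086680; 
52111131; 52335399; 52114971; 72031945; 55281435; 55472679; 55468839; 
37105112; 52916763; 35337908; 52343094; 69671827; 52916763; 85713209; 
37103570; 37345481; 55292958; 15000804; 52152606; 38479832; 69684937; 
69684961; 89055545; 15000804; 38479817; 40054214; 38481350; 88856615; 
68885425; 52156446; 38479832; 69671890; 69684193; 88808231; 88852013; 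
15000804; 40077257; 52135707; 52137246; 52147227; 52146462; 38483672; 
69684781; 88855097; 73603975; 41474264; 38676422; 52312359; 68892205; 
52111161; 40672412; 53901351; 41446508; 40056461; 72232222; 40057223; 
80096542; 68885425; 52141086; 52146459; 68885425; 38483672; 52925259; 
38676422; 15000804; 89007911; 41061833; 68888365; 68888350; 15000804; 
52311609; 41446616; 69676315; 41446628; 72034078; 40660184; 52128807; 
15000804; 15000804; 35534513; 10282212; 10282164; 55305246; 35534561; 
72235492; 52159518; 36558905; 35534561; 36559049; 15000804; 52312374; 
68885293; 38476652; 52907547; 15000804; 40677857; 89028662; 31777249; 
15000804; 52146462; 69684937; 38476664; 40061912; 11854305; 40690916; 
15000804; 89053238; 40049609; 15000804; 38476700; 52343094; 52915227; 
40061804; 89044022; 15000804; 15000804; 90385691; 15000804; 52115742; 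
38476760; 40061816; 69684961; 89056310; 15000804; 38476745; 40050374; 
15000804; 15000804; 52351542; 15000804; 52351542; 40062572; 70116553; 
89048630; 15000804; 38681033; 40690904; 68885293; 68885389; 52309302; 
69684013; 69671710; 52915227; 40670177; 41076452; 69672475; 15000804; 
68885305; 52309302; 15000804; 52309302; 69684169; 69672478; 40093400; 
68886046; 41456594; 15000804; 52111131; 52305462; 15000804; 52305462; 
70116409; 69684961; 40093400; 41040329; 55298334; 41039414; 15000804; 
41446628; 53878473; 69715501; 40672364; 70662430; 40056350; 40057163; 
15000804; 41076344; 15000804; 15000804; 72235384; 11855076; 11855076; 
31777249; 35535305; 72235480; 28631521; 35535161; 35535305; 36562145; 
55274526; 72235372; 72235372; 52128798; 55277598; 15000804; 72235420; 
52918302; 11855076; 36161993; 37144289; 36161849; 15000804; 41077208; 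
40093340; 40093292; 40670051; 40093292; 41444210; 41077112; 41077112; 
7123425; 43815779; 47735666; 15000804; 55297566; 55266846; 11855076; 
69671707; 55298331; 55471158; 89007926; 52130334; 55298331; 74232241; 
73604041; 56838987; 15000804; 55305246; 55274526; 38484422; 55272219; 
11855076; 15000804; 55305246; 55277598; 38680262; 52131870; 11855076; 
73617112; 73617052; 7135713; 7135665; 15000804; 52128822; 52128822; 80099614; 
43202891; 15000804; 7123425; 23901364; 72234571; 89012534; 11842740; 
11842740; 35337758; 38680886; 15000804; 28631521; 52108059; 52355382; 
52918299; 52154910; 52108830; 52942923; 69671707; 52918299; 52152603; 
76749643; 55260702; 52918299; 55260702; 52115742; 52152606; 52112670; 
15000804; 52158750; 52112670; 69684913; 69684793; 52151835; 27059380; 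
55261470; 52159515; 52111131; 15000804; 10282212; 7135665; 15000804; 
27058609; 10269924; 55479609; 40057163; 14213553; 52141110; 23901364; 
7123377; 23913652; 10269924; 43831907; 36124190; 27046321; 42852662; 7123377; 
15000804; 7123425; 10282164; 10282212; 10282212; 27058657; 10282164; 7123377; 
7123377; 15000804; 52915254; 57817401; 46544498; 10269924; 23901364; 7123425; 
43202855; 7135665; 15000804; 68885356; 52328502; 35330924; 52906782; 
36549857; 15000804; 85882934; 31778020; 15000804; 52316982; 35330936; 
36117464; 69672664; 36561380; 11854305; 35535314; 36129737; 15000804; 
15000804; 35331032; 35331032; 69089644; 69671890; 70104265; 85910582; 
36562145; 15000804; 15000804; 72031033; 55455030; 40057286; 11855076; 
55261467; 72031033; 41458904; 11855076; 73604041; 73604638; 15000804; 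
35331800; 69089656; 52351542; 52915230; 69684193; 85902902; 35331026; 
36118232; 28631521; 55256859; 55451190; 11855076; 40093385; 55260699; 
55261470; 43818200; 41077193; 40056521; 41040329; 52131870; 69089656; 
69089656; 52326966; 52918302; 36162017; 37107410; 37108088; 76761955; 
37330061; 15000804; 37108184; 36124316; 52912953; 53899830; 86467385; 
87454262; 53294739; 54077283; 15000804; 15000804; 69089683; 52325430; 
52925262; 69671710; 52912926; 70104121; 15000804; 15000804; 55284510; 
15000804; 55272222; 15000804; 15000804; 52151838; 52121118; 15000804; 
52130334; 52325430; 69672658; 69672478; 23913652; 52152603; 52120347; 
15000804; 52131867; 43833560; 15000804; 52159518; 52128798; 15000804; 
52317750; 69684193; 52912923; 52915230; 15000804; 85903673; 38680262; 
52130331; 15000804; 15000804; 69678748; 53890617; 70661707; 15000804; 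
52915254; 52915254; 70662430; 35337806; 43202891; 76389517; 15000804; 
47741036; 55254555; 55253790; 23900641; 55286811; 55254555; 55256862; 
55281438; 55253790; 76762723; 52111134; 56829726; 56829726; 73603918; 
52906809; 52906809; 15000804; 69678622; 70872265; 15000804; 69679387; 
70698673; 85683254; 85877558; 15000804; 70085689; 15000804; 41464952; 
55258398; 55261470; 72031111; 35338697; 47756504; 55260699; 55261470; 
55292955; 55260699; 37345421; 73604038; 56831262; 56831262; 10282212; 
7135665; 15000804; 47756504; 23900593; 10269876; 23900641; 14213553; 
27059380; 7123425; 46758029; 53294802; 70088761; 53294802; 27059428; 
58225377; 58225377; 75019384; 15000804; 69715597; 70662616; 54081123; 
70085689; 70661842; 53901369; 53901369; 88826681; 27059380; 88826681; 
28632292; 85881398; 41477240; 15000804; 7123425; 10282164; 15000804; 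
10282212; 10282164; 23900593; 47768696; 14201265; 7123425; 7123377; 15000804; 
76007719; 80922226; 47367794; 41477240; 27059428; 42850349; 42453287; 
36558893; 15000804; 15000804; 15000804; 15000804; 40660148; 40660088; 
52894542; 43805852; 72232237; 52108827; 88835870; 15000804; 90410315; 
38677940; 35532140; 52925262; 38677880; 52141083; 72232237; 88837403; 
15000804; 90408782; 40660196; 52356135; 40660184; 52156443; 43208333; 
90424907; 15000804; 15000804; 52348455; 38677988; 52154907; 38677976; 
15000804; 15000804; 52138779; 88851995; 11855076; 11855076; 11650776; 
11855076; 11855076; 11650776; 15000804; 52114971; 40062692; 40062644; 
38681012; 38681060; 15000804; 52114971; 40062692; 40062644; 15000804; 
15000804; 31777249; 15000804; 40663220; 40663268; 15000804; 15000804; 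
31777249; 15000804; 15000804; 15000804; 13797276; 15000804; 14202036; 
14796504; 15000804; 15000804; 13797276; 15000804; 14202036; 14796504; 
15000804; 14796504; 11855076; 43207565; 35330894; 11650776; 15000804; 
11855076; 11855076; 11650776; 11650776; 15000804; 28431049; 28631521; 
14796504; 15000804; 14796504; 52138782; 11855076; 11650776; 52894542; 
15000804; 11855076; 11855076; 11650776; 11650776; 28631521; 11855076; 
11650776; 28431049; 15000804; 15000804; 52154907; 52138779; 43808924; 
52942926; 15000804; 52332327; 15000804; 35330993; 52154907; 91001714; 
15000804; 52141086; 15000804; 11855076; 11650776; 90394190; 15000804; 
11855076; 11855076; 38476760; 52942926; 28431049; 11855076; 88851998; 
36129593; 28431049; 15000804; 52108830; 15000804; 11855076; 88821278; 
11650776; 15000804; 11855076; 52114974; 38476664; 75975640; 11650776; 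
15000804; 28631521; 42421049; 43207625; 15000804; 15000804; 52156443; 
35535212; 52108059; 52941390; 15000804; 15000804; 52307751; 89035574; 
72031954; 43207601; 15000804; 15000804; 40660148; 15000804; 40660088; 
40660124; 31777249; 15000804; 15000804; 70085773; 31777249; 15000804; 
15000804; 70088881; 40663220; 69684148; 15000804; 40663220; 15000804; 
31777249; 40061873; 11855076; 11855076; 28631521; 15000804; 15000804; 
15000804; 70088761; 70088905; 28631521; 69086494; 69086674; 38476769; 
40660148; 15000804; 53290866; 40660124; 90408779; 15000804; 15000804; 
15000804; 15000804; 15000804; 15000804; 15000804; 38680946; 15000804; 
15000804; 38681042; 15000804; 15000804; 15000804; 12986220; 15000804; 
12986220; 15000804; 15000804; 15000804; 69086578; 52925262; 69086518; 
15000804; 15000804; 15000804; 15000804; 15000804; 15000804; 15000804; 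
15000804; 11855076; 11855076; 69684184; 11855076; 15000804; 28631521; 
15000804; 15000804; 15000804; 28631521; 15000804; 15000804; 11855076; 
11855076; 11855076; 11855076; 15000804; 31777249; 69089614; 69089566; 
38680910; 28631521; 15000804; 28631521; 38680862; 28631521; 15000804; 
15000804; 52126494; 11855076; 11855076; 11855076; 31777249; 11855076; 
11855076; 28631521; 28631521; 28631521; 11855076; 88811294; 28631521; 
15000804; 70085809; 15000804; 15000804; 52126494; 70085689; 15000804; 
15000804; 15000804; 90393422; 52927563; 52895307; 15000804; 15000804; 
69089650; 15000804; 68885368; 53290851; 28631521; 28631521; 52894539; 
69684946; 40061906; 28631521; 15000804; 15000804; 15000804; 52126491; 
40663196; 11855076; 28631521; 28631521; 69086542; 15000804; 69086578; 
69086662; 15000804; 11855076; 15000804; 11855076; 11855076; 11855076; 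
15000804; 11855076; 11855076; 38681030; 69684178; 28631521; 28631521; 
38680886; 15000804; 28631521; 15000804; 15000804; 52158747; 68886136; 
69086662; 28631521; 15000804; 15000804; 52126491; 90410318; 15000804; 
52941387; 69684916; 69684952; 15000804; 70085833; 28631521; 15000804; 
90394190; 38681042; 15000804; 15000804; 15000804; 55281486; 15000804; 
15000804; 52312395; 15000804; 52349259; 52137291; 52120350; 52349259; 
55253790; 55451166; 69081931; 15000804; 52349259; 52128795; 15000804; 
15000804; 52343115; 52355403; 52126494; 52112715; 15000804; 15000804; 
52121115; 55284558; 55483470; 55483470; 52152651; 52355403; 52355403; 
52353102; 52152651; 15000804; 52120347; 15000804; 15000804; 52323099; 
52115787; 15000804; 11620056; 15000804; 15000804; 15000804; 53326947; 
68885326; 53294691; 53331555; 69089611; 15000804; 76377145; 53331555; 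
76377229; 52895307; 52927563; 52941387; 69684964; 69684952; 53331555; 
70085833; 35534450; 52912971; 53294691; 38680274; 52916811; 15000804; 
15000804; 11620056; 11620056; 15000804; 53339235; 70085857; 52942923; 
52942923; 69684934; 35333963; 52906827; 52894539; 15000804; 52918347; 
53290851; 15000804; 53326947; 69089635; 15000804; 68885356; 53294691; 
38483531; 76377265; 15000804; 52895307; 52927563; 76377229; 52108827; 
52112667; 52897614; 52894542; 52141083; 45183668; 52108827; 52112667; 
52137243; 48329444; 52141083; 48329396; 52154907; 15000804; 52146459; 
52942926; 52942926; 52945998; 52333863; 52317735; 52146459; 52130331; 
15000804; 15000804; 52115739; 52152603; 15000804; 52901454; 70682509; 
52131867; 69086503; 72031798; 72031774; 52152603; 52325415; 15000804; 
15000804; 15000804; 52146459; 52130331; 70898311; 52933710; 15000804; 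
35530706; 52317735; 72031924; 69086563; 69086599; 15000804; 15000804; 
35334008; 52941390; 52941390; 52115739; 52325415; 52309287; 15000804; 
15000804; 52131867; 72031798; 52137243; 52141083; 52121115; 52108827; 
52925262; 52922190; 52137243; 52141083; 52121115; 52108827; 52128795; 
52112667; 15000804; 15000804; 70884553; 15000804; 45388769; 15000804; 
70085773; 15000804; 52927563; 15000804; 15000804; 15000804; 15000804; 
15000804; 15000804; 52894539; 53877639; 15000804; 15000804; 52137291; 
15000804; 52333902; 14796513; 15000804; 15000804; 55455006; 14796513; 
14796513; 15000804; 52112670; 15000804; 35534546; 72031030; 76380337; 
15000804; 52158750; 53339250; 75975604; 53339250; 15000804; 15000804; 
73604038; 35534546; 73604038; 15000804; 52137246; 15000804; 72031156; 
52152606; 76380217; 15000804; 52152606; 53331570; 70088905; 53331570; 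
11855076; 11620056; 35334089; 76749766; 73616356; 52309302; 15000804; 
15000804; 69089671; 52894542; 53294706; 15000804; 72235303; 48522209; 
52897614; 52894542; 11620056; 11855076; 15000804; 45183686; 11620056; 
15000804; 52141086; 15000804; 11855076; 11855076; 53331570; 15000804; 
52147230; 52156446; 38479832; 52942926; 52945998; 76762732; 35334089; 
73617112; 73617124; 15000804; 11855076; 15000804; 52141086; 11855076; 
52927566; 15000804; 11620056; 15000804; 52147230; 11620056; 52933710; 
35530706; 76762732; 35337929; 73617004; 15000804; 52108830; 15000804; 
11855076; 38479691; 11855076; 15000804; 52154910; 52114974; 38479736; 
52941390; 52938318; 76750414; 15000804; 76761976; 73604806; 52333878; 
15000804; 15000804; 69089575; 35337803; 35530610; 15000804; 52333878; 
72235303; 11620056; 75975580; 52922190; 15000804; 76749646; 76761964; 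
15000804; 52120347; 52323099; 52120347; 52323099; 52152651; 52355403; 
52355403; 52152651; 15000804; 15000804; 14765748; 14765748; 15000804; 
15000804; 55254555; 15000804; 93556043; 52141083; 55457319; 40660088; 
94138979; 43805852; 72232237; 72031771; 55489575; 15000804; 43208327; 
1797147; 52121115; 55286859; 52126494; 52121115; 15000804; 15000804; 
55488843; 15000804; 52112715; 14752689; 55497243; 55488843; 55483470; 
5151822; 65329380; 55253787; 15000804; 15000804; 52895310; 41444195; 
43208369; 52356135; 40660184; 94147427; 43208333; 55453479; 15000804; 
42853577; 5131815; 47750300; 15000804; 15000804; 15000804; 15000804; 
15000804; 15000804; 45199844; 40062611; 15000804; 72232222; 88811294; 
15000804; 38476589; 15000804; 15000804; 15000804; 52895310; 15000804; 
15000804; 15000804; 15000804; 40660124; 40062605; 40062665; 15000804; 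
15000804; 28631521; 15000804; 15000804; 15000804; 14988468; 14988468; 
15000804; 15000804; 11855076; 15000804; 11855076; 11855076; 11841969; 
15000804; 52305465; 15000804; 15000804; 48329396; 76380217; 40057163; 
15000804; 72234523; 45183716; 41040326; 45183716; 15000804; 43803617; 
41040326; 48329444; 77363380; 15000804; 15000804; 69088843; 69088795; 
38483534; 35337806; 15000033; 15000033; 72234571; 72234523; 15000804; 
15000804; 38483486; 35337758; 15000033; 15000033; 15000804; 45388721; 
15000804; 15000804; 45199796; 15000804; 43805912; 12983118; 45199796; 
38476571; 48345572; 12983118; 38680862; 38680862; 45199796; 15000804; 
72034126; 15000804; 72234616; 69676435; 48325604; 31542862; 55472697; 
15000804; 55472697; 46545362; 48526034; 42822713; 11607582; 36531257; 
98883704; 15000804; 55463469; 15000804; 72230776; 55457325; 43199819; 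
15000804; 52126521; 85680941; 70659538; 43808924; 35333918; 11606811; 
35333933; 36534449; 40054151; 15000804; 15000804; 55284507; 52927566; 
41035619; 52348455; 38677988; 52154907; 38677976; 57854349; 36117302; 
35331725; 55478055; 46565330; 47765660; 15000804; 72034078; 15000804; 
55457337; 69676315; 47737964; 68888365; 45376481; 15000804; 55272237; 
41446616; 48522194; 47738084; 45376481; 15000804; 95537528; 15000804; 
15000804; 72234616; 52111149; 15000804; 76380217; 31777249; 52326969; 
68888398; 88826669; 43808888; 38479646; 11607582; 35534393; 31777249; 
15000804; 15000804; 52126491; 52927566; 15000804; 31777249; 15000804; 
68886136; 31777249; 15000804; 35331629; 88811291; 38477369; 45212084; 
15000804; 15000804; 15000804; 15000804; 15000804; 30979252; 15000804; 
31777249; 30979252; 14201265; 14201265; 14201265; 48357860; 15000804; 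
15000804; 55481163; 15000804; 15000804; 52151883; 55293003; 52151883; 
52158798; 14987697; 14987697; 55489614; 55481163; 15000804; 15000804; 
15000804; 15000804; 52128795; 15000804; 15000804; 15000804; 15000804; 
52326939; 15000804; 15000804; 15000804; 15000804; 15000804; 15000804; 
15000804; 14803428; 15000804; 14803428; 14791092; 14988468; 14988468; 
14791092; 14804193; 15000033; 14791857; 14987697; 15000804]%num.
(* For each completed seed: its index in the list of seeds, the index of the
   plane, and the base 43 digits of a permutation carrying the plane to it. *)
Definition leaves4 : seq (nat * (nat * N)) := [::
(280, (2, 10260842788736462359817266225573077521726281781509408165280705771964903%num));
(280, (2, 10260842788736462359817266225641738721744783819502835121831801195806903%num));
(280, (2, 10260842788736462359817266225710399921763285857496262078382890445294297%num));
(281, (3, 14443266381578162353033167741483381767757249097536015818790934223107983%num));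
(281, (0, 7256199409974245801273904485401240166795581998625630260967029112646925%num));
(281, (1, 7254018840387935024793765467484588021718067030617071263091129711921207%num));
(281, (0, 7256199409974245801273904485401240166795576124222523900547016554456331%num));
(281, (1, 7254018840387935024793765467484588021718061156213964902671117153730613%num));
(281, (0, 7256199409974245801273904485401240166795570249819417540126997821911131%num));
(281, (1, 7254018840387935024793765467484588021718055281810858542251098421185413%num));
(364, (1, 477235638781167616337609433095024718371135200935993154372211213553999%num));
(364, (1, 3253734986093313536317168411093965101539413547470834509251987812507465%num));
(364, (2, 17204739684505432905876178388124727615090487970401421566819280921375921%num));
(388, (3, 14443281713048802368928539257620911824775289977088459729243971508591957%num));
(412, (3, 14443312286158330733990882864048743600103557796869625830619696207603079%num));
(412, (3, 14443312278118828857553772815592597519266490993306317071151967976767793%num));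
(412, (3, 14443099217751770869513296728203419433721645267118219267949909558358985%num));
(412, (3, 14443099209712268993076186679747273352884578463554910508482181327523699%num));
(412, (3, 14433724207863136832499506751009156112917493958056330510479296991618849%num));
(412, (3, 14433724199823634956062396702553010032080427154493021751011568760783563%num));
(412, (3, 14030385714245313376428951595810509151957075138643707376573169972548907%num));
(412, (3, 14030385706205811499991841547354363071120008335080398617105441741713621%num));
(412, (3, 14443312286158260073541275998759975284610074112767598088187035408239999%num));
(412, (3, 14443312278118862563649630759046882326468920291554797071849105414401357%num));
(412, (3, 14443099217751700209063689862914651118228161583016191525517248758995905%num));
(412, (3, 14443099209712302699172044623201558160087007761803390509179318765157263%num));
(412, (3, 14433724207863066172049899885720387797424010273954302768046636192255769%num));
(412, (3, 14433724199823668662158254646007294839282856452741501751708706198417127%num));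
(412, (3, 14030385714245242715979344730521740836463591454541679634140509173185827%num));
(412, (3, 14030385706205845206087699490808647878322437633328878617802579179347185%num));
(412, (3, 14443312044845405453426782039021694046355089472712788879915430343346005%num));
(412, (3, 14443312047525416419373152809799326899212085333878310986241033177929041%num));
(412, (3, 14443098976438845588949195903176369879973176942961382317245643694101911%num));
(412, (3, 14443098979118856554895566673954002732830172804126904423571246528684947%num));
(412, (3, 14433723966550211551935405925982106559169025633899493559775031127361775%num));
(412, (3, 14433723969230222517881776696759739412026021495065015666100633961944811%num));
(412, (3, 14030385472932388095864850770783459598208606814486870425868904108291833%num));
(412, (3, 14030385475612399061811221541561092451065602675652392532194506942874869%num));
(412, (3, 14443312044845334792977175179500468219422654992164304695985322940419549%num));
(412, (3, 14443312047525382713277294878435945383986005280014415380725355680748213%num));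
(412, (3, 14443098976438774928499589043655144053040742462412898133315536291175455%num));
(412, (3, 14443098979118822848799708742590621217604092750263008818055569031504119%num));
(412, (3, 14433723966550140891485799066460880732236591153351009375844923724435319%num));
(412, (3, 14433723969230188811785918765396357896799941441201120060584956464763983%num));
(412, (3, 14030385472932317435415243911262233771276172333938386241938796705365377%num));
(412, (3, 14030385475612365355715363610197710935839522621788496926678829445694041%num));
(412, (3, 14443311676993780624765132289830678574997975272707739131520848825403979%num));
(412, (3, 14443311685033847479570908669373576787295912926855972164463343234861501%num));
(412, (3, 14443098608587220760287546153985354408616062742956332568851062176159885%num));
(412, (3, 14443098616627287615093322533528252620914000397104565601793556585617407%num));
(412, (3, 14433723598698586723273756176791091087811911433894443811380449609419749%num));
(412, (3, 14433723606738653578079532556333989300109849088042676844322944018877271%num));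
(412, (3, 14030385105080763267203201021592444126851492614481820677474322590349807%num));
(412, (3, 14030385113120830122008977401135342339149430268630053710416816999807329%num));
(412, (3, 14443311676993814330860990233286523020515321025656824896484798589172515%num));
(412, (3, 14443311685033776837350656125265527205690580139518310742753244318052615%num));
(412, (3, 14443098608587254466383404097441198854133408495905418333815011939928421%num));
(412, (3, 14443098616627216972873069989420203039308667609766904180083457668808521%num));
(412, (3, 14433723598698620429369614120246935533329257186843529576344399373188285%num));
(412, (3, 14433723606738582935859280012225939718504516300705015422612845102068385%num));
(412, (3, 14030385105080796973299058965048288572368838367430906442438272354118343%num));
(412, (3, 14030385113120759479788724857027292757544097481292392288706718082998443%num));
(412, (3, 14443311561697091258722751255639239665191931098922973379413006226169795%num));
(412, (3, 14443311564377384866632895069280715525944909035748501460299434193675805%num));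
(412, (3, 14443098493290531394245165119793915498810018569171566816743219576925701%num));
(412, (3, 14443098495970825002155308933435391359562996505997094897629647544431711%num));
(412, (3, 14433723483401897357231375142599652178005867260109678059272607010185565%num));
(412, (3, 14433723486082190965141518956241128038758845196935206140159034977691575%num));
(412, (3, 14030384989784073901160819987401005217045448440697054925366479991115623%num));
(412, (3, 14030384992464367509070963801042481077798426377522583006252907958621633%num));
(412, (3, 14443311561697057552626893324274298511650934590358472009630516402853995%num));
(412, (3, 14443311564377314187953933888578770965124323925309561682675040508996943%num));
(412, (3, 14443098493290497688149307188428974345269022060607065446960729753609901%num));
(412, (3, 14443098495970754323476347752733446798742411395558155120005253859752849%num));
(412, (3, 14433723483401863651135517211234711024464870751545176689490117186869765%num));
(412, (3, 14433723486082120286462557775539183477938260086496266362534641293012713%num));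
(412, (3, 14030384989784040195064962056036064063504451932132553555583990167799823%num));
(412, (3, 14030384992464296830392002620340536516977841267083643228628514273942771%num))].
Definition leaves6 : seq (nat * (nat * N)) := [::
(1, (1, 2045839840984885938263634983041969974462134028386155349766945962238435%num));
(1, (0, 2045839840984885938263634983041969974462134028386155349766945962238435%num));
(1, (2, 10713927410216891948891384169175306012517514315998879348120464582278153%num));
(1, (0, 4965283821800906845668338568817323923093464468668569368588296458812611%num));
(1, (2, 13867125179821591382725120468024343611560146224516755915231104145655527%num));
(1, (0, 806998886588963411781423725886203519882269662512117136362656787071437%num));
(1, (1, 806998886588963411781423725886203519882269662512117136362656787071437%num));
(1, (1, 4965283821800906845668338568817323923093464468668569368588296458812611%num));
(1, (2, 12628284225425668874565756064246988541173740037317115768103103313053785%num));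
(1, (2, 9475086455623475011399439344617430993619430509624978559942380746594281%num));
(1, (0, 4523521751019399214460969204003344222395448954213458437710915826464533%num));
(1, (1, 4523521751019399214460969204003344222395448954213458437710915826464533%num));
(1, (2, 8902599418820485303421994753340531655851778448623733954145316688166293%num));
(1, (2, 8902812256758277799253167157981036153037506767218472800972587118339425%num));
(1, (2, 13477512138419005032721867046167135135343790795970657585510737783148191%num));
(1, (2, 10141653211546154050612861196799887365028233304176896093619088972191851%num));
(1, (2, 8925057796513538998399176135649841895093817977888066988043547950062821%num));
(1, (2, 11787544243975668392591132592909695441877614329458001971228869286948945%num));
(1, (2, 10154526506912906679239041860507138095750215665473061061708609059841371%num));
(1, (2, 11796701114948142852002190267646303685322494427513738389645603936713653%num));
(1, (2, 13477301259465482046468618802095983688665552284442510789084340058320171%num));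
(1, (2, 13463781614284399893124798625744940370394304212074881571909585597353207%num));
(1, (2, 8067399102704338547082513087055713555708884290892423230668297757376049%num));
(1, (2, 12219918168931734810669457656003595871321827134210914367076996842386571%num));
(1, (2, 12238460304937389873438389231116068574997449098974274979408630360399677%num));
(1, (2, 8080178251822765274302317572719742971288210062566496388929403542560121%num));
(1, (2, 8071021380850290814891259897983134727843329964510759970512668892795413%num));
(1, (2, 8916113763416570594056088747783307865052028145368567724858480378924515%num));
(1, (2, 12225366681075310245391500792527474178412929111630256579462793132669697%num));
(1, (2, 10154954717944662767086318318763222978720131330836803534534190073505715%num));
(1, (2, 12224940659496523641765104586926089158403577675116458279263083746840075%num));
(1, (2, 10150691506063596140749143873409946304758009586932753571243514295715825%num));
(1, (0, 6385738339917851175449038610787649736388003737877631125493151418012645%num));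
(1, (1, 6385738339917851175449038610787649736388003737877631125493151418012645%num));
(1, (0, 7260724190289569291638658574897451771890804337121119159737505427695533%num));
(1, (1, 7260724190289569291638658574897451771890804337121119159737505427695533%num));
(1, (1, 3072772109069539958562920402986559173657307917301363170907413263272295%num));
(1, (1, 7673447719254162223273860661419723996005145006501795691826235483556239%num));
(1, (1, 5146897385129974924058336676657076144544056242083015143213867006022151%num));
(1, (0, 1833931154281663707203226364170979290820906410224808920687972956840389%num));
(1, (1, 1833931154281663707203226364170979290820906410224808920687972956840389%num));
(1, (0, 11389970582441929747928098042525641953017876815595287236359613506743501%num));
(1, (1, 11389970582441929747928098042525641953017876815595287236359613506743501%num));
(1, (1, 10977247053477336816292895956003369728903536146214610704270883444204207%num));
(3, (1, 12238673259684686112864987602002271791550199711771360042542176632383895%num));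
(3, (1, 6785679838251662131179938266348825706327646742432509800390757013346343%num));
(3, (1, 6789088933816103054220178926747985492646711297682954115093355213862585%num));
(3, (1, 13858260311747541389653969800582112097998847658680824329705600438919143%num));
(3, (1, 5541292077240795331407342299046358952909967946667209758994097722868673%num));
(3, (1, 13861669405193016129896570881437768900309654010554462416172623254163385%num));
(3, (0, 12238673259684686112864987602002271791550199711771360042542176635723189%num));
(3, (0, 6785679838251662131179938266348825706327646742432509800390757016685637%num));
(3, (0, 6789088933816103054220178926747985492646711297682954115093355217201879%num));
(3, (1, 5537030707987791723124661937751870911263275655300461068018200282541213%num));
(3, (0, 5537030707987791723124661937751870911263275655300461068018200282541213%num));
(3, (1, 12234411890307037434987515832535287069828726154023429715459631737363953%num));
(7, (2, 8912187267341136750846871305757008777818320830453749719912772777359335%num));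
(7, (2, 8076689876682133814305071736166789289474438984568969786476552677911599%num));
(7, (2, 13632930159008670066543200562819844787563388352263220324101262995174469%num));
(7, (2, 2500680440549804911049931804462562162671663969642607937151785504363445%num));
(7, (2, 1408126216301724519217475942004274181779966557801463305707869336912131%num));
(7, (2, 2646754102291087144638892244340059315242790676771331622396725756284591%num));
(7, (2, 2646967055463280214336801629031227217169519486644832595990604937267339%num));
(7, (2, 12220007476126633310360575554183116621078622280782451873626926817769845%num));
(7, (2, 12393988028676837862702314668817062433460997020125241310077854285122343%num));
(7, (2, 13458848315288189005479901241206877839454976578908728910394010336824937%num));
(7, (2, 13633047006690712222660029233198371528602223517771120404575701341008093%num));
(7, (2, 11154936080225803041539892908953395704602338440139499309667536833108777%num));
(7, (2, 12219794292485706614551586423662192113241070931241367353122113343897399%num));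
(7, (2, 23130244417990050275257307132445247019275740998597066602060326320547%num));
(7, (2, 13537095613230925535335356672440849539976690026774110121039321901217%num));
(7, (2, 11155466388936973266257431971137053409184394668734148480434410323078807%num));
(7, (2, 2491518383637352563872914850325757274111765564888009630713768587228207%num));
(7, (2, 1252244262870163251714489517904914097218444210414215178784001402683835%num));
(7, (2, 11164623259909482215545089975065575653313397962661488108518992105740539%num));
(7, (2, 1252459405495865358139714094124869962136789078519759069765357311963941%num));
(7, (2, 1252596188729301649820666919084261220015854742999995813217894296638667%num));
(7, (2, 12403586132756829887558346381477765684147881662661325492840720881431695%num));
(12, (1, 11155466504109070464109175981323764772684820026022531593610741351557569%num));
(12, (1, 12394307458702452929944021092822159718204399648605558136860065812685037%num));
(12, (1, 9071747963289374025590947019349664223890096052746559981289945500324367%num));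
(12, (1, 10310588917685296533781553806454838034587489455363342796968515635377583%num));
(12, (2, 4124241697333948784928563231132037482428099064923232376990869988373737%num));
(12, (2, 4142555440132618595697356946392952639144577789286982559441040435916873%num));
(12, (2, 5363082651729871293087927634910987597745893696943302875347288002675475%num));
(12, (2, 5381396394788323614523260013259523471518864095279347224188395032936271%num));
(12, (2, 7014294979480966981212062274990639622218675534484355535409805137253289%num));
(12, (2, 7010375742284994868987647749186880915598163994435952903691470566020127%num));
(12, (2, 1833932999286925139090400749502313543290418673513798295179238542208891%num));
(12, (2, 1664873530751392016925661608768199552725096488689646283316847633781885%num));
(12, (2, 4124102724646872204985167100401663643333603296346436073306949212482241%num));
(12, (2, 2903714485147314525085026012547149668042891120709716781673265648083623%num));
(12, (2, 7014636995181758261606024085217793795027925606170963822868831453155655%num));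
(12, (2, 2885400742348644714316232297286234511326412396345966599223095197201193%num));
(12, (2, 1642724441140427617788963742262379363139263779096643471124059096828231%num));
(12, (2, 2904031840686365837192338461452707380547621346248134447399751086758577%num));
(12, (2, 13319187299505048407565158461393355443064579461985335795304183301705%num));
(12, (2, 22912336104298663086092062774496853504261874843166821759127651218245%num));
(12, (2, 9909977560112663212517252674489914120546162402539541876171661933041%num));
(12, (2, 173211644170097553784678965484566438156932182909567706318333325326949%num));
(12, (2, 7005043846376964646927497180904690296966728310789782336905007981899821%num));
(12, (2, 1646559787692939695490329230419663678952126090353601934475740606860383%num));
(13, (0, 5381926818796270651253200697788634338178324892918610579216217656773777%num));
(13, (1, 5381926818796270651253200697788634338178324892918610579216217656773777%num));
(13, (0, 11155466503521761816799691364404407428403704513714981233637316452075811%num));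
(13, (1, 11155466503521761816799691364404407428403704513714981233637316452075811%num));
(13, (1, 5128451585948193979949104159371519020414250943284703306652630226396981%num));
(13, (1, 4124241581971955508451125627075265474740967463986106959976593687707411%num));
(13, (1, 13458848315876085914163394481158767270679239447179279581245295074543939%num));
(13, (0, 7014731256921416612832359029202872582845010396369875019618912487716731%num));
(13, (1, 7014731256921416612832359029202872582845010396369875019618912487716731%num));
(13, (0, 10314424148938705769456605571211514608157485059976777179418340260476529%num));
(13, (1, 10314424148938705769456605571211514608157485059976777179418340260476529%num));
(13, (1, 2885400627637748825825408210711907427171662539365197187611946555167141%num));
(13, (1, 4714834709010737799115058820631576829840676325631779341989458432476657%num));
(13, (0, 4714834709010737799115058820631576829840676325631779341989458432476657%num));
(13, (1, 13200685067091647533827372775472187667799977802900789626772469710616651%num));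
(13, (0, 13200685067091647533827372775472187667799977802900789626772469710616651%num));
(13, (0, 14045562537758414001151992146682044335802327715795347068325293772694705%num));
(13, (1, 14045562537758414001151992146682044335802327715795347068325293772694705%num));
(13, (1, 3730141315071617077121121388299273463970059722100767599220520845505539%num));
(13, (1, 12215991671968465370512679346384818411541722248064834877242166144833349%num));
(13, (1, 6363276850832418489199343641786533265045946469323713218285774751573011%num));
(13, (1, 2491085217987602807027031422188670009366101559549920988620617440791605%num));
(13, (0, 3475993640502187020006868014067217202333113858167602402817332463330899%num));
(13, (1, 3475993640502187020006868014067217202333113858167602402817332463330899%num));
(13, (1, 11154934005418628246211153722759172463437414072850521979795960576995411%num));
(13, (1, 7010365601657665276252645016709681557876324062892626085118402261704517%num));
(13, (1, 5381396510085031428594202738662183275310936340637705410466331997946835%num));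
(13, (1, 3472191134631415680355738132741292670143473797214173956814073022504529%num));
(13, (0, 3472191134631415680355738132741292670143473797214173956814073022504529%num));
(13, (1, 4711031974914777329799338919844634178059773326929986360005957156154179%num));
(13, (0, 4711031974914777329799338919844634178059773326929986360005957156154179%num));
(13, (1, 14049260985843626705794391582586015701490934631898560052444277724656305%num));
(13, (0, 14049260985843626705794391582586015701490934631898560052444277724656305%num));
(13, (1, 10310056534751861779042032161412025228072272710765683648860685604172333%num));
(13, (1, 13200548168624415536803732295745802459920432688291752675004270116478059%num));
(13, (0, 13200548168624415536803732295745802459920432688291752675004270116478059%num))].

Definition seeds4 := next_level 4 false 4 (next_level 4 false 3 (next_level 4 false 2 (first_level 4 false) hints42) hints43) hints44.
Definition seeds6 := next_level 6 true 3 (next_level 6 true 2 (first_level 6 true) hints62) hints63.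

Lemma reaches1 n full : (if full then n = 6 else n = 4) -> reaches n full 1 (first_level n full).
Proof.
move=> nf; apply: (reaches_next nf _ (@reaches0 n full)); first by case: full nf => ->.
move=> T e; rewrite inE => /eqP -> he.
exists (normalise n (first_hint n e) e); first by right; exists (first_hint n e).
by apply: dedup_sub; [exact: eq_arrayP | exact: (map_f (fun T => normalise n (first_hint n T) T))].
Qed.
Lemma reaches_step n full K reps hs : (if full then n = 6 else n = 4) -> K < n ->
  reaches n full K reps -> reaches n full K.+1 (next_level n full K.+1 reps hs).
Proof. by move=> nf Kn h; apply: (reaches_next nf Kn h) => T e hT he; exact: (next_levelP K.+1 hs hT he). Qed.
Lemma reaches4 : reaches 4 false 4 seeds4.
Proof. do 3 (apply: reaches_step => //); exact: reaches1. Qed.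
Lemma reaches6 : reaches 6 true 3 seeds6.
Proof. do 2 (apply: reaches_step => //); exact: reaches1. Qed.

Lemma checks4 : check_seeds 4 search4 leaves4 0 seeds4.
Proof. vm_cast_no_check (erefl true). Qed.
Lemma checks6 : check_seeds 6 search6 leaves6 0 seeds6.
Proof. vm_cast_no_check (erefl true). Qed.
Lemma planes_no_extension : all no_extension planes.
Proof. vm_cast_no_check (erefl true). Qed.

Lemma plane_mem P : P \in [:: P1; P2; P3; P4] -> exists2 P', P' \in planes & P = [set:: [seq set_of_mask m | m <- P']].
Proof.
have -> : [:: P1; P2; P3; P4] = [seq lines_of l | l <- [:: P1_lines; P2_lines; P3_lines; P4_lines]] by [].
by case/mapP => l hl ->; exists (plane_masks l); [exact: map_f | rewrite lines_ofE].
Qed.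
Lemma mem_lines P' (l : line) : l \in [set:: [seq set_of_mask m | m <- P']] -> exists2 m, m \in P' & l = set_of_mask m.
Proof. by rewrite inE => /mapP. Qed.
Lemma plane_is_ppl P : P \in [:: P1; P2; P3; P4] -> is_ppl P /\ #|P| = 25.
Proof.
case/plane_mem => P' hP' ->; have [uP sP P7 P1'] := planeokP (allP planes_ok _ hP').
split; [split|].
- by move=> l /mem_lines [m mP ->]; have [] := P7 m mP.
- move=> l l' /mem_lines [m mP ->] /mem_lines [m' m'P ->] ne; apply: P1' => //.
  by apply: contra ne => /eqP ->.
rewrite cardsE -[RHS]sP -(size_map set_of_mask); apply/card_uniqP; rewrite map_inj_in_uniq // => a b aP bP e.
by rewrite -(set_of_maskK (proj2 (P7 a aP))) e set_of_maskK //; have [] := P7 b bP.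
Qed.
(** A line outside [P] would meet each line of [P] once, and the test found no 7-set doing so. *)
Lemma plane_max P (l : line) : P \in [:: P1; P2; P3; P4] -> is_ppl (l |: P) -> l \in P.
Proof.
case/plane_mem => P' hP' -> [c7 m1]; apply/negPn/negP => lP.
have := allP planes_no_extension _ hP'; rewrite /no_extension.
suff : mask_of l \in candidates P' all_points 7 by case: (candidates _ _ _).
have [uP sP P7 P1'] := planeokP (allP planes_ok _ hP').
have := @candidatesP P' all_points (mask_of l); rewrite size_positions_mask_of c7 ?setU11 //; apply.
  by move=> i /bit_mask_ofP [x _ ->]; rewrite all_pointsE bit_mask_of inE.
move=> m mP; rewrite -(set_of_maskK (proj2 (P7 m mP))) mask_of_land single_mask_of.
have mS : set_of_mask m \in [set:: [seq set_of_mask m | m <- P']] by rewrite inE map_f.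
have ne : l != set_of_mask m by apply/eqP => e; rewrite e mS in lP.
by rewrite (m1 l (set_of_mask m) (setU11 _ _) (setU1r l mS) ne).
Qed.

Lemma found_large (M : {set line}) : is_ppl M -> 25 <= #|M| ->
  exists (f : {perm pt}) (P : {set line}), P \in [:: P1; P2; P3; P4] /\ M = [set f @: l | l : line in P].
Proof.
move=> HM0 c0.
have [M' /maxsetP [/is_pplP HM hmax] sub] := maxset_exists (introT (is_pplP M) HM0).
have c25 : 25 <= #|M'| by apply: leq_trans c0 (subset_leq_card sub).
have n6 z : deg M' z != 6.
  apply/eqP => /(deg6_extend HM) [l lM /is_pplP hl].
  by have e := hmax _ hl (subsetUr _ _); move: lM; rewrite -e setU11.
have d57 z : deg M' z != 7 -> deg M' z <= 5.
  have := deg_le7 HM z; have := n6 z; move: (deg M' z) => d; clear; ssrlia.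
have [f [P [hP h]]] : found M'.
  have [z /eqP d7|no7] := pickP (fun z => deg M' z == 7); last first.
    (* An upper bound on degrees passes to sub-families, so exactly 25 lines can be kept. This would
       not do for a point of degree 7, where the degree itself has to be preserved. *)
    have [S sS cS] : exists2 S : {set line}, S \subset M' & #|S| = 25.
      exists [set:: take 25 (enum M')].
        by apply/subsetP => a; rewrite inE => /mem_take; rewrite mem_enum.
      by rewrite cardsE (card_uniqP _) ?take_uniq ?enum_uniq // size_takel // -cardE.
    apply: (found_sub sS); apply: (found_no_deg7 reaches4 checks4 (is_ppl_sub HM sS) cS) => x.
    apply: leq_trans (d57 x _); last by rewrite no7.
    apply: subset_leq_card; apply/subsetP => a; rewrite !inE => /andP [/(subsetP sS) -> ->] //.
  have [z' /andP [zz /eqP d7']|no] := pickP (fun z' => (z' != z) && (deg M' z' == 7)).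
    exact: (found_two_deg7 reaches6 checks6 HM c25 zz d7 d7').
  apply: (found_one_deg7 reaches4 checks4 HM c25 d7) => x xz; apply: d57.
  by have := no x; rewrite xz => /negbT.
have [[P7 P1'] cP] := plane_is_ppl hP.
pose fP := [set f @: l | l : line in P].
have fI := @perm_inj _ f.
have cf : #|fP| = 25 by rewrite card_imset //; exact: imset_inj.
have fM : fP \subset M' by apply/subsetP => _ /imsetP [l lP ->]; exact: h.
have eM : M' = fP.
  apply/eqP; rewrite eqEsubset fM andbT; apply/subsetP => m mM.
  (* Pulled back by [f], a line of [M'] extends the plane [P], hence belongs to it. *)
  pose l := (f^-1)%g @: m.
  have fl : f @: l = m.
    by rewrite /l imset_permM mulVg -[RHS]imset_id; apply: eq_imset => x; rewrite perm1.
  rewrite -fl; apply: imset_f; apply: (plane_max hP).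
  have sM : [set f @: a | a : line in l |: P] \subset M'.
    by apply/subsetP => _ /imsetP [a /setU1P [->|aP] ->]; [rewrite fl|apply: h].
  have := is_ppl_imset (f^-1)%g (is_ppl_sub HM sM).
  suff -> : [set (f^-1)%g @: b | b : line in [set f @: a | a : line in l |: P]] = l |: P by [].
  rewrite -imset_comp -[RHS]imset_id; apply: eq_imset => a /=.
  by rewrite imset_permM mulgV -[RHS]imset_id; apply: eq_imset => x; rewrite perm1.
(* [M'] has just 25 lines, and [M] is a subset with at least as many. *)
exists f, P; split=> //; rewrite -/fP -eM; apply/eqP; rewrite eqEcard sub.
by rewrite eM cf.
Qed.

Lemma pure_partial_large s (X : finType) (L : {set {set X}}) : pure_partial_plane 6 s L -> 25 <= s ->
  s = 25 /\ exists2 P, P \in [:: P1; P2; P3; P4] & ppp_isomorphic L P.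
Proof.
case=> cX cL c7 m1 s25.
pose phi (x : X) : pt := cast_ord cX (enum_rank x).
have phiI : injective phi by move=> x y /cast_ord_inj/enum_rank_inj.
have phiK : bijective phi by apply: inj_card_bij => //; rewrite card_ord cX.
pose M := [set phi @: l | l : {set X} in L].
have cM : #|M| = s by rewrite card_imset //; exact: imset_inj.
have HM : is_ppl M.
  split; first by move=> _ /imsetP [l lL ->]; rewrite card_imset // c7.
  move=> _ _ /imsetP [l lL ->] /imsetP [m mL ->] ne.
  rewrite -imsetI; last by move=> x y _ _; exact: phiI.
  by rewrite card_imset // m1 //; apply: contra ne => /eqP ->.
have [f [P [hP eM]]] : exists (f : {perm pt}) (P : {set line}),
    P \in [:: P1; P2; P3; P4] /\ M = [set f @: l | l : line in P].
  by apply: found_large; rewrite ?cM.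
split.
  by rewrite -cM eM card_imset; [have [] := plane_is_ppl hP | exact: imset_inj (@perm_inj _ f)].
exists P => //; pose psi x := (f^-1)%g (phi x).
have psiI : injective psi by move=> x y /perm_inj/phiI.
exists psi, (fun l : {set X} => psi @: l); split.
- by apply: inj_card_bij => //; rewrite card_ord cX.
- by move=> l m _ _; exact: imset_inj.
- rewrite (_ : [set psi @: l | l : {set X} in L] = [set (f^-1)%g @: m | m : line in M]); last first.
    rewrite /M -imset_comp; apply: eq_imset => l /=; by rewrite -imset_comp.
  rewrite eM -imset_comp -[RHS]imset_id; apply: eq_imset => a /=.
  by rewrite imset_permM mulgV -[RHS]imset_id; apply: eq_imset => x; rewrite perm1.
- by move=> x l _; rewrite mem_imset.
Qed.

Lemma plane_pure_partial P : P \in [:: P1; P2; P3; P4] -> pure_partial_plane 6 25 P.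
Proof. by move=> /plane_is_ppl [[c7 m1] c]; split=> //; rewrite card_ord. Qed.

Theorem theorem1 :
  [/\ (forall (s : nat) (X : finType) (L : {set {set X}}),
         pure_partial_plane 6 s L -> s <= 25),
      (exists (X : finType) (L : {set {set X}}), pure_partial_plane 6 25 L),
      [/\ pure_partial_plane 6 25 P1, pure_partial_plane 6 25 P2,
          pure_partial_plane 6 25 P3 & pure_partial_plane 6 25 P4]
    & forall (X : finType) (L : {set {set X}}),
        pure_partial_plane 6 25 L ->
        [\/ ppp_isomorphic L P1, ppp_isomorphic L P2,
            ppp_isomorphic L P3 | ppp_isomorphic L P4]].
Proof.
have hP i : i < 4 -> pure_partial_plane 6 25 (nth P1 [:: P1; P2; P3; P4] i).
  by move=> i4; apply: plane_pure_partial; exact: mem_nth.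
split.
- by move=> s X L h; rewrite leqNgt; apply/negP => s26; have [e _] := pure_partial_large h (ltnW s26); rewrite e in s26.
- by exists 'I_43, P1; exact: (hP 0).
- by split; [exact: (hP 0)|exact: (hP 1)|exact: (hP 2)|exact: (hP 3)].
move=> X L h; have [_ [P /(nthP P1) [i i4 <-]]] := pure_partial_large h (leqnn 25).
by case: i i4 => [|[|[|[|i]]]] //= _ iso; [constructor 1|constructor 2|constructor 3|constructor 4].
Qed.
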